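(* Let $(M,F)$ be a Finsler manifold, let $m\ge 1$ be an integer and let $\kappa_1,\dots,\kappa_m$ be real constants. Let $D$ be the Berwald-type connection on $\pi^*TM$ with constants $\kappa_1,\dots,\kappa_m$, i.e. the Finsler connection with compatible tensors $S=A+\kappa_1\dot A+\cdots+\kappa_m\overset{m}{A}$ and $T=0$. Then the hv-curvature of $D$ vanishes identically if and only if $F$ is a Berwald metric.
   Context: **Finsler structure.** $M$ is an $n$-dimensional $C^\infty$ manifold, $TM_0=TM\setminus\{0\}$, $\pi:TM_0\to M$ the projection. A Finsler structure is a function $F:TM\to[0,\infty)$ that is $C^\infty$ on $TM_0$, positively 1-homogeneous on the fibers, and such that $g_{ij}(x,y)=\frac12[F^2]_{y^iy^j}$ is positive definite on $TM_0$. $\pi^*TM$ is the pull-back of $TM$ over $TM_0$ (fiber over $v\in T_xM\setminus\{0\}$ is a copy of $T_xM$), with local frame $\partial_i|_v=(v,\partial/\partial x^i|_x)$ and canonical section $\ell_v=(v,v)/F(v)$. $g$ is the bundle metric on $\pi^*TM$ with $g(\partial_i,\partial_j)=g_{ij}$. The Cartan tensor $A$ is the symmetric trilinear form on $\pi^*TM$ with components $A_{ijk}=\frac14F\,[F^2]_{y^iy^jy^k}$. **Finsler connections.** $\rho:T(TM_0)\to\pi^*TM$ is the linear bundle map with $\rho(\partial/\partial x^i)=\partial_i$, $\rho(\partial/\partial y^i)=0$; the vertical space is $V_zTM=\ker\rho_z$. For a linear connection $D$ on the bundle $\pi^*TM$ put $\mu(\hat X)=D_{\hat X}(F\ell)$.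 $D$ is a Finsler connection if $\mu_z$ restricted to $V_zTM$ is an isomorphism onto the fiber of $\pi^*TM$ for every $z\in TM_0$; then $T_zTM_0=H_zTM\oplus V_zTM$ with horizontal space $H_zTM=\ker\mu_z$, and $\hat X=H\hat X+V\hat X$ denotes the decomposition. **Derivatives of $A$.** Let $\bar\ell$ be the horizontal vector field with $\rho(\bar\ell)=\ell$. Put $\overset{0}{A}=A$ and $$\overset{j+1}{A}(X,Y,Z)=\bar\ell\,\overset{j}{A}(X,Y,Z)-\overset{j}{A}(D_{\bar\ell}X,Y,Z)-\overset{j}{A}(X,D_{\bar\ell}Y,Z)-\overset{j}{A}(X,Y,D_{\bar\ell}Z);$$ write $\dot A=\overset{1}{A}$, $\ddot A=\overset{2}{A}$. **Connection with compatible tensors $S,T$.** $S,T$ are symmetric trilinear forms on $\pi^*TM$; define $T(X,Y)\in\pi^*TM$ by $g(T(X,Y),Z)=T(X,Y,Z)$. $D$ is the Finsler connection with compatible tensors $S,T$ if for all $\hat X,\hat Y,\hat Z$ tangent to $TM_0$ and sections $X,Y$ of $\pi^*TM$: (i) $D_{\hat X}\rho(\hat Y)-D_{\hat Y}\rho(\hat X)-\rho[\hat X,\hat Y]=F^{-1}T(\mu(\hat X),\rho(\hat Y))-F^{-1}T(\mu(\hat Y),\rho(\hat X))$; (ii) $(D_{\hat Z}g)(X,Y)=2A(\rho(\hat Z),X,Y)+2F^{-1}A(\mu(\hat Z),X,Y)-2S(\rho(\hat Z),X,Y)-2F^{-1}T(\mu(\hat Z),X,Y)$. (Such a connection exists and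 is unique for the $S,T$ considered here.) When $S$ involves $\overset{j}{A}$, these are formed with $D$ itself. **hv-curvature.** With $\Omega(\hat X,\hat Y)Z=D_{\hat X}D_{\hat Y}Z-D_{\hat Y}D_{\hat X}Z-D_{[\hat X,\hat Y]}Z$, the hv-curvature of $D$ is $P=\Omega(H\hat X,V\hat Y)$; it vanishes if $\Omega(H\hat X,V\hat Y)Z=0$ for all $\hat X,\hat Y,Z$. **Berwald metric.** $F$ is a Berwald metric if in every standard local coordinate system $(x^i,y^i)$ of $TM_0$ the Christoffel symbols $\Gamma^k_{ij}$ of the Chern connection (the connection with compatible tensors $S=A$, $T=0$), defined by $D_{\partial/\partial x^i}\partial_j=\Gamma^k_{ij}\partial_k$, depend on $x$ only.
   Formalization: The dimension of M is assumed different from 1: in dimension 1 the claim fails, e.g. M = R, F(x,y) = y for y > 0 and F(x,y) = -e^x y for y < 0 has vanishing hv-curvature, but its Chern Christoffel symbol depends on the sign of y. *)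

(* Defs.v *)
From HB Require Import structures.
From mathcomp Require Import all_boot all_order all_algebra.
From mathcomp Require Import all_classical all_reals all_analysis.

Set Implicit Arguments.
Unset Strict Implicit.
Unset Printing Implicit Defensive.

Import Order.TTheory GRing.Theory Num.Theory.
Import numFieldNormedType.Exports.

Local Open Scope classical_set_scope.
Local Open Scope ring_scope.

(* C^oo near [a]: all iterated directional derivatives exist and are (totally)
   differentiable on a neighbourhood of [a]. *)
Definition iter_derive (R : realType) (V W : normedModType R)
    (vs : seq V) (f : V -> W) : V -> W :=
  foldr (fun v g => fun a => 'D_v g a) f vs.

Definition smooth_near (R : realType) (V W : normedModType R)
    (f : V -> W) (a : V) : Prop :=
  \forall b \near a, forall vs : seq V, differentiable (iter_derive vs f) b.

Record chart (R : realType) (n : nat) (M : topologicalType) := Chart {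
  dom : set M ;
  coord : M -> 'rV[R]_n ;
  uncoord : 'rV[R]_n -> M ;
  chart_open_dom : open dom ;
  chart_open_im : open (coord @` dom) ;
  chartK : forall p, dom p -> uncoord (coord p) = p ;
  chart_cont : {within dom, continuous coord} ;
  chart_cont_inv : {within coord @` dom, continuous uncoord} }.

Section Transition.
Variables (R : realType) (n : nat) (M : topologicalType).
Local Notation V := 'rV[R]_n.

Definition trans (c c' : chart R n M) (x : V) : V := coord c' (uncoord c x).

(* The transition between the induced charts of the tangent bundle. *)
Definition ttrans (c c' : chart R n M) (u : V * V) : V * V :=
  (trans c c' u.1, 'D_(u.2) (trans c c') u.1).

Definition compatible (c c' : chart R n M) : Prop :=
  forall p, dom c p -> dom c' p -> smooth_near (trans c c') (coord c p).

End Transition.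

(* An n-dimensional smooth manifold with its maximal atlas.  The preferred chart
   [chart_at p] only serves to name the elements of the tangent space at p. *)
Record smoothManifold (R : realType) (n : nat) := SmoothManifold {
  carrier :> topologicalType ;
  mfd_hausdorff : hausdorff_space carrier ;
  mfd_second_countable : @second_countable carrier ;
  atlas : set (chart R n carrier) ;
  chart_at : carrier -> chart R n carrier ;
  atlas_chart_at : forall p, atlas (chart_at p) ;
  dom_chart_at : forall p, dom (chart_at p) p ;
  atlas_compatible : forall c c', atlas c -> atlas c' -> compatible c c' ;
  atlas_maximal : forall c,
    (forall c', atlas c' -> compatible c c' /\ compatible c' c) -> atlas c }.

(* A point of TM.  The fibre T_pM is a copy of R^n: [vec z] lists the components
   of the tangent vector in the chart [chart_at (base z)].  This is a separate
   record, not a product, so that it does not inherit the product topology, which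
   is not the topology of TM. *)
Record tangent_bundle (R : realType) (n : nat) (M : smoothManifold R n) :=
  TPoint { base : M ; vec : 'rV[R]_n }.

Section TangentBundle.
Variables (R : realType) (n : nat) (M : smoothManifold R n).
Local Notation V := 'rV[R]_n.
Local Notation TM := (tangent_bundle M).

(* Components in the chart c of a vector v of T_pM, and conversely. *)
Definition tcoord (c : chart R n M) (p : M) (v : V) : V :=
  'D_v (trans (chart_at p) c) (coord (chart_at p) p).

Definition tuncoord (c : chart R n M) (p : M) (y : V) : V :=
  'D_y (trans c (chart_at p)) (coord c p).

(* The standard coordinates (x,y) of TM induced by the chart c. *)
Definition Tcoord (c : chart R n M) (z : TM) : V * V :=
  (coord c (base z), tcoord c (base z) (vec z)).

Definition Tuncoord (c : chart R n M) (u : V * V) : TM :=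
  let p := uncoord c u.1 in TPoint p (tuncoord c p u.2).

Definition slit : set TM := [set z | vec z != 0].

(* T_z(TM) is a copy of R^n x R^n: the components (dx, dy) of a tangent vector
   in the standard coordinates induced by [chart_at (base z)].  The next two
   maps convert to and from the coordinates induced by another chart. *)
Definition TTcoord (c : chart R n M) (z : TM) (w : V * V) : V * V :=
  'D_w (ttrans (chart_at (base z)) c) (Tcoord (chart_at (base z)) z).

Definition TTuncoord (c : chart R n M) (z : TM) (w : V * V) : V * V :=
  'D_w (ttrans c (chart_at (base z))) (Tcoord c z).

Definition near_TM (z : TM) (P : TM -> Prop) : Prop :=
  let c := chart_at (base z) in
  \forall u \near Tcoord c z, P (Tuncoord c u).

(* Sections of pi^*TM and vector fields on TM_0, by their values: the fibre of
   pi^*TM over z is T_{base z}M.  They are total functions; only their germs at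
   points of TM_0 where they are smooth are ever used. *)
Definition section := TM -> V.
Definition vfield := TM -> V * V.

Definition section_rep (c : chart R n M) (X : section) (u : V * V) : V :=
  let z := Tuncoord c u in tcoord c (base z) (X z).

Definition vfield_rep (c : chart R n M) (X : vfield) (u : V * V) : V * V :=
  let z := Tuncoord c u in TTcoord c z (X z).

Definition smooth_fun (z : TM) (f : TM -> R) : Prop :=
  let c := chart_at (base z) in
  smooth_near (fun u => f (Tuncoord c u) : R^o) (Tcoord c z).

Definition smooth_section (z : TM) (X : section) : Prop :=
  let c := chart_at (base z) in smooth_near (section_rep c X) (Tcoord c z).

Definition smooth_vfield (z : TM) (X : vfield) : Prop :=
  let c := chart_at (base z) in smooth_near (vfield_rep c X) (Tcoord c z).

(* The derivative w(f) at z of a function f on TM. *)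
Definition act (z : TM) (w : V * V) (f : TM -> R) : R :=
  let c := chart_at (base z) in
  'D_w (fun u => f (Tuncoord c u) : R^o) (Tcoord c z).

Definition bracket (X Y : vfield) : vfield := fun z =>
  let c := chart_at (base z) in
  'D_(X z) (vfield_rep c Y) (Tcoord c z) - 'D_(Y z) (vfield_rep c X) (Tcoord c z).

(* rho(dx, dy) = dx, i.e. rho(d/dx^i) = d_i and rho(d/dy^i) = 0. *)
Definition rho (w : V * V) : V := w.1.

Definition rhof (X : vfield) : section := fun z => rho (X z).

(* Trilinear forms on pi^*TM, as operators on sections. *)
Definition tensor3 := section -> section -> section -> TM -> R.

End TangentBundle.

Section Finsler.
Variables (R : realType) (n : nat) (M : smoothManifold R n).
Local Notation V := 'rV[R]_n.
Local Notation TM := (tangent_bundle M).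

(* g_z(v,w) = 1/2 [F^2]_{y^i y^j} v^i w^j. *)
Definition fundamental (F : TM -> R) (z : TM) (v w : V) : R :=
  let F2 := fun y : V => F (TPoint (base z) y) ^+ 2 : R^o in
  2^-1 * 'D_v (fun y => 'D_w F2 y) (vec z).

(* A_z(v,w,t) = 1/4 F [F^2]_{y^i y^j y^k} v^i w^j t^k. *)
Definition cartan (F : TM -> R) (z : TM) (v w t : V) : R :=
  let F2 := fun y : V => F (TPoint (base z) y) ^+ 2 : R^o in
  4^-1 * F z * 'D_v (fun y => 'D_w (fun y' => 'D_t F2 y') y) (vec z).

Record finsler := Finsler {
  fin_fun :> TM -> R ;
  fin_ge0 : forall z, 0 <= fin_fun z ;
  fin_smooth : forall z, slit z -> smooth_fun z fin_fun ;
  fin_homo : forall (p : M) (v : V) (a : R), 0 < a ->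
    fin_fun (TPoint p (a *: v)) = a * fin_fun (TPoint p v) ;
  fin_posdef : forall z, slit z -> forall v, v != 0 ->
    0 < fundamental fin_fun z v v }.

(* A linear connection on pi^*TM over TM_0; [D z w X] is D_w X for w in
   T_z(TM_0) and X a section that is smooth near z. *)
Record connection := Connection {
  cov :> TM -> V * V -> section M -> V ;
  cov_linear : forall z, slit z -> forall X, smooth_section z X ->
    forall (a : R) (w w' : V * V),
    cov z (a *: w + w') X = a *: cov z w X + cov z w' X ;
  cov_add : forall z, slit z -> forall X Y,
    smooth_section z X -> smooth_section z Y -> forall w,
    cov z w (fun z' => X z' + Y z') = cov z w X + cov z w Y ;
  cov_leibniz : forall z, slit z -> forall f X,
    smooth_fun z f -> smooth_section z X -> forall w,
    cov z w (fun z' => f z' *: X z') = act z w f *: X z + f z *: cov z w X ;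
  cov_local : forall z, slit z -> forall X Y,
    smooth_section z X -> near_TM z (fun z' => X z' = Y z') -> forall w,
    cov z w X = cov z w Y ;
  cov_smooth : forall z, slit z -> forall (W : vfield M) X,
    smooth_vfield z W -> smooth_section z X ->
    smooth_section z (fun z' => cov z' (W z') X) }.

Variable F : finsler.

Definition ell : section M := fun z => (F z)^-1 *: vec z.

Section Connection.
Variable D : connection.

Definition covf (W : vfield M) (X : section M) : section M :=
  fun z => D z (W z) X.

Definition mu (z : TM) (w : V * V) : V := D z w (fun z' => F z' *: ell z').

Definition muf (W : vfield M) : section M := fun z => mu z (W z).

(* The vertical space at z is { (0, b) }. *)
Definition finsler_connection : Prop :=
  forall z, slit z -> bijective (fun b : V => mu z (0, b)).

Definition horizontal (z : TM) : set (V * V) := [set w | mu z w = 0].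
Definition vertical (z : TM) : set (V * V) := [set w | rho w = 0].

Definition hpart (W : vfield M) : vfield M :=
  fun z => get [set h | horizontal z h /\ vertical z (W z - h)].

Definition vpart (W : vfield M) : vfield M := fun z => W z - hpart W z.

Definition lbar : vfield M :=
  fun z => get [set w | horizontal z w /\ rho w = ell z].

Definition cartan_form : tensor3 M :=
  fun X Y Z z => cartan F z (X z) (Y z) (Z z).

Definition dot (B : tensor3 M) : tensor3 M := fun X Y Z z =>
  act z (lbar z) (B X Y Z)
  - B (covf lbar X) Y Z z - B X (covf lbar Y) Z z - B X Y (covf lbar Z) z.

Definition cartan_dot (j : nat) : tensor3 M := iter j dot cartan_form.

(* T(X,Y), determined by g(T(X,Y),Z) = T(X,Y,Z). *)
Definition raise (T : tensor3 M) (X Y : section M) : section M := fun z =>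
  get [set t | forall Z, smooth_section z Z ->
                 fundamental F z t (Z z) = T X Y Z z].

Definition cov_metric (W : vfield M) (X Y : section M) (z : TM) : R :=
  act z (W z) (fun z' => fundamental F z' (X z') (Y z'))
  - fundamental F z (covf W X z) (Y z) - fundamental F z (X z) (covf W Y z).

Definition torsion_eq (T : tensor3 M) : Prop :=
  forall z, slit z -> forall X Y : vfield M,
  smooth_vfield z X -> smooth_vfield z Y ->
  covf X (rhof Y) z - covf Y (rhof X) z - rho (bracket X Y z)
  = (F z)^-1 *: raise T (muf X) (rhof Y) z
    - (F z)^-1 *: raise T (muf Y) (rhof X) z.

Definition metric_eq (S T : tensor3 M) : Prop :=
  forall z, slit z -> forall (W : vfield M) (X Y : section M),
  smooth_vfield z W -> smooth_section z X -> smooth_section z Y ->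
  cov_metric W X Y z
  = 2 * cartan_form (rhof W) X Y z
    + 2 * (F z)^-1 * cartan_form (muf W) X Y z
    - 2 * S (rhof W) X Y z
    - 2 * (F z)^-1 * T (muf W) X Y z.

Definition has_compatible_tensors (S T : tensor3 M) : Prop :=
  [/\ finsler_connection, torsion_eq T & metric_eq S T].

Definition curvature (X Y : vfield M) (Z : section M) : section M := fun z =>
  covf X (covf Y Z) z - covf Y (covf X Z) z - covf (bracket X Y) Z z.

Definition hv_curvature_vanishes : Prop :=
  forall z, slit z -> forall (X Y : vfield M) (Z : section M),
  smooth_vfield z X -> smooth_vfield z Y -> smooth_section z Z ->
  curvature (hpart X) (vpart Y) Z z = 0.

(* Gamma^k_ij at the point of coordinates u = (x,y), defined by
   D_{d/dx^i} d_j = Gamma^k_ij d_k in the chart c. *)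
Definition christoffel (c : chart R n M) (i j k : 'I_n) (u : V * V) : R :=
  let z := Tuncoord c u in
  let ddx_i := TTuncoord c z (delta_mx 0 i, 0) in
  let d_j : section M := fun z' => tuncoord c (base z') (delta_mx 0 j) in
  tcoord c (base z) (D z ddx_i d_j) 0 k.

Definition tensor0 : tensor3 M := fun _ _ _ _ => 0.

Definition chern : Prop := has_compatible_tensors cartan_form tensor0.

Definition berwald_type_tensor (m : nat) (kappa : 'I_m -> R) : tensor3 M :=
  fun X Y Z z => cartan_form X Y Z z
                 + \sum_(j < m) kappa j * cartan_dot j.+1 X Y Z z.

Definition berwald_type (m : nat) (kappa : 'I_m -> R) : Prop :=
  has_compatible_tensors (berwald_type_tensor kappa) tensor0.

End Connection.

(* The Chern connection exists and is unique on TM_0, so that "exists" below just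
   names it. *)
Definition berwald_metric : Prop :=
  exists2 D : connection, chern D &
    forall c, atlas c -> forall (i j k : 'I_n) (x y y' : V),
    (coord c @` dom c) x -> y != 0 -> y' != 0 ->
    christoffel D c i j k (x, y) = christoffel D c i j k (x, y').

End Finsler.

(* Main.v *)
(* In a chart, a torsion-free connection with T = 0 is given by functions
   G(a, b) = Gamma^k_ij a^i b^j at each point (x, y), symmetric in a and b, and its
   hv-curvature is -dG/dy.  So the hv-curvature vanishes iff G depends on x only:
   for n >= 2 the punctured fibres are connected, and for n = 0 they are empty.

   Put L = kappa_1 A^(1) + ... + kappa_m A^(m).  Each A^(j) is symmetric and is
   killed by y, because D_lbar y = mu(lbar) = 0, so the same holds for L.  With
   delta_a = d/dx^a - G(a, y)^i d/dy^i, the metric equation says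
     delta_a g(b, c) - g(G(a, b), c) - g(b, G(a, c)) = -2 L(a, b, c),
   and b = c = y gives delta_a F^2 = 0.

   If G depends on x only, differentiating delta_a F^2 = 0 twice along the fibre
   gives the left-hand side above, so L = 0 and D is the Chern connection.

   Conversely let G0 be the coefficients of the Chern connection, depending on x
   only, and C = G - G0.  Permuting the indices in the difference of the two
   metric equations yields successively C(y, y) = 0, C(a, y) = 0 and
   g(C(a, b), c) = L(a, b, c).  Differentiating delta_a F^2 = 0 three times along
   the fibre, for G0, shows A^(1) = 0, since D and its Chern analogue agree in the
   direction lbar.  Hence all A^(j) with j >= 1, then L and C, vanish. *)
From HB Require Import structures.
From mathcomp Require Import all_boot all_order all_algebra.
From mathcomp Require Import all_classical all_reals all_analysis.
From mathcomp Require Import ring lra.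
Require Import Defs.

Set Implicit Arguments.
Unset Strict Implicit.
Unset Printing Implicit Defensive.

Import Order.TTheory GRing.Theory Num.Theory.
Import numFieldNormedType.Exports.

Local Open Scope classical_set_scope.
Local Open Scope ring_scope.

(** * Smooth functions on finite-dimensional spaces *)

(** The components of a tangent vector at p refer to the preferred chart of p, and this chart is the
    same along the whole fibre over p. The coefficients G are therefore taken in that chart only,
    where the coordinate changes at p are the identity. Other charts enter at the end, through the
    transformation law of the Christoffel symbols, whose inhomogeneous term depends on x only.

    The A^(j) are operators on sections; that their value at z depends only on the values of the
    sections at z is not established. Their symmetries are transferred instead to the covariant
    derivative of g, which is pointwise by construction, and G is compared with G0 there.

    The case n = 1 is excluded because a punctured fibre is then a pair of half-lines and F is only
    positively homogeneous. If F is a(x)y for y > 0 and b(x)|y| for y < 0, with a, b > 0, the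
    hv-curvature vanishes, but the Christoffel symbol is a'/a on one half-line and b'/b on the
    other. *)

Class findim (R : realType) (V : normedModType R) : Prop := FinDim {
  findim_basis : exists (k : nat) (e : 'I_k -> V) (l : 'I_k -> {linear V -> R^o}),
    (forall i, continuous (l i)) /\ forall v, v = \sum_i l i v *: e i }.

Section Differential.
Variable R : realType.
Implicit Types U V W : normedModType R.

(** The first-order expansion of [f] at [a] is also one of [g]; by uniqueness its linear part is the
    differential of [g]. *)
Lemma differentiable_ext V W (f g : V -> W) (a : V) :
  (\forall x \near a, f x = g x) -> differentiable f a -> differentiable g a.
Proof.
move=> fg df; have fga : f a = g a by exact: (nbhs_singleton fg).
have fg0 : \forall h \near (0 : V), f (h + a) = g (h + a).
  by move: fg; rewrite (near_shift 0 a) /=; apply: filterS => h /=; rewrite subr0.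
have E : g \o shift a = cst (g a) + 'd f a +o_ 0 id.
  have /diff_locallyP[_] := df => /eqaddoP Hf.
  apply/eqaddoP => e e0; move: (Hf e e0); apply: filterS2 fg0 => h /= Eh.
  by rewrite !fctE /= Eh fga.
have dcf : continuous ('d f a) by exact: diff_continuous.
have U := diff_unique dcf E.
by apply/diff_locallyP; rewrite U.
Qed.

Lemma linear_diff V W (f : V -> W) a : linear f -> continuous f -> differentiable f a.
Proof.
move=> lf cf; pose fl := GRing.isLinear.Build _ _ _ _ _ lf.
pose F : {linear V -> W} := HB.pack f fl.
exact: (@linear_differentiable _ _ _ F).
Qed.

Lemma derive_lin V W (f : V -> W) a v : linear f -> 'D_v f a = f v.
Proof.
move=> lf; rewrite /derive; apply: lim_near_cst => //.
near=> h; have h0 : h != 0 by near: h; exact: nbhs_dnbhs_neq.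
have := lf h v a => /= ->.
by rewrite addrK scalerA mulVf// scale1r.
Unshelve. all: by end_near. Qed.

Lemma differentiable_scale V W (k : V -> R^o) (f : V -> W) a :
  differentiable k a -> differentiable f a ->
  differentiable (fun x => k x *: f x) a /\
  forall v, 'D_v (fun x => k x *: f x) a = 'D_v k a *: f a + k a *: 'D_v f a.
Proof.
have bil : bilinear_for
    (GRing.Scale.Law.clone _ _ *:%R _) (GRing.Scale.Law.clone _ _ *:%R _)
    (@GRing.scale R W : R^o -> W -> W).
  split=> [u'|u] b x y /=; first by rewrite scalerDl scalerA.
  by rewrite scalerDr !scalerA mulrC.
pose BM := bilinear_isBilinear.Build R R^o W W _ _ (@GRing.scale R W : R^o -> W -> W) bil.
pose B : {bilinear R^o -> W -> W} := HB.pack (@GRing.scale R W : R^o -> W -> W) BM.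
have cB : continuous (fun p : R^o * W => B p.1 p.2).
  by move=> p; exact: scale_continuous.
move=> dk df.
have dp := differentiable_pair dk df.
have dB := @differentiable_bilin _ _ _ _ B (k a, f a) cB.
have dC : differentiable (fun x => k x *: f x) a.
  exact: (@differentiable_comp _ _ _ _ (fun x => (k x, f x)) (fun p => B p.1 p.2)).
split=> // v; rewrite deriveE// !deriveE//.
have -> : (fun x => k x *: f x) = (fun p => B p.1 p.2) \o (fun x => (k x, f x)) by [].
have -> : 'd ((fun p => B p.1 p.2) \o (fun x => (k x, f x))) a v =
    'd (fun p => B p.1 p.2) (k a, f a) ('d k a v, 'd f a v).
  by rewrite diff_comp//= diff_pair.
have -> : 'd (fun p => B p.1 p.2) (k a, f a) ('d k a v, 'd f a v) =
    B (k a) ('d f a v) + B ('d k a v) (f a).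
  by rewrite (@diff_bilin _ _ _ _ B (k a, f a) cB).
by rewrite addrC.
Qed.

Lemma derive_comp U V W (f : U -> V) (g : V -> W) a v :
  differentiable f a -> differentiable g (f a) ->
  'D_v (fun x => g (f x)) a = 'D_('D_v f a) g (f a).
Proof.
move=> df dg; have dC := differentiable_comp df dg.
rewrite !deriveE//; first by rewrite (_ : (fun x => g (f x)) = g \o f)// diff_comp.
Qed.

Lemma derive_add V W (f g : V -> W) a v : differentiable f a -> differentiable g a ->
  'D_v (fun x => f x + g x) a = 'D_v f a + 'D_v g a.
Proof. by move=> df dg; apply: deriveD; exact: diff_derivable. Qed.

Lemma differentiable_bigsum V W (I : Type) (r : seq I) (f : I -> V -> W) a :
  (forall i, differentiable (f i) a) ->
  differentiable (fun x => \sum_(i <- r) f i x) a /\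
  forall v, 'D_v (fun x => \sum_(i <- r) f i x) a = \sum_(i <- r) 'D_v (f i) a.
Proof.
move=> df; elim: r => [|i r [dr IH]].
  under eq_fun do rewrite big_nil; split; first exact: differentiable_cst.
  by move=> v; rewrite big_nil derive_cst.
have E : (fun x => \sum_(j <- i :: r) f j x) = f i + (fun x => \sum_(j <- r) f j x).
  by apply/funext => x; rewrite big_cons.
rewrite E; split; first exact: differentiableD.
by move=> v; rewrite big_cons deriveD ?IH//; exact: diff_derivable.
Qed.

Lemma derive_linear V W (f : V -> W) a : differentiable f a ->
  linear (fun v => 'D_v f a).
Proof. by move=> df k v w; rewrite !deriveE// linearP. Qed.

Lemma derive_pair U V W (f : U -> V) (g : U -> W) a v :
  differentiable f a -> differentiable g a ->
  'D_v (fun x => (f x, g x)) a = ('D_v f a, 'D_v g a).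
Proof.
move=> df dg; have dp := differentiable_pair df dg.
by rewrite !deriveE// diff_pair.
Qed.

(** Both sides are limits of the same difference quotients, so [g] may be any function. *)
Lemma derive_comp_linear U V W (L : U -> V) (g : V -> W) a v :
  linear L -> 'D_v (fun x => g (L x)) a = 'D_(L v) g (L a).
Proof.
move=> lL; rewrite /derive /=.
by under eq_fun do rewrite lL.
Qed.

Lemma derive_linear_comp U V W (f : U -> V) (L : V -> W) a v :
  linear L -> continuous L -> differentiable f a ->
  'D_v (fun x => L (f x)) a = L ('D_v f a).
Proof.
move=> lL cL df; rewrite derive_comp//; first exact: derive_lin.
exact: linear_diff.
Qed.

Lemma linear_findim_continuous V W {fV : findim V} (f : V -> W) :
  linear f -> continuous f.
Proof.
move=> lf; case: fV => -[k [e [l [cl El]]]].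
pose fl := GRing.isLinear.Build _ _ _ _ _ lf.
pose F : {linear V -> W} := HB.pack f fl.
have -> : f = fun v => \sum_i l i v *: f (e i).
  apply/funext => v; rewrite {1}(El v) -[f]/(F : V -> W) linear_sum.
  by apply: eq_bigr => i _; rewrite linearZ.
move=> x; apply: differentiable_continuous.
apply: (differentiable_bigsum _ _).1 => i.
apply: differentiableZl; exact: linear_differentiable.
Qed.

Lemma findim_linear_diff V W {fV : findim V} (f : V -> W) a :
  linear f -> differentiable f a.
Proof. by move=> lf; apply: linear_diff => //; exact: linear_findim_continuous. Qed.

Lemma linear_zero V W (f : V -> W) : linear f -> f 0 = 0.
Proof. by move=> lf; have := lf (-1) 0 0; rewrite scaler0 addr0 scaleN1r addNr. Qed.

Lemma linear_add V W (f : V -> W) x y : linear f -> f (x + y) = f x + f y.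
Proof. by move=> lf; have := lf 1 x y; rewrite !scale1r. Qed.

Lemma linear_scale V W (f : V -> W) k x : linear f -> f (k *: x) = k *: f x.
Proof. by move=> lf; have := lf k x 0; rewrite (linear_zero lf) !addr0. Qed.

Lemma linear_opp V W (f : V -> W) x : linear f -> f (- x) = - f x.
Proof. by move=> lf; rewrite -scaleN1r linear_scale// scaleN1r. Qed.

Lemma linear_bigsum V W (f : V -> W) (I : Type) (r : seq I) (g : I -> V) : linear f ->
  f (\sum_(i <- r) g i) = \sum_(i <- r) f (g i).
Proof.
move=> lf; elim: r => [|i r IH]; first by rewrite !big_nil linear_zero.
by rewrite !big_cons linear_add// IH.
Qed.

(** Expanding the first argument along a basis reduces the product rule to scalar multiples of the
    linear maps [B (e i)]; continuity comes from finite dimension. *)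
Lemma derive_bilinear U V1 V2 W {f1 : findim V1} {f2 : findim V2}
    (B : V1 -> V2 -> W) (f : U -> V1) (g : U -> V2) a :
  (forall x, linear (B x)) -> (forall y, linear (B^~ y)) ->
  differentiable f a -> differentiable g a ->
  differentiable (fun x => B (f x) (g x)) a /\
  forall v, 'D_v (fun x => B (f x) (g x)) a = B ('D_v f a) (g a) + B (f a) ('D_v g a).
Proof.
move=> lr ll df dg; case: (f1) => -[k [e [l [cl El]]]].
have -> : (fun x => B (f x) (g x)) = fun x => \sum_i l i (f x) *: B (e i) (g x).
  apply/funext => x; rewrite {1}(El (f x)) (linear_bigsum _ _ (ll (g x))).
  by apply: eq_bigr => i _; rewrite (linear_scale _ _ (ll (g x))).
have dl i : differentiable (fun x => l i (f x) : R^o) a.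
  by apply: differentiable_comp => //; exact: linear_differentiable.
have dB i : differentiable (fun x => B (e i) (g x)) a.
  by apply: differentiable_comp => //; exact: findim_linear_diff.
have ds i := differentiable_scale (dl i) (dB i).
have S := @differentiable_bigsum _ _ _ (index_enum _) _ a (fun i => (ds i).1).
split; first exact: S.1.
move=> v; rewrite S.2 (eq_bigr _ (fun i _ => (ds i).2 v)) big_split /=.
have Elin z w : B z w = \sum_i l i z *: B (e i) w.
  rewrite {1}(El z) (linear_bigsum _ _ (ll w)).
  by apply: eq_bigr => i _; rewrite (linear_scale _ _ (ll w)).
rewrite (Elin ('D_v f a)) (Elin (f a)); congr (_ + _); apply: eq_bigr => i _.
  rewrite (@derive_linear_comp _ _ _ f (l i))//; exact: linearP.
by rewrite (@derive_linear_comp _ _ _ g (B (e i)))//; exact: linear_findim_continuous.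
Qed.

End Differential.

Section Smooth.
Variable R : realType.
Implicit Types U V W : normedModType R.

Lemma findim_R : findim (R^o : normedModType R).
Proof.
split; exists 1%N, (fun _ => 1 : R^o), (fun _ => idfun : {linear R^o -> R^o}); split.
  by move=> i x; exact: cvg_id.
by move=> v; rewrite big_ord1 /=; rewrite -[LHS]mulr1.
Qed.

Lemma findim_rV n : findim ('rV[R]_n : normedModType R).
Proof.
pose lf (i : 'I_n) (v : 'rV[R]_n) : R^o := v 0 i.
have ll i : linear (lf i) by move=> k u v; rewrite /lf !mxE.
pose l i : {linear 'rV[R]_n -> R^o} :=
  HB.pack (lf i) (GRing.isLinear.Build _ _ _ _ _ (ll i)).
split; exists n, (fun i => delta_mx 0 i), l; split.
  by move=> i; exact: coord_continuous.
by move=> v; rewrite {1}[v]row_sum_delta.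
Qed.

Lemma findim_prod V W : findim V -> findim W -> findim ((V * W)%type : normedModType R).
Proof.
move=> [[k [e [l [cl El]]]]] [[k' [e' [l' [cl' El']]]]].
pose lf (i : 'I_(k + k')) (v : V * W) : R^o :=
  match fintype.split i with inl j => l j v.1 | inr j => l' j v.2 end.
have ll i : linear (lf i).
  by move=> c u v; rewrite /lf; case: (fintype.split i) => j; rewrite linearP.
pose L i : {linear (V * W)%type -> R^o} :=
  HB.pack (lf i) (GRing.isLinear.Build _ _ _ _ _ (ll i)).
split; exists (k + k')%N, (fun i => match fintype.split i with inl j => (e j, 0) | inr j => (0, e' j) end), L; split.
  move=> i x; rewrite /L /= /lf; case: (fintype.split i) => j.
    by apply: (@continuous_comp _ _ _ fst (l j)); [exact: cvg_fst|exact: cl].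
  by apply: (@continuous_comp _ _ _ snd (l' j)); [exact: cvg_snd|exact: cl'].
move=> v; rewrite big_split_ord /=.
rewrite (eq_bigr (fun i : 'I_k => (l i v.1 *: e i, 0 : W))); last first.
  by move=> i _; rewrite /lf (unsplitK (inl i)) -[LHS]/(_ *: _, _ *: _) scaler0.
rewrite [X in _ + X](eq_bigr (fun i : 'I_k' => (0 : V, l' i v.2 *: e' i))); last first.
  by move=> i _; rewrite /lf (unsplitK (inr i)) -[LHS]/(_ *: _, _ *: _) scaler0.
have E1 (r : seq 'I_k) (f : 'I_k -> V) : \sum_(i <- r) (f i, 0 : W) = (\sum_(i <- r) f i, 0).
  elim: r => [|i r IH]; first by rewrite !big_nil.
  by rewrite !big_cons IH -[LHS]/(_ + _, _ + _) addr0.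
have E2 (r : seq 'I_k') (f : 'I_k' -> W) : \sum_(i <- r) (0 : V, f i) = (0, \sum_(i <- r) f i).
  elim: r => [|i r IH]; first by rewrite !big_nil.
  by rewrite !big_cons IH -[LHS]/(_ + _, _ + _) addr0.
rewrite E1 E2 -[RHS]/(_ + _, _ + _) addr0 add0r -El -El'.
by case: v.
Qed.

(** A fixed set rather than a germ: all iterated derivatives then live on the same set, on which the
    coinduction below relies. *)
Definition smooth_on V W (A : set V) (f : V -> W) :=
  forall b, A b -> forall vs : seq V, differentiable (iter_derive vs f) b.

Lemma smooth_nearP V W (f : V -> W) a :
  smooth_near f a <-> exists A, [/\ open A, A a & smooth_on A f].
Proof.
split=> [|[A [oA Aa sA]]]; last first.
  by apply: filterS (open_nbhs_nbhs (conj oA Aa)) => b Ab vs; exact: sA.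
move=> H; have : nbhs a [set b | forall vs : seq V, differentiable (iter_derive vs f) b] by exact: H.
by rewrite nbhsE => -[A [oA Aa] AP]; exists A; split=> // b Ab vs; exact: AP.
Qed.

Lemma near_open V (A : set V) (P : V -> Prop) a :
  open A -> A a -> (forall x, A x -> P x) -> \forall x \near a, P x.
Proof. by move=> oA Aa AP; apply: filterS AP _; exact: open_nbhs_nbhs. Qed.

Lemma open_neq0 V : open [set y : V | y != 0].
Proof.
rewrite (_ : [set y : V | _] = ~` [set 0]); last by apply/seteqP; split=> y /= /eqP.
apply: closed_openC; apply: accessible_closed_set1.
by apply: hausdorff_accessible; exact: norm_hausdorff.
Qed.

Lemma iter_derive_ext V W (A : set V) (f g : V -> W) vs :
  open A -> (forall x, A x -> f x = g x) ->
  forall x, A x -> iter_derive vs f x = iter_derive vs g x.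
Proof.
move=> oA fg; elim: vs => [|v vs IH] x Ax; first exact: fg.
by apply: near_eq_derive; exact: (near_open oA Ax).
Qed.

Lemma smooth_on_ext V W (A : set V) (f g : V -> W) :
  open A -> (forall x, A x -> f x = g x) -> smooth_on A f -> smooth_on A g.
Proof.
move=> oA fg sf b Ab vs; apply: differentiable_ext (sf b Ab vs).
by apply: (near_open oA Ab) => x; exact: iter_derive_ext.
Qed.

Lemma smooth_onS V W (A B : set V) (f : V -> W) :
  B `<=` A -> smooth_on A f -> smooth_on B f.
Proof. by move=> BA sf b /BA; exact: sf. Qed.

Lemma smooth_on_diff V W (A : set V) (f : V -> W) x :
  smooth_on A f -> A x -> differentiable f x.
Proof. by move=> sf Ax; exact: (sf x Ax [::]). Qed.

Lemma smooth_on_derive V W (A : set V) (f : V -> W) v :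
  smooth_on A f -> smooth_on A ('D_v f).
Proof.
move=> sf b Ab vs.
have := sf b Ab (vs ++ [:: v]); rewrite /iter_derive foldr_cat.
by rewrite /=.
Qed.

(* Coinduction: a class of differentiable functions closed, up to equality on A,
   under directional derivatives consists of smooth functions. *)
Lemma smooth_on_coind V W (A : set V) (P : (V -> W) -> Prop) :
  open A -> (forall f, P f -> forall a, A a -> differentiable f a) ->
  (forall f v, P f -> exists2 g, P g & forall a, A a -> 'D_v f a = g a) ->
  forall f, P f -> smooth_on A f.
Proof.
move=> oA dP PD.
have key vs : forall f, P f -> exists2 g, P g &
    forall a, A a -> iter_derive vs f a = g a.
  elim: vs => [|v vs IH] f Pf; first by exists f.
  have [g Pg fg] := IH f Pf; have [h Ph gh] := PD g v Pg.
  exists h => // a Aa; rewrite -gh//=.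
  by apply: near_eq_derive; exact: (near_open oA Aa).
move=> f Pf b Ab vs; have [g Pg fg] := key vs f Pf.
apply: differentiable_ext (dP g Pg b Ab).
by apply: (near_open oA Ab) => x Ax; rewrite fg.
Qed.

Lemma smooth_on_cst V W (A : set V) (w : W) : open A -> smooth_on A (fun _ => w).
Proof.
move=> oA; apply: (@smooth_on_coind _ _ _ (fun f => exists w, f = fun _ => w)) => //;
  last by exists w.
  by move=> f [w' ->] a _; exact: differentiable_cst.
move=> f v [w' ->]; exists (fun _ => 0); first by exists 0.
by move=> a _; exact: derive_cst.
Qed.

Lemma smooth_on_lin V W (L : V -> W) (A : set V) :
  open A -> linear L -> continuous L -> smooth_on A L.
Proof.
move=> oA lL cL; apply: (@smooth_on_coind _ _ _
  (fun f => f = L \/ exists w, f = fun _ => w)) => //; last by left.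
  move=> f [->|[w' ->]] a _; last exact: differentiable_cst.
  exact: linear_diff.
move=> f v [->|[w' ->]].
  exists (fun _ => L v); first by right; exists (L v).
  by move=> a _; exact: derive_lin.
exists (fun _ => 0); first by right; exists 0.
by move=> a _; exact: derive_cst.
Qed.

Lemma smooth_on_add V W (A : set V) (f g : V -> W) : open A ->
  smooth_on A f -> smooth_on A g -> smooth_on A (fun x => f x + g x).
Proof.
move=> oA sf sg; apply: (@smooth_on_coind _ _ _ (fun h => exists f g,
  [/\ smooth_on A f, smooth_on A g & h = fun x => f x + g x])) => //;
  last by exists f, g.
  move=> h [f' [g' [sf' sg' ->]]] a Aa.
  by apply: differentiableD; exact: smooth_on_diff Aa.
move=> h v [f' [g' [sf' sg' ->]]]; exists (fun x => 'D_v f' x + 'D_v g' x).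
  by exists ('D_v f'), ('D_v g'); split=> //; exact: smooth_on_derive.
by move=> a Aa; apply: derive_add; exact: smooth_on_diff Aa.
Qed.

Lemma smooth_on_linear_comp U V W (A : set U) (f : U -> V) (L : V -> W) :
  open A -> linear L -> continuous L -> smooth_on A f -> smooth_on A (fun x => L (f x)).
Proof.
move=> oA lL cL sf; apply: (@smooth_on_coind _ _ _ (fun h => exists2 f,
  smooth_on A f & h = fun x => L (f x))) => //; last by exists f.
  move=> h [f' sf' ->] a Aa; apply: (differentiable_comp (smooth_on_diff sf' Aa)).
  exact: linear_diff.
move=> h v [f' sf' ->]; exists (fun x => L ('D_v f' x)).
  by exists ('D_v f') => //; exact: smooth_on_derive.
move=> a Aa; apply: derive_linear_comp => //; exact: smooth_on_diff Aa.
Qed.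

Lemma smooth_on_bigsum V W (A : set V) (I : Type) (r : seq I) (f : I -> V -> W) : open A ->
  (forall i, smooth_on A (f i)) -> smooth_on A (fun x => \sum_(i <- r) f i x).
Proof.
move=> oA sf; elim: r => [|i r IH].
  by under eq_fun do rewrite big_nil; exact: smooth_on_cst.
by under eq_fun do rewrite big_cons; exact: smooth_on_add.
Qed.

(** The derivative of a composite, a product or an inverse is a sum of products of functions of the
    same kinds. This closure contains all of them, so that it is stable under directional
    derivatives and the coinduction applies. The values are scalar in order that products make
    sense. *)
Inductive smooth_class V (A : set V) : (V -> R^o) -> Prop :=
| sc_base f : smooth_on A f -> smooth_class A f
| sc_comp U (fU : findim U) (B : set U) (g : U -> R^o) (h : V -> U) :
    (forall x, A x -> B (h x)) -> smooth_on B g -> smooth_on A h ->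
    smooth_class A (fun x => g (h x))
| sc_add f g : smooth_class A f -> smooth_class A g -> smooth_class A (fun x => f x + g x)
| sc_mul f g : smooth_class A f -> smooth_class A g ->
    smooth_class A (fun x => f x *: g x)
| sc_inv f : smooth_class A f -> (forall x, A x -> f x != 0) ->
    smooth_class A (fun x => (f x)^-1).

Lemma smooth_class_sum V (A : set V) (I : Type) (r : seq I) (f : I -> V -> R^o) :
  open A -> (forall i, smooth_class A (f i)) ->
  smooth_class A (fun x => \sum_(i <- r) f i x).
Proof.
move=> oA sf; elim: r => [|i r IH].
  by under eq_fun do rewrite big_nil; apply: sc_base; exact: smooth_on_cst.
by under eq_fun do rewrite big_cons; exact: sc_add.
Qed.

Lemma derive_inv V (f : V -> R^o) a v : f a != 0 -> differentiable f a ->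
  'D_v (fun x => (f x)^-1 : R^o) a = (- 'D_v f a) *: ((f a)^-1 *: (f a)^-1).
Proof.
move=> fa df; rewrite (@deriveV _ _ f)//; last exact: diff_derivable.
rewrite -exprVn expr2 scaleNr scaleNr; congr (- _).
by rewrite /GRing.scale /= mulrC.
Qed.

Lemma smooth_class_smooth V (A : set V) f : open A -> smooth_class A f -> smooth_on A f.
Proof.
move=> oA; apply: smooth_on_coind => //.
  move=> {}f; elim => {f} [f sf a Aa|U fU B g h AB sg sh a Aa|f g _ df _ dg a Aa
      |f g _ df _ dg a Aa|f _ df f0 a Aa].
  - exact: smooth_on_diff Aa.
  - apply: (differentiable_comp (smooth_on_diff sh Aa)).
    exact: smooth_on_diff (AB _ Aa).
  - by apply: differentiableD; [exact: df|exact: dg].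
  - exact: (differentiable_scale (df a Aa) (dg a Aa)).1.
  - by apply: differentiableV; [exact: df|exact: f0].
(* Differentiability is carried along with the derivative found in the class: the sum, product and
   quotient rules need it for the constituents of [f]. *)
move=> {}f v H; suff: smooth_class A f /\ (exists2 g, smooth_class A g &
  forall a, A a -> differentiable f a /\ 'D_v f a = g a).
  by move=> [_ [g sg fg]]; exists g => // a /fg[].
split=> //; elim: H => {f} [f sf|U fU B g h AB sg sh|f g sf [f' sf' Ef] sg [g' sg' Eg]
      |f g sf [f' sf' Ef] sg [g' sg' Eg]|f sf [f' sf' Ef] f0].
- exists ('D_v f); first by apply: sc_base; exact: smooth_on_derive.
  by move=> a Aa; split=> //; exact: smooth_on_diff Aa.
- have [[k [e [l [cl El]]]]] := fU.
  exists (fun x => \sum_i l i ('D_v h x) *: 'D_(e i) g (h x)).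
    apply: smooth_class_sum => // i; apply: sc_mul.
      apply: sc_base; apply: (@smooth_on_linear_comp _ _ _ A ('D_v h) (l i)) => //.
        exact: linearP.
      exact: smooth_on_derive.
    by apply: (@sc_comp _ _ _ fU B ('D_(e i) g)) => //; exact: smooth_on_derive.
  move=> a Aa; have dh := smooth_on_diff sh Aa.
  have dg := smooth_on_diff sg (AB _ Aa).
  split; first exact: differentiable_comp.
  rewrite (derive_comp _ dh dg) {1}(El ('D_v h a)).
  rewrite (linear_bigsum _ _ (derive_linear dg)).
  by apply: eq_bigr => i _; rewrite (linear_scale _ _ (derive_linear dg)).
- exists (fun x => f' x + g' x); first exact: sc_add.
  move=> a Aa; have [df Df] := Ef a Aa; have [dg Dg] := Eg a Aa.
  by split; [exact: differentiableD|rewrite derive_add// Df Dg].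
- exists (fun x => f' x *: g x + f x *: g' x).
    by apply: sc_add; apply: sc_mul.
  move=> a Aa; have [df Df] := Ef a Aa; have [dg Dg] := Eg a Aa.
  have [dfg Dfg] := differentiable_scale df dg.
  by split=> //; rewrite Dfg Df Dg.
- exists (fun x => (- f' x) *: ((f x)^-1 *: (f x)^-1)).
    apply: sc_mul; last by apply: sc_mul; exact: sc_inv.
    have -> : (fun x => - f' x) = (fun x => (fun _ => -1 : R^o) x *: f' x).
      by apply/funext => x; rewrite scaleN1r.
    by apply: sc_mul => //; apply: sc_base; exact: smooth_on_cst.
  move=> a Aa; have [df Df] := Ef a Aa; split.
    by apply: differentiableV => //; exact: f0.
  by rewrite derive_inv ?Df//; exact: f0.
Qed.

Lemma smooth_on_scale V W {fW : findim W} (A : set V) (k : V -> R^o) (f : V -> W) :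
  open A -> smooth_on A k -> smooth_on A f -> smooth_on A (fun x => k x *: f x).
Proof.
move=> oA sk sf; case: fW => -[n [e [l [cl El]]]].
apply: (@smooth_on_ext _ _ _ (fun x => \sum_i (k x *: l i (f x)) *: e i)) => //.
  move=> x Ax; rewrite [in RHS](El (f x)) scaler_sumr.
  by apply: eq_bigr => i _; rewrite scalerA.
apply: smooth_on_bigsum => // i.
apply: (@smooth_on_linear_comp _ _ _ _ (fun x => k x *: l i (f x)) (fun t : R^o => t *: e i)) => //.
- by move=> a b c; rewrite scalerDl scalerA.
- by move=> x; exact: scalel_continuous.
- apply: smooth_class_smooth => //; apply: sc_mul; apply: sc_base => //.
  apply: (@smooth_on_linear_comp _ _ _ A f (l i)) => //; exact: linearP.
Qed.

Lemma smooth_on_comp U V W {fV : findim V} {fW : findim W} (A : set U) (B : set V)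
    (f : U -> V) (g : V -> W) : open A -> (forall x, A x -> B (f x)) ->
  smooth_on B g -> open B -> smooth_on A f -> smooth_on A (fun x => g (f x)).
Proof.
move=> oA AB sg oB sf; case: fW => -[n [e [l [cl El]]]].
apply: (@smooth_on_ext _ _ _ (fun x => \sum_i l i (g (f x)) *: e i)) => //.
apply: smooth_on_bigsum => // i.
apply: (@smooth_on_linear_comp _ _ _ _ (fun x => l i (g (f x))) (fun t : R^o => t *: e i)) => //.
- by move=> a b c; rewrite scalerDl scalerA.
- by move=> x; exact: scalel_continuous.
- apply: smooth_class_smooth => //.
  apply: (@sc_comp _ _ _ fV B (fun y => l i (g y))) => //.
  apply: (@smooth_on_linear_comp _ _ _ B g (l i)) => //; exact: linearP.
Qed.

End Smooth.
#[global] Existing Instance findim_R.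
#[global] Existing Instance findim_rV.
#[global] Existing Instance findim_prod.

(** * Symmetry of second derivatives *)

Section Schwarz.
Variable R : realType.
Implicit Types U V W : normedModType R.

(** Restriction to a line, for use with the one-variable mean value theorem. *)
Lemma line_is_derive V W (f : V -> W) (v b : V) (s : R) :
  differentiable f (s *: v + b) ->
  differentiable (fun t : R => f (t *: v + b)) s /\
  is_derive s 1 (fun t : R => f (t *: v + b)) ('D_v f (s *: v + b)).
Proof.
move=> df.
have dl : differentiable (fun t : R => t *: v + b) s by [].
have dc : differentiable (fun t : R => f (t *: v + b)) s.
  exact: (@differentiable_comp _ _ _ _ (fun t : R => t *: v + b)).
split=> //; apply: DeriveDef; first exact: diff_derivable.
rewrite (@derive_comp _ _ _ _ (fun t : R => t *: v + b))//; congr ('D__ f _).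
rewrite (@derive_add _ _ _ (fun t : R => t *: v) (fun=> b))//.
rewrite derive_cst addr0 (@derive_lin _ _ _ (fun t : R => t *: v)) ?scale1r//.
by move=> k x y; rewrite scalerDl scalerA.
Qed.

Lemma second_difference V (f : V -> R^o) (a v w : V) (eta : R) : 0 < eta ->
  (\forall x \near a, differentiable f x) -> differentiable ('D_v f) a ->
  exists2 d, 0 < d & forall t, 0 < t < d ->
  `|f (t *: v + t *: w + a) - f (t *: v + a) - f (t *: w + a) + f a
    - t ^+ 2 * 'D_w ('D_v f) a| <= eta * t ^+ 2 * (2 * `|v| + `|w|).
Proof.
move=> eta0 df dP; set P := 'D_v f.
have /diff_locallyP[_ /eqaddoP /(_ _ eta0)] := dP => HP.
have df0 : \forall h \near (0 : V), differentiable f (h + a).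
  by move: df; rewrite (near_shift 0 a) /=; apply: filterS => h /=; rewrite subr0.
have [d0 /= d00 Hd] := (nbhs_ballP _ _).1 (filterI HP df0).
have {}Hd h : `|h| < d0 -> `|P (h + a) - P a - 'd P a h| <= eta * `|h| /\
    differentiable f (h + a).
  move=> hd; have [] := Hd h; first by rewrite -ball_normE /= sub0r normrN.
  by move=> H1 H2; split=> //; move: H1; rewrite !fctE /= opprD addrA.
(* The displacements that occur have norm at most t times [C]; the summand 1 makes [C] positive. *)
pose C := `|v| + `|w| + 1; have C0 : 0 < C by rewrite ltr_wpDl// addr_ge0.
exists (d0 / C); first exact: divr_gt0.
move=> t /andP[t0]; rewrite ltr_pdivlMr// => tC.
have bnd s : 0 <= s <= t -> `|s *: v + t *: w| < d0 /\ `|s *: v| < d0.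
  move=> /andP[s0 st]; have sv : `|s *: v| <= t * `|v|.
    by rewrite normrZ ger0_norm// ler_wpM2r.
  have tw : `|t *: w| = t * `|w| by rewrite normrZ gtr0_norm.
  split.
    apply: le_lt_trans tC; rewrite (le_trans (ler_normD _ _))// tw /C !mulrDr.
    by rewrite mulr1 -addrA lerD// lerDl ltW.
  apply: le_lt_trans tC; rewrite (le_trans sv)// /C !mulrDr mulr1 -addrA lerDl.
  by rewrite addr_ge0 ?mulr_ge0// ltW.
(* The increment of [f] along t w, seen as a function of the position along [v]; the second
   difference is phi t - phi 0. *)
pose phi (s : R) : R := f (s *: v + (t *: w + a)) - f (s *: v + a).
have dphi (s : R) : 0 <= s <= t -> differentiable phi s /\
    is_derive s 1 phi (P (s *: v + (t *: w + a)) - P (s *: v + a)).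
  move=> st; have [b1 b2] := bnd s st.
  have d1 : differentiable f (s *: v + (t *: w + a)) by rewrite addrA; exact: (Hd _ b1).2.
  have [D1 D1'] := line_is_derive d1.
  have [D2 D2'] := line_is_derive (Hd _ b2).2.
  split; first exact: differentiableB.
  exact: is_deriveB.
have dphi' (s : R) : s \in `]0, t[%R ->
    is_derive s 1 phi (P (s *: v + (t *: w + a)) - P (s *: v + a)).
  by rewrite in_itv /= => /andP[s0 st]; apply: (dphi s _).2; rewrite !ltW.
have cphi : {within `[0, t], continuous phi}.
  apply: continuous_in_subspaceT => s; rewrite inE /= in_itv /= => st.
  exact: differentiable_continuous (dphi s st).1.
have [c] := MVT t0 dphi' cphi.
rewrite in_itv /= => /andP[c0 ct]; rewrite subr0 => E.
have ct' : 0 <= c <= t by rewrite (ltW c0) (ltW ct).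
have [b1 b2] := bnd c ct'.
have [+ _] := Hd _ b1; have [+ _] := Hd _ b2; rewrite linearD => H2 H1.
have -> : f (t *: v + t *: w + a) - f (t *: v + a) - f (t *: w + a) + f a = phi t - phi 0.
  by rewrite /phi scale0r !add0r !addrA opprB; rewrite -!addrA [_ + f a]addrC.
rewrite E.
have -> : 'D_w P a = t^-1 * 'd P a (t *: w).
  by rewrite linearZ /= deriveE// mulrA mulVf ?gt_eqF// mul1r.
set X := P (c *: v + (t *: w + a)); set Y := P (c *: v + a).
have -> : (X - Y) * t - t ^+ 2 * (t^-1 * 'd P a (t *: w)) =
  t * ((X - P a - ('d P a (c *: v) + 'd P a (t *: w))) - (Y - P a - 'd P a (c *: v))).
  have {}E : t ^+ 2 * (t^-1 * 'd P a (t *: w)) = t * 'd P a (t *: w).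
    by rewrite expr2 -mulrA mulVKf// gt_eqF.
  by rewrite E; ring.
rewrite normrM gtr0_norm// -!mulrA mulrCA ler_pM2l//.
rewrite (le_trans (ler_normB _ _))//.
have {}H1 : `|X - P a - ('d P a (c *: v) + 'd P a (t *: w))| <=
    eta * `|c *: v + t *: w| by rewrite /X addrA.
have N2 : `|c *: v| <= t * `|v| by rewrite normrZ (gtr0_norm c0) ler_wpM2r// ltW.
have N1 : `|c *: v + t *: w| <= t * `|v| + t * `|w|.
  by rewrite (le_trans (ler_normD _ _))// lerD// normrZ gtr0_norm.
have M1 := ler_wpM2l (ltW eta0) N1; have M2 := ler_wpM2l (ltW eta0) N2.
apply: (le_trans (lerD H1 H2)); apply: (le_trans (lerD M1 M2)).
by rewrite le_eqVlt; apply/orP; left; apply/eqP; ring.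
Qed.

(** The second difference is symmetric in [v] and [w], so it approximates t^2 times either mixed
    derivative. *)
Lemma schwarz_scalar V (f : V -> R^o) (a v w : V) :
  (\forall x \near a, differentiable f x) ->
  differentiable ('D_v f) a -> differentiable ('D_w f) a ->
  'D_v ('D_w f) a = 'D_w ('D_v f) a.
Proof.
move=> df dv dw; apply/eqP; rewrite -subr_eq0 -normr_le0; apply/ler_addgt0Pl => e e0.
(* The sum of the two error constants, (2|v| + |w|) + (2|w| + |v|), plus 1 so that one can divide by
   it. *)
rewrite addr0; set C := 3 * (`|v| + `|w|) + 1.
have C0 : 0 < C by rewrite ltr_wpDl// mulr_ge0// addr_ge0.
have eC : 0 < e / C by exact: divr_gt0.
have [d1 d10 H1] := second_difference w eC df dv.
have [d2 d20 H2] := second_difference v eC df dw.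
pose t := Num.min d1 d2 / 2.
have m0 : 0 < Num.min d1 d2 by rewrite lt_min d10.
have t0 : 0 < t by exact: divr_gt0.
have tm : t < Num.min d1 d2 by rewrite /t ltr_pdivrMr// mulr_natr mulr2n ltrDl.
have := H1 t; have := H2 t; rewrite t0.
move: tm; rewrite lt_min => /andP[-> ->] /(_ isT) K2 /(_ isT) K1.
rewrite (addrC (t *: w) (t *: v)) in K2.
move: K1 K2; set A := f (t *: v + t *: w + a); set B := f (t *: v + a).
set G := f (t *: w + a); set X := 'D_w ('D_v f) a; set Y := 'D_v ('D_w f) a.
move=> K1 K2; have tt : 0 < t ^+ 2 by exact: exprn_gt0.
have K : `|t ^+ 2 * (Y - X)| <= e / C * t ^+ 2 * C.
  have -> : t ^+ 2 * (Y - X) = (A - B - G + f a - t ^+ 2 * X) - (A - G - B + f a - t ^+ 2 * Y).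
    by rewrite mulrBr; ring.
  rewrite (le_trans (ler_normB _ _))// (le_trans (lerD K1 K2))// -mulrDr ler_wpM2l//.
    by rewrite mulr_ge0// ltW.
  have -> : 2 * `|v| + `|w| + (2 * `|w| + `|v|) = C - 1 by rewrite /C; ring.
  by rewrite gerBl.
move: K; rewrite normrM (gtr0_norm tt) (mulrAC (e / C)) divfK ?gt_eqF//.
by rewrite mulrC ler_pM2r.
Qed.

End Schwarz.

(** * Calculus of smooth germs *)

Section SmoothNear.
Variable R : realType.
Implicit Types U V W : normedModType R.

Lemma smooth_near_ext V W (f g : V -> W) a :
  (\forall x \near a, f x = g x) -> smooth_near f a -> smooth_near g a.
Proof.
move=> fg /smooth_nearP[A [oA Aa sA]].
have : nbhs a [set x | f x = g x] by exact: fg.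
rewrite nbhsE => -[B [oB Ba] BP]; apply/smooth_nearP; exists (A `&` B).
split=> //; first exact: openI.
apply: (@smooth_on_ext _ _ _ _ f); first exact: openI.
  by move=> x [_ Bx]; exact: BP.
by apply: smooth_onS sA => x [].
Qed.

Lemma smooth_near_diff V W (f : V -> W) a : smooth_near f a -> differentiable f a.
Proof. by case/smooth_nearP => A [oA Aa sA]; exact: smooth_on_diff Aa. Qed.

Lemma smooth_near_cont V W (f : V -> W) a : smooth_near f a -> {for a, continuous f}.
Proof. by move=> /smooth_near_diff; exact: differentiable_continuous. Qed.

Lemma smooth_near_near V W (f : V -> W) a : smooth_near f a ->
  \forall x \near a, smooth_near f x.
Proof.
case/smooth_nearP => A [oA Aa sA]; apply: (near_open oA Aa) => x Ax.
by apply/smooth_nearP; exists A.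
Qed.

Lemma smooth_near_derive V W (f : V -> W) a v : smooth_near f a -> smooth_near ('D_v f) a.
Proof.
case/smooth_nearP => A [oA Aa sA]; apply/smooth_nearP; exists A; split=> //.
exact: smooth_on_derive.
Qed.

Lemma smooth_near_cst V W (w : W) (a : V) : smooth_near (fun _ => w) a.
Proof. by apply/smooth_nearP; exists setT; split=> //; [exact: openT|apply: smooth_on_cst; exact: openT]. Qed.

Lemma smooth_near_lin V W {fV : findim V} (L : V -> W) (a : V) : linear L -> smooth_near L a.
Proof.
move=> lL; apply/smooth_nearP; exists setT; split=> //; first exact: openT.
by apply: smooth_on_lin => //; [exact: openT|exact: linear_findim_continuous].
Qed.

Lemma smooth_near_add V W (f g : V -> W) a :
  smooth_near f a -> smooth_near g a -> smooth_near (fun x => f x + g x) a.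
Proof.
move=> /smooth_nearP[A [oA Aa sA]] /smooth_nearP[B [oB Ba sB]].
apply/smooth_nearP; exists (A `&` B); split=> //; first exact: openI.
apply: smooth_on_add; first exact: openI.
  by apply: smooth_onS sA => x [].
by apply: smooth_onS sB => x [].
Qed.

Lemma smooth_near_bigsum V W (I : Type) (r : seq I) (f : I -> V -> W) a :
  (forall i, smooth_near (f i) a) -> smooth_near (fun x => \sum_(i <- r) f i x) a.
Proof.
move=> sf; elim: r => [|i r IH].
  by under eq_fun do rewrite big_nil; exact: smooth_near_cst.
by under eq_fun do rewrite big_cons; exact: smooth_near_add.
Qed.

Lemma smooth_near_linear_comp U V W {fV : findim V} (f : U -> V) (L : V -> W) a :
  linear L -> smooth_near f a -> smooth_near (fun x => L (f x)) a.
Proof.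
move=> lL /smooth_nearP[A [oA Aa sA]]; apply/smooth_nearP; exists A; split=> //.
by apply: smooth_on_linear_comp => //; exact: linear_findim_continuous.
Qed.

Lemma smooth_near_scale V W {fW : findim W} (k : V -> R^o) (f : V -> W) a :
  smooth_near k a -> smooth_near f a -> smooth_near (fun x => k x *: f x) a.
Proof.
move=> /smooth_nearP[A [oA Aa sA]] /smooth_nearP[B [oB Ba sB]].
apply/smooth_nearP; exists (A `&` B); split=> //; first exact: openI.
apply: smooth_on_scale; first exact: openI.
  by apply: smooth_onS sA => x [].
by apply: smooth_onS sB => x [].
Qed.

Lemma smooth_near_opp V W {fW : findim W} (f : V -> W) a :
  smooth_near f a -> smooth_near (fun x => - f x) a.
Proof.
by move=> sf; apply: (@smooth_near_linear_comp _ _ _ fW f -%R) => // k x y; rewrite opprD scalerN.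
Qed.

Lemma smooth_near_comp U V W {fV : findim V} {fW : findim W}
    (f : U -> V) (g : V -> W) a :
  smooth_near f a -> smooth_near g (f a) -> smooth_near (fun x => g (f x)) a.
Proof.
move=> sf; have cf := smooth_near_cont sf; move: sf.
move=> /smooth_nearP[A [oA Aa sA]] /smooth_nearP[B [oB Ba sB]].
have : nbhs a (f @^-1` B) by apply: cf; exact: open_nbhs_nbhs.
rewrite nbhsE => -[C [oC Ca] CB].
apply/smooth_nearP; exists (A `&` C); split=> //; first exact: openI.
apply: (@smooth_on_comp _ _ _ _ _ _ _ B) => //; first exact: openI.
  by move=> x [_ /CB].
by apply: smooth_onS sA => x [].
Qed.

Lemma smooth_near_inv V (f : V -> R^o) a : f a != 0 -> smooth_near f a ->
  smooth_near (fun x => (f x)^-1 : R^o) a.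
Proof.
move=> fa sf; have cf := smooth_near_cont sf; move: sf => /smooth_nearP[A [oA Aa sA]].
have : nbhs a (f @^-1` [set y | y != 0]).
  by apply: cf; apply: open_nbhs_nbhs; split=> //; exact: open_neq.
rewrite nbhsE => -[C [oC Ca] CB].
apply/smooth_nearP; exists (A `&` C); split=> //; first exact: openI.
apply: smooth_class_smooth; first exact: openI.
apply: sc_inv; last by move=> x [_ /CB].
by apply: sc_base; apply: smooth_onS sA => x [].
Qed.

Lemma smooth_near_pair U V W {fV : findim V} {fW : findim W} (f : U -> V) (g : U -> W) a :
  smooth_near f a -> smooth_near g a -> smooth_near (fun x => (f x, g x)) a.
Proof.
move=> sf sg; have -> : (fun x => (f x, g x)) = fun x => (f x, 0) + (0, g x).
  by apply/funext => x; rewrite -[RHS]/(_ + _, _ + _) addr0 add0r.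
apply: smooth_near_add.
  apply: (@smooth_near_linear_comp _ _ _ fV f (fun x => (x, 0 : W))) => // k x y.
  by rewrite -[RHS]/(k *: x + y, k *: 0 + 0) scaler0 addr0.
apply: (@smooth_near_linear_comp _ _ _ fW g (fun x => (0 : V, x))) => // k x y.
by rewrite -[RHS]/(k *: 0 + 0, k *: x + y) scaler0 addr0.
Qed.

Lemma derive_expand V W (k : nat) (e : 'I_k -> V) (l : 'I_k -> {linear V -> R^o})
    (g : V -> W) x v : (forall v, v = \sum_i l i v *: e i) -> differentiable g x ->
  'D_v g x = \sum_i l i v *: 'D_(e i) g x.
Proof.
move=> El dg; rewrite {1}(El v) (linear_bigsum _ _ (derive_linear dg)).
by apply: eq_bigr => i _; rewrite (linear_scale _ _ (derive_linear dg)).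
Qed.

(** A derivative in a variable direction is a finite sum of derivatives in fixed directions with
    smooth coefficients. This expansion is the main use of [findim]. *)
Lemma smooth_near_dir U V W {fV : findim V} {fW : findim W} (g : V -> W) (phi v : U -> V) a :
  smooth_near g (phi a) -> smooth_near phi a -> smooth_near v a ->
  smooth_near (fun u => 'D_(v u) g (phi u)) a.
Proof.
move=> sg sp sv; have [[k [e [l [cl El]]]]] := fV.
apply: (@smooth_near_ext _ _ (fun u => \sum_i l i (v u) *: 'D_(e i) g (phi u))).
  have N : \forall u \near a, smooth_near g (phi u).
    exact: smooth_near_cont sp _ (smooth_near_near sg).
  apply: filterS N => u su.
  by rewrite (derive_expand _ El)//; exact: smooth_near_diff.
apply: smooth_near_bigsum => i; apply: smooth_near_scale.
  apply: (@smooth_near_linear_comp _ _ _ fV v (l i)) => //; first exact: (linearP (l i)).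
by apply: (@smooth_near_comp _ _ _ _ _ phi ('D_(e i) g)) => //; exact: smooth_near_derive.
Qed.

(** After expansion in a basis, the product rule gives one term for the change of direction and one
    for the displacement of the base point, with the direction frozen at [v a]. *)
Lemma derive_dir U V W {fV : findim V} {fW : findim W} (g : V -> W) (phi v : U -> V) a w :
  smooth_near g (phi a) -> differentiable phi a -> differentiable v a ->
  'D_w (fun u => 'D_(v u) g (phi u)) a =
  'D_('D_w v a) g (phi a) + 'D_('D_w phi a) ('D_(v a) g) (phi a).
Proof.
move=> sg sp sv; have [[k [e [l [cl El]]]]] := fV.
have E : \forall u \near a, 'D_(v u) g (phi u) = \sum_i l i (v u) *: 'D_(e i) g (phi u).
  have N : \forall u \near a, smooth_near g (phi u).
    exact: differentiable_continuous sp _ (smooth_near_near sg).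
  apply: filterS N => u su.
  by rewrite (derive_expand _ El)//; exact: smooth_near_diff.
rewrite (near_eq_derive _ E).
have dl i : differentiable (fun u => l i (v u) : R^o) a.
  by apply: differentiable_comp => //; exact: linear_differentiable.
have dde i : differentiable ('D_(e i) g) (phi a).
  by apply: smooth_near_diff; exact: smooth_near_derive.
have dD i : differentiable (fun u => 'D_(e i) g (phi u)) a.
  exact: (@differentiable_comp _ _ _ _ phi ('D_(e i) g)).
have dS i := differentiable_scale (dl i) (dD i).
rewrite (@differentiable_bigsum _ _ _ _ (index_enum _) _ a (fun i => (dS i).1)).2.
rewrite (eq_bigr _ (fun i _ => (dS i).2 w)) big_split /=; congr (_ + _).
  rewrite (derive_expand _ El); last exact: smooth_near_diff.
  apply: eq_bigr => i _; rewrite (@derive_linear_comp _ _ _ _ v (l i))//.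
  exact: linearP.
have E2 : \forall x \near phi a, 'D_(v a) g x = \sum_i l i (v a) *: 'D_(e i) g x.
  apply: filterS (smooth_near_near sg) => x sx.
  by rewrite (derive_expand _ El)//; exact: smooth_near_diff.
rewrite (near_eq_derive _ E2).
have dT i := @differentiable_scale _ _ _ (fun=> l i (v a) : R^o) _ _
  (differentiable_cst _ (phi a)) (dde i).
rewrite (@differentiable_bigsum _ _ _ _ (index_enum _) _ _ (fun i => (dT i).1)).2.
apply: eq_bigr => i _; rewrite (dT i).2 derive_cst scale0r add0r.
by rewrite (@derive_comp _ _ _ _ phi ('D_(e i) g)).
Qed.

Lemma schwarz V W {fW : findim W} (f : V -> W) a v w : smooth_near f a ->
  'D_v ('D_w f) a = 'D_w ('D_v f) a.
Proof.
move=> sf; have [[k [e [l [cl El]]]]] := fW; rewrite [LHS]El [RHS]El.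
apply: eq_bigr => i _; congr (_ *: _).
have key v' w' : l i ('D_v' ('D_w' f) a) = 'D_v' ('D_w' (fun x => l i (f x) : R^o)) a.
  rewrite -(@derive_linear_comp _ _ _ _ ('D_w' f) (l i))//; last 2 first.
  - exact: linearP.
  - by apply: smooth_near_diff; exact: smooth_near_derive.
  apply: near_eq_derive; apply: filterS (smooth_near_near sf) => x sx.
  rewrite (@derive_linear_comp _ _ _ _ f (l i))//; first exact: linearP.
  exact: smooth_near_diff.
have sl : smooth_near (fun x => l i (f x) : R^o) a.
  by apply: (@smooth_near_linear_comp _ _ _ fW f (l i)) => //; exact: linearP.
rewrite !key; apply: schwarz_scalar.
- by apply: filterS (smooth_near_near sl) => x; exact: smooth_near_diff.
- by apply: smooth_near_diff; exact: smooth_near_derive.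
- by apply: smooth_near_diff; exact: smooth_near_derive.
Qed.

Lemma derive_dir_schwarz V W {fV : findim V} {fW : findim W} (g : V -> W) (v : V -> V) a w :
  smooth_near g a -> differentiable v a ->
  'D_w (fun u => 'D_(v u) g u) a = 'D_('D_w v a) g a + 'D_(v a) ('D_w g) a.
Proof.
move=> sg dv; rewrite (@derive_dir _ _ _ _ _ g id v)//.
by rewrite derive_id schwarz.
Qed.

Lemma derive0_segment V (f : V -> R^o) (x y : V) :
  (forall t : R, 0 <= t <= 1 -> differentiable (fun s : R => f (s *: (y - x) + x)) t /\
    'D_1 (fun s : R => f (s *: (y - x) + x)) t = 0) ->
  f x = f y.
Proof.
move=> H; pose phi (s : R) : R := f (s *: (y - x) + x).
have d (s : R) : s \in `]0, 1[%R -> is_derive s (1 : R) phi ((fun=> 0 : R) s).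
  rewrite in_itv /= => /andP[s0 s1].
  have [] := H s; first by rewrite !ltW.
  by move=> dp E; apply: DeriveDef => //; exact: diff_derivable.
have c : {within `[0, 1], continuous phi}.
  apply: continuous_in_subspaceT => s; rewrite inE /= in_itv /= => st.
  exact: differentiable_continuous (H s st).1.
have [z _] := MVT ltr01 d c.
rewrite mul0r => /eqP; rewrite subr_eq0 => /eqP.
by rewrite /phi scale1r scale0r add0r subrK.
Qed.

End SmoothNear.

(** * Connectedness of a punctured fibre *)

Section Connected.
Variables (R : realType) (n : nat) (W : normedModType R).
Context {fW : findim W}.
Local Notation V := 'rV[R]_n.

Lemma derive0_const_segment (f : V -> W) (x y : V) :
  (forall t : R, 0 <= t <= 1 -> t *: (y - x) + x != 0) ->
  (forall z, z != 0 -> differentiable f z /\ forall b, 'D_b f z = 0) -> f x = f y.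
Proof.
move=> nz Hf; have [[k [e [l [cl El]]]]] := fW; rewrite [LHS]El [RHS]El.
apply: eq_bigr => i _; congr (_ *: _).
apply: (@derive0_segment _ _ (fun z => l i (f z) : R^o)) => t t01.
have [df Df] := Hf _ (nz t t01).
have dlf : differentiable (fun z => l i (f z) : R^o) (t *: (y - x) + x).
  by apply: differentiable_comp => //; exact: linear_differentiable.
have [dl Dl] := line_is_derive dlf; split=> //; rewrite (@derive_val _ _ _ _ _ _ _ Dl).
rewrite (@derive_linear_comp _ _ _ _ f (l i))//; last exact: (linearP (l i)).
by rewrite Df linear0.
Qed.

(** If the coordinate of index i of [y] is nonzero, a basis vector of any other index is not a
    multiple of [y]; as the dimension is not 1, there is such an index. *)
Lemma exists_transverse (y : V) : n <> 1%N -> y != 0 ->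
  exists e : V, forall k : R, e != k *: y.
Proof.
move=> n1 y0; have [i yi] : exists i, y 0 i != 0.
  apply: contrapT => H; move/eqP: y0; apply; apply/rowP => i; rewrite mxE.
  by apply/eqP; apply: contrapT => /negP yi; apply: H; exists i.
have [j ij] : exists j : 'I_n, j != i.
  apply: contrapT => H; apply: n1; rewrite -[LHS](card_ord n); apply/eqP/fintype1P.
  by exists i => j; apply/eqP; apply: contrapT => /negP ji; apply: H; exists j.
exists (delta_mx 0 j) => k; apply/eqP => E.
have := congr1 (fun m : V => m 0 i) E; rewrite !mxE /= eq_sym (negbTE ij) /=.
move=> /esym/eqP; rewrite mulf_eq0 (negbTE yi) orbF => /eqP k0.
have := congr1 (fun m : V => m 0 j) E; rewrite !mxE k0 mul0r !eqxx /= => /eqP.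
by rewrite oner_eq0.
Qed.

(** If the segment from [x] to [y] meets the origin, the two points lie on one line through it, and
    the path is broken at a vector [e] off that line. *)
Lemma derive0_const_punctured (f : V -> W) (x y : V) : n <> 1%N ->
  x != 0 -> y != 0 ->
  (forall z, z != 0 -> differentiable f z /\ forall b, 'D_b f z = 0) -> f x = f y.
Proof.
move=> n1 x0 y0 Hf.
have [|/existsNP[t /not_implyP[t01 /negP]]] :=
    pselect (forall t : R, 0 <= t <= 1 -> t *: (y - x) + x != 0).
  by move=> H; exact: derive0_const_segment.
rewrite negbK => /eqP E.
have t0 : t != 0 by apply: contra_neq x0 => t0; rewrite -E t0 scale0r add0r.
have E' : t *: y = (t - 1) *: x.
  by apply/eqP; rewrite -subr_eq0 -E scalerBr scalerBl scale1r opprB addrA addrAC.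
have yx : y = (t^-1 * (t - 1)) *: x by rewrite -scalerA -E' scalerA mulVf// scale1r.
have [e He] := exists_transverse n1 x0.
have nz1 s : s *: (e - x) + x != 0.
  apply/eqP => Es; have s0 : s != 0.
    by apply: contra_neq x0 => s0; rewrite -Es s0 scale0r add0r.
  have : s *: e = (s - 1) *: x.
    by apply/eqP; rewrite -subr_eq0 -Es scalerBr scalerBl scale1r opprB addrA addrAC.
  move=> /(congr1 (fun m => s^-1 *: m)); rewrite !scalerA mulVf// scale1r.
  exact/eqP/He.
have nz2 s : s *: (y - e) + e != 0.
  apply/eqP => Es; have s1 : 1 - s != 0.
    apply: contra_neq y0 => /eqP; rewrite subr_eq0 => /eqP s1.
    by rewrite -Es -s1 scale1r subrK.
  have : (1 - s) *: e = (- s * (t^-1 * (t - 1))) *: x.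
    rewrite -scalerA -yx; apply/rowP => k.
    have := congr1 (fun m : V => m 0 k) Es; rewrite !mxE => E0.
    by apply/eqP; rewrite -subr_eq0 -E0; apply/eqP; ring.
  move=> /(congr1 (fun m => (1 - s)^-1 *: m)); rewrite !scalerA mulVf// scale1r.
  exact/eqP/He.
by rewrite (@derive0_const_segment f x e)// (@derive0_const_segment f e y).
Qed.

End Connected.

(** * Fibre derivatives and Euler's identities *)

Section Affine.
Variable R : realType.
Implicit Types U V W : normedModType R.

Lemma derive_comp_affine U V W (L0 L : U -> V) (g : V -> W) a v :
  (forall k x y, L (k *: x + y) = k *: L0 x + L y) ->
  'D_v (fun x => g (L x)) a = 'D_(L0 v) g (L a).
Proof. by move=> lL; rewrite /derive /=; under eq_fun do rewrite lL. Qed.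

Lemma derive_fiber U V W (h : U * V -> W) x y w :
  'D_w (fun y => h (x, y)) y = 'D_(0, w) h (x, y).
Proof.
apply: (@derive_comp_affine _ _ _ (fun w => (0, w)) (fun y => (x, y))) => k a b.
by rewrite -[RHS]/(k *: 0 + x, k *: a + b) scaler0 add0r.
Qed.

(** Since t y + y = (t + 1) y, the difference quotient along [y] is equal to [h y] for 0 < |t| < 1,
    whatever the regularity of [h]. *)
Lemma euler1 V (h : V -> R^o) y : (forall k : R, 0 < k -> h (k *: y) = k * h y) ->
  'D_y h y = h y.
Proof.
move=> H; rewrite /derive; apply: lim_near_cst => //.
near=> t.
have t0 : t != 0 by near: t; exact: nbhs_dnbhs_neq.
have t1 : `|t| < 1 by near: t; exact: dnbhs0_lt.
have E : t *: y + y = (t + 1) *: y by rewrite scalerDl scale1r.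
rewrite /= E H; last by move: t1; rewrite ltr_norml => /andP[]; lra.
by rewrite -[LHS]/(t^-1 * _) mulrDl mul1r addrK mulKf.
Unshelve. all: by end_near. Qed.

Lemma euler0 V (h : V -> R^o) y : (forall k : R, 0 < k -> h (k *: y) = h y) ->
  'D_y h y = 0.
Proof.
move=> H; rewrite /derive; apply: lim_near_cst => //.
near=> t.
have t1 : `|t| < 1 by near: t; exact: dnbhs0_lt.
have E : t *: y + y = (t + 1) *: y by rewrite scalerDl scale1r.
rewrite /= E H; last by move: t1; rewrite ltr_norml => /andP[]; lra.
by rewrite subrr scaler0.
Unshelve. all: by end_near. Qed.

Lemma derive_homogeneous V (h : V -> R^o) (d : nat) (y w : V) (k : R) :
  (forall y k, 0 < k -> y != 0 -> h (k *: y) = k ^+ d.+1 * h y) ->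
  (forall y, y != 0 -> differentiable h y) -> 0 < k -> y != 0 ->
  'D_w h (k *: y) = k ^+ d * 'D_w h y.
Proof.
move=> H dh k0 y0; have ky0 : k *: y != 0 by rewrite scaler_eq0 negb_or gt_eqF.
have E1 : 'D_w (fun y => h (k *: y)) y = k * 'D_w h (k *: y).
  rewrite (@derive_comp_linear _ _ _ _ ( *:%R k)); last first.
    by move=> b u v; rewrite scalerDr !scalerA mulrC.
  exact: (linear_scale _ _ (derive_linear (dh _ ky0))).
have E2 : 'D_w (fun y => h (k *: y)) y = k ^+ d.+1 * 'D_w h y.
  have N : \forall x \near y, h (k *: x) = (k ^+ d.+1) *: h x.
    by apply: (near_open (@open_neq0 _ V) y0) => x; exact: H.
  rewrite (near_eq_derive _ N) (@deriveZ _ _ _ h)//.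
  by apply: diff_derivable; exact: dh.
apply: (mulfI (lt0r_neq0 k0)).
by rewrite -E1 E2 exprS mulrA.
Qed.

End Affine.

Local Opaque derive.

(** * Higher derivatives in variable directions *)

Section DirectionalHigher.
Variable R : realType.
Implicit Types U V W : normedModType R.

(** The inner direction changes the function that is differentiated next. Schwarz moves it
    outermost, where linearity is that of a differential. *)
Lemma derive2_linear V W {fW : findim W} (f : V -> W) a s : smooth_near f a ->
  linear (fun w => 'D_s ('D_w f) a).
Proof.
move=> sf k v w; rewrite !(schwarz s _ sf).
by rewrite (derive_linear (smooth_near_diff (smooth_near_derive s sf))).
Qed.

Lemma derive3_linear V W {fW : findim W} (f : V -> W) a t s : smooth_near f a ->
  linear (fun w => 'D_t ('D_s ('D_w f)) a).
Proof.
move=> sf k v w.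
have E x : 'D_t ('D_s ('D_x f)) a = 'D_t ('D_x ('D_s f)) a.
  by apply: near_eq_derive; apply: filterS (smooth_near_near sf) => y sy; exact: schwarz.
exact: (etrans (E _) (etrans (derive2_linear t (smooth_near_derive s sf) k v w)
  (esym (congr2 (fun x y => k *: x + y) (E v) (E w))))).
Qed.

Lemma derive4_linear V W {fW : findim W} (f : V -> W) a r t s : smooth_near f a ->
  linear (fun w => 'D_r ('D_t ('D_s ('D_w f))) a).
Proof.
move=> sf k v w.
have E x : 'D_r ('D_t ('D_s ('D_x f))) a = 'D_r ('D_t ('D_x ('D_s f))) a.
  apply: near_eq_derive; apply: filterS (near_join (smooth_near_near sf)) => y sy.
  by apply: near_eq_derive; apply: filterS sy => y' sy'; exact: schwarz.
exact: (etrans (E _) (etrans (derive3_linear r t (smooth_near_derive s sf) k v w)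
  (esym (congr2 (fun x y => k *: x + y) (E v) (E w))))).
Qed.

Lemma sum_expand V W (g : V -> W) (k : nat) (e : 'I_k -> V) (l : 'I_k -> {linear V -> R^o}) v :
  (forall v, v = \sum_i l i v *: e i) -> linear g -> g v = \sum_i l i v *: g (e i).
Proof.
move=> El lg; rewrite {1}(El v) (linear_bigsum _ _ lg).
by apply: eq_bigr => i _; rewrite (linear_scale _ _ lg).
Qed.

(** The shape in a chart of the derivative of g(X, Y), the directions [v] and [w] being the
    components of X and Y: two terms for the change of the components, one for the change of g. *)
Lemma derive_dir2 V W {fV : findim V} {fW : findim W} (f : V -> W) (v w : V -> V) a d :
  smooth_near f a -> smooth_near v a -> smooth_near w a ->
  'D_d (fun u => 'D_(v u) ('D_(w u) f) u) a =
  'D_('D_d v a) ('D_(w a) f) a + 'D_(v a) ('D_('D_d w a) f) a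
  + 'D_d ('D_(v a) ('D_(w a) f)) a.
Proof.
move=> sf sv sw; have [[k [e [l [cl El]]]]] := fV.
have N : \forall u \near a, 'D_(v u) ('D_(w u) f) u =
    \sum_i l i (w u) *: 'D_(v u) ('D_(e i) f) u.
  apply: filterS (smooth_near_near sf) => u su.
  exact: (sum_expand (w u) El (derive2_linear (v u) su)).
have dl i : differentiable (fun u => l i (w u) : R^o) a.
  apply: differentiable_comp; first exact: smooth_near_diff.
  exact: linear_differentiable.
have sid : smooth_near (id : V -> V) a by exact: smooth_near_lin.
have sg i : smooth_near (fun u => 'D_(v u) ('D_(e i) f) u) a.
  exact: (@smooth_near_dir _ _ _ _ _ _ ('D_(e i) f) id v a (smooth_near_derive (e i) sf) sid sv).
have dS i := differentiable_scale (dl i) (smooth_near_diff (sg i)).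
have B := (@differentiable_bigsum _ _ _ _ (index_enum _) _ a (fun i => (dS i).1)).2 d.
apply: (etrans (near_eq_derive d N)); apply: (etrans B).
rewrite (eq_bigr _ (fun i _ => (dS i).2 d)) big_split /=.
have E1 : \sum_i 'D_d (fun u => l i (w u) : R^o) a *: 'D_(v a) ('D_(e i) f) a =
    'D_(v a) ('D_('D_d w a) f) a.
  rewrite (sum_expand ('D_d w a) El (derive2_linear (v a) sf)); apply: eq_bigr => i _.
  rewrite (@derive_linear_comp _ _ _ _ w (l i))//; first exact: (linearP (l i)).
  exact: smooth_near_diff.
have E2 : \sum_i l i (w a) *: 'D_d (fun u => 'D_(v u) ('D_(e i) f) u) a =
    'D_('D_d v a) ('D_(w a) f) a + 'D_d ('D_(v a) ('D_(w a) f)) a.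
  have A1 := sum_expand (w a) El (derive2_linear (fW := fW) ('D_d v a) sf).
  have A2 := sum_expand (w a) El (derive3_linear (fW := fW) d (v a) sf).
  apply: esym; apply: (etrans (congr2 +%R A1 A2)); rewrite -big_split /=.
  apply: eq_bigr => i _; rewrite -scalerDr; apply: (congr1 ( *:%R (l i (w a)))).
  apply: esym.
  have dv := smooth_near_diff sv.
  have K := @derive_dir_schwarz _ _ _ fV fW _ _ _ d (smooth_near_derive (e i) sf) dv.
  exact: (etrans K (congr1 (fun r => _ + r) (schwarz (v a) d (smooth_near_derive (e i) sf)))).
have alg (A B' C : W) : A + (B' + C) = B' + A + C by rewrite addrCA addrA.
exact: (etrans (congr2 +%R E1 E2) (alg _ _ _)).
Qed.

(** The analogue for A(X, Y, Z). Differentiability is stated as well, because A carries the further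
    factor F to which the product rule will be applied. *)
Lemma derive_dir3 V W {fV : findim V} {fW : findim W} (f : V -> W) (v w t : V -> V) a d :
  smooth_near f a -> smooth_near v a -> smooth_near w a -> smooth_near t a ->
  differentiable (fun u => 'D_(v u) ('D_(w u) ('D_(t u) f)) u) a /\
  'D_d (fun u => 'D_(v u) ('D_(w u) ('D_(t u) f)) u) a =
  'D_('D_d v a) ('D_(w a) ('D_(t a) f)) a + 'D_(v a) ('D_('D_d w a) ('D_(t a) f)) a
  + 'D_(v a) ('D_(w a) ('D_('D_d t a) f)) a + 'D_d ('D_(v a) ('D_(w a) ('D_(t a) f))) a.
Proof.
move=> sf sv sw st; have [[k [e [l [cl El]]]]] := fV.
have sid : smooth_near (id : V -> V) a by exact: smooth_near_lin.
have dl (t' : V -> V) i : smooth_near t' a -> differentiable (fun u => l i (t' u) : R^o) a.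
  move=> st'; apply: differentiable_comp; first exact: smooth_near_diff.
  exact: linear_differentiable.
have N2 (g : V -> W) : smooth_near g a -> \forall u \near a, 'D_(v u) ('D_(w u) g) u =
    \sum_i l i (w u) *: 'D_(v u) ('D_(e i) g) u.
  move=> sg; apply: filterS (smooth_near_near sg) => u su.
  exact: (sum_expand (w u) El (derive2_linear (v u) su)).
have d2 (g : V -> W) : smooth_near g a -> differentiable (fun u => 'D_(v u) ('D_(w u) g) u) a.
  move=> sg; have sg' i : smooth_near (fun u => 'D_(v u) ('D_(e i) g) u) a.
    exact: (@smooth_near_dir _ _ _ _ _ _ ('D_(e i) g) id v a (smooth_near_derive (e i) sg) sid sv).
  have dS i := differentiable_scale (dl w i sw) (smooth_near_diff (sg' i)).
  have B := (@differentiable_bigsum _ _ _ _ (index_enum _) _ a (fun i => (dS i).1)).1.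
  apply: (differentiable_ext _ B).
  by apply: filterS (N2 g sg) => u ->.
have N : \forall u \near a, 'D_(v u) ('D_(w u) ('D_(t u) f)) u =
    \sum_i l i (t u) *: 'D_(v u) ('D_(w u) ('D_(e i) f)) u.
  apply: filterS (smooth_near_near sf) => u su.
  exact: (sum_expand (t u) El (derive3_linear (v u) (w u) su)).
have dS i := differentiable_scale (dl t i st) (d2 _ (smooth_near_derive (e i) sf)).
have B := @differentiable_bigsum _ _ _ _ (index_enum _) _ a (fun i => (dS i).1).
split.
  apply: (differentiable_ext _ B.1).
  by apply: filterS N => u ->.
apply: (etrans (near_eq_derive d N)); apply: (etrans (B.2 d)).
rewrite (eq_bigr _ (fun i _ => (dS i).2 d)) big_split /=.
have E1 : \sum_i 'D_d (fun u => l i (t u) : R^o) a *: 'D_(v a) ('D_(w a) ('D_(e i) f)) a =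
    'D_(v a) ('D_(w a) ('D_('D_d t a) f)) a.
  rewrite (sum_expand ('D_d t a) El (derive3_linear (v a) (w a) sf)); apply: eq_bigr => i _.
  rewrite (@derive_linear_comp _ _ _ _ t (l i))//; first exact: (linearP (l i)).
  exact: smooth_near_diff.
have E2 : \sum_i l i (t a) *: 'D_d (fun u => 'D_(v u) ('D_(w u) ('D_(e i) f)) u) a =
    'D_('D_d v a) ('D_(w a) ('D_(t a) f)) a + 'D_(v a) ('D_('D_d w a) ('D_(t a) f)) a
    + 'D_d ('D_(v a) ('D_(w a) ('D_(t a) f))) a.
  have A1 := sum_expand (t a) El (derive3_linear (fW := fW) ('D_d v a) (w a) sf).
  have A2 := sum_expand (t a) El (derive3_linear (fW := fW) (v a) ('D_d w a) sf).
  have A3 := sum_expand (t a) El (derive4_linear (fW := fW) d (v a) (w a) sf).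
  apply: esym; apply: (etrans (congr2 +%R (congr2 +%R A1 A2) A3)); rewrite -!big_split /=.
  apply: eq_bigr => i _; rewrite -!scalerDr; apply: (congr1 ( *:%R (l i (t a)))).
  apply: esym; exact: (derive_dir2 d (smooth_near_derive (e i) sf) sv sw).
have alg (P P1 P2 P3 : W) : P + (P1 + P2 + P3) = P1 + P2 + P + P3.
  by rewrite addrC -!addrA; congr (_ + (_ + _)); rewrite addrC.
exact: (etrans (congr2 +%R E1 E2) (alg _ _ _ _)).
Qed.

End DirectionalHigher.

(** * Charts of M and of TM *)

Section Charts.
Variables (R : realType) (n : nat) (M : smoothManifold R n).
Local Notation V := 'rV[R]_n.
Local Notation VV := (V * V)%type.
Local Notation TM := (tangent_bundle M).
Implicit Types (c : chart R n M) (p : M) (z : TM) (u w : VV).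

Lemma uncoord_dom c x : (coord c @` dom c) x ->
  dom c (uncoord c x) /\ coord c (uncoord c x) = x.
Proof. by move=> [p dp <-]; rewrite chartK. Qed.

Lemma coord_im c p : dom c p -> (coord c @` dom c) (coord c p).
Proof. by move=> dp; exists p. Qed.

Lemma trans_coord c c' p : dom c p -> trans c c' (coord c p) = coord c' p.
Proof. by move=> dp; rewrite /trans chartK. Qed.

Lemma uncoord_trans c c' x : dom c' (uncoord c x) -> uncoord c' (trans c c' x) = uncoord c x.
Proof. by move=> dp; rewrite /trans chartK. Qed.

Definition overlap c c' (x : V) := (coord c @` dom c) x /\ dom c' (uncoord c x).

Lemma near_overlap c c' p : dom c p -> dom c' p -> \forall x \near coord c p, overlap c c' x.
Proof.
move=> dp dp'; apply: filterI.
  by apply: open_nbhs_nbhs; split; [exact: chart_open_im|exact: coord_im].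
have := @chart_cont_inv _ _ _ c.
rewrite continuous_open_subspace; last exact: chart_open_im.
move=> H; apply: (H (coord c p) (mem_set (coord_im dp))).
by apply: open_nbhs_nbhs; split; [exact: chart_open_dom|rewrite chartK].
Qed.

Lemma trans_trans c c' c'' x : overlap c c' x -> trans c' c'' (trans c c' x) = trans c c'' x.
Proof. by case=> _ H; rewrite {1}/trans uncoord_trans. Qed.

Lemma trans_smooth c c' p : atlas c -> atlas c' -> dom c p -> dom c' p ->
  smooth_near (trans c c') (coord c p).
Proof. by move=> ac ac' dp dp'; exact: atlas_compatible dp dp'. Qed.

Lemma trans_diff c c' p : atlas c -> atlas c' -> dom c p -> dom c' p ->
  differentiable (trans c c') (coord c p).
Proof. by move=> ac ac' dp dp'; apply: smooth_near_diff; exact: trans_smooth. Qed.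

(** The cocycle rule from which the conversions of tangent vectors between charts follow. *)
Lemma trans_chain c c' c'' p v : atlas c -> atlas c' -> atlas c'' ->
  dom c p -> dom c' p -> dom c'' p ->
  'D_('D_v (trans c c') (coord c p)) (trans c' c'') (coord c' p) =
  'D_v (trans c c'') (coord c p).
Proof.
move=> ac ac' ac'' d d' d''.
have E : \forall x \near coord c p, trans c c'' x = trans c' c'' (trans c c' x).
  by apply: filterS (near_overlap d d') => x /trans_trans ->.
rewrite (near_eq_derive _ E) (@derive_comp _ _ _ _ (trans c c')).
- by rewrite trans_coord.
- exact: trans_diff.
- by rewrite trans_coord//; exact: trans_diff.
Qed.

Lemma trans_id c p v : dom c p -> 'D_v (trans c c) (coord c p) = v.
Proof.
move=> d; have E : \forall x \near coord c p, trans c c x = id x.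
  by apply: filterS (near_overlap d d) => x [/uncoord_dom[_ E] _]; rewrite /trans E.
by rewrite (near_eq_derive _ E) derive_id.
Qed.

Lemma trans_linear c c' p : atlas c -> atlas c' -> dom c p -> dom c' p ->
  linear (fun v => 'D_v (trans c c') (coord c p)).
Proof. by move=> *; apply: derive_linear; exact: trans_diff. Qed.

Local Hint Resolve atlas_chart_at dom_chart_at : core.

Lemma tcoordK c p v : atlas c -> dom c p -> tuncoord c p (tcoord c p v) = v.
Proof. by move=> ac d; rewrite /tuncoord /tcoord trans_chain// trans_id. Qed.

Lemma tuncoordK c p v : atlas c -> dom c p -> tcoord c p (tuncoord c p v) = v.
Proof. by move=> ac d; rewrite /tuncoord /tcoord trans_chain// trans_id. Qed.

Lemma tcoord_trans c c' p v : atlas c -> atlas c' -> dom c p -> dom c' p ->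
  'D_(tcoord c p v) (trans c c') (coord c p) = tcoord c' p v.
Proof. by move=> *; rewrite /tcoord trans_chain. Qed.

Lemma tuncoord_trans c c' p v : atlas c -> atlas c' -> dom c p -> dom c' p ->
  tcoord c' p (tuncoord c p v) = 'D_v (trans c c') (coord c p).
Proof. by move=> *; rewrite /tcoord /tuncoord trans_chain. Qed.

Lemma tcoord_linear c p : atlas c -> dom c p -> linear (tcoord c p).
Proof. by move=> *; exact: trans_linear. Qed.

Lemma tuncoord_linear c p : atlas c -> dom c p -> linear (tuncoord c p).
Proof. by move=> *; exact: trans_linear. Qed.

Lemma tcoord_id p v : tcoord (chart_at p) p v = v.
Proof. exact: trans_id. Qed.

Lemma tuncoord_id p v : tuncoord (chart_at p) p v = v.
Proof. exact: trans_id. Qed.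

Lemma TcoordK c z : atlas c -> dom c (base z) -> Tuncoord c (Tcoord c z) = z.
Proof.
move=> ac d; rewrite /Tuncoord /Tcoord /= chartK//.
by case: z d => p v /= d; rewrite tcoordK.
Qed.

Lemma TuncoordK c u : atlas c -> (coord c @` dom c) u.1 ->
  Tcoord c (Tuncoord c u) = u.
Proof.
move=> ac /uncoord_dom[d E]; rewrite /Tuncoord /Tcoord /= E tuncoordK//.
by case: u {d E}.
Qed.

Lemma near_Toverlap c c' z : dom c (base z) -> dom c' (base z) ->
  \forall u \near Tcoord c z, overlap c c' u.1.
Proof.
move=> d d'; have H := near_overlap d d'.
have : {for Tcoord c z, continuous (fst : VV -> V)} by exact: cvg_fst.
by move=> /(_ _ H).
Qed.

Lemma ttrans_Tuncoord c c' u : atlas c -> atlas c' -> overlap c c' u.1 ->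
  ttrans c c' u = Tcoord c' (Tuncoord c u).
Proof.
move=> ac ac' [/uncoord_dom[d E] d']; rewrite /ttrans /Tcoord /Tuncoord /=.
by rewrite tuncoord_trans// E.
Qed.

Lemma ttrans_Tcoord c c' z : atlas c -> atlas c' -> dom c (base z) -> dom c' (base z) ->
  ttrans c c' (Tcoord c z) = Tcoord c' z.
Proof.
move=> ac ac' d d'; rewrite ttrans_Tuncoord ?TcoordK//.
by split; [exact: coord_im|rewrite /= chartK].
Qed.

Lemma Tuncoord_ttrans c c' u : atlas c -> atlas c' -> overlap c c' u.1 ->
  Tuncoord c' (ttrans c c' u) = Tuncoord c u.
Proof. by move=> ac ac' o; rewrite ttrans_Tuncoord// TcoordK//; case: o. Qed.

Lemma ttrans_smooth c c' z : atlas c -> atlas c' -> dom c (base z) -> dom c' (base z) ->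
  smooth_near (ttrans c c') (Tcoord c z).
Proof.
move=> ac ac' d d'; have s1 : smooth_near (fst : VV -> V) (Tcoord c z) by exact: smooth_near_lin.
have s2 : smooth_near (snd : VV -> V) (Tcoord c z) by exact: smooth_near_lin.
have st := trans_smooth ac ac' d d'.
apply: smooth_near_pair.
  exact: (@smooth_near_comp _ _ _ _ _ _ fst (trans c c')).
exact: (@smooth_near_dir _ _ _ _ _ _ (trans c c') fst snd).
Qed.

Lemma ttrans_diff c c' z : atlas c -> atlas c' -> dom c (base z) -> dom c' (base z) ->
  differentiable (ttrans c c') (Tcoord c z).
Proof. by move=> *; apply: smooth_near_diff; exact: ttrans_smooth. Qed.

Lemma ttrans_chain c c' c'' z w : atlas c -> atlas c' -> atlas c'' ->
  dom c (base z) -> dom c' (base z) -> dom c'' (base z) ->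
  'D_('D_w (ttrans c c') (Tcoord c z)) (ttrans c' c'') (Tcoord c' z) =
  'D_w (ttrans c c'') (Tcoord c z).
Proof.
move=> ac ac' ac'' d d' d''.
have E : \forall u \near Tcoord c z, ttrans c c'' u = ttrans c' c'' (ttrans c c' u).
  apply: filterS2 (near_Toverlap d d') (near_Toverlap d d'') => u o o''.
  rewrite [RHS]ttrans_Tuncoord// ?Tuncoord_ttrans ?ttrans_Tuncoord//.
  split; first by exists (uncoord c u.1) => //; case: o.
  by rewrite uncoord_trans; [case: o''|case: o].
rewrite (near_eq_derive _ E) (@derive_comp _ _ _ _ (ttrans c c')).
- by rewrite ttrans_Tcoord.
- exact: ttrans_diff.
- by rewrite ttrans_Tcoord//; exact: ttrans_diff.
Qed.

Lemma ttrans_id c z w : atlas c -> dom c (base z) -> 'D_w (ttrans c c) (Tcoord c z) = w.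
Proof.
move=> ac d; have E : \forall u \near Tcoord c z, ttrans c c u = id u.
  by apply: filterS (near_Toverlap d d) => u o; rewrite ttrans_Tuncoord// TuncoordK//; case: o.
by rewrite (near_eq_derive _ E) derive_id.
Qed.

Lemma ttrans_linear c c' z : atlas c -> atlas c' -> dom c (base z) -> dom c' (base z) ->
  linear (fun w => 'D_w (ttrans c c') (Tcoord c z)).
Proof. by move=> *; apply: derive_linear; exact: ttrans_diff. Qed.

Lemma ttrans_fst c c' z w : atlas c -> atlas c' -> dom c (base z) -> dom c' (base z) ->
  ('D_w (ttrans c c') (Tcoord c z)).1 = 'D_(w.1) (trans c c') (coord c (base z)).
Proof.
move=> ac ac' d d'; have dt := ttrans_diff ac ac' d d'.
have -> : ('D_w (ttrans c c') (Tcoord c z)).1 =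
    'D_w (fun u : VV => trans c c' (fst u)) (Tcoord c z).
  apply: esym; apply: (@derive_linear_comp _ _ _ _ (ttrans c c') (fst : VV -> V)) => //.
  exact: linear_findim_continuous.
have d1 : differentiable (fst : VV -> V) (Tcoord c z) by exact: findim_linear_diff.
have d2 : differentiable (trans c c') (fst (Tcoord c z)) by exact: trans_diff.
by rewrite (derive_comp w d1 d2) (@derive_lin _ _ _ (fst : VV -> V)).
Qed.

(** On a fibre [ttrans] is linear, given by the differential of [trans] at a fixed base point, so it
    is its own vertical derivative. *)
Lemma ttrans_vert c c' z b : atlas c -> atlas c' -> dom c (base z) -> dom c' (base z) ->
  'D_(0, b) (ttrans c c') (Tcoord c z) = (0, 'D_b (trans c c') (coord c (base z))).
Proof.
move=> ac ac' d d'; have dt := ttrans_diff ac ac' d d'.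
have lt := trans_linear ac ac' d d'.
pose L (v : V) : VV := (coord c (base z), v).
have : ('D_(0, b) (ttrans c c') (Tcoord c z)).2 = 'D_b (trans c c') (coord c (base z)).
  have -> : ('D_(0, b) (ttrans c c') (Tcoord c z)).2 =
      'D_(0, b) (fun u : VV => 'D_(snd u) (trans c c') (fst u)) (Tcoord c z).
    apply: esym; apply: (@derive_linear_comp _ _ _ _ (ttrans c c') (snd : VV -> V)) => //.
    exact: linear_findim_continuous.
  have st := trans_smooth ac ac' d d'.
  have d1 : differentiable (fst : VV -> V) (Tcoord c z) by exact: findim_linear_diff.
  have d2 : differentiable (snd : VV -> V) (Tcoord c z) by exact: findim_linear_diff.
  rewrite (derive_dir (0, b) (st : smooth_near _ (fst (Tcoord c z))) d1 d2).
  rewrite (@derive_lin _ _ _ (fst : VV -> V))// (@derive_lin _ _ _ (snd : VV -> V))//=.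
  by rewrite derive0 addr0.
have : ('D_(0, b) (ttrans c c') (Tcoord c z)).1 = 0.
  by rewrite ttrans_fst//= derive0.
by case: ('D__ _ _) => a1 a2 /= -> ->.
Qed.

Lemma TTcoord_linear c z : atlas c -> dom c (base z) -> linear (TTcoord c z).
Proof. by move=> ac d; exact: ttrans_linear. Qed.

Lemma TTuncoordK c z w : atlas c -> dom c (base z) -> TTcoord c z (TTuncoord c z w) = w.
Proof. by move=> ac d; rewrite /TTuncoord /TTcoord ttrans_chain// ttrans_id. Qed.

Lemma TTcoord_trans c c' z w : atlas c -> atlas c' -> dom c (base z) -> dom c' (base z) ->
  'D_(TTcoord c z w) (ttrans c c') (Tcoord c z) = TTcoord c' z w.
Proof. by move=> *; rewrite /TTcoord ttrans_chain. Qed.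

Lemma TTcoord_id z w : TTcoord (chart_at (base z)) z w = w.
Proof. exact: ttrans_id. Qed.

Lemma TTuncoord_id z w : TTuncoord (chart_at (base z)) z w = w.
Proof. exact: ttrans_id. Qed.

Lemma TTcoord_fst c z w : atlas c -> dom c (base z) ->
  (TTcoord c z w).1 = tcoord c (base z) w.1.
Proof. by move=> ac d; exact: ttrans_fst. Qed.

Lemma TTuncoord_fst c z w : atlas c -> dom c (base z) ->
  (TTuncoord c z w).1 = tuncoord c (base z) w.1.
Proof. by move=> ac d; exact: ttrans_fst. Qed.

Lemma TTcoord_vert c z b : atlas c -> dom c (base z) ->
  TTcoord c z (0, b) = (0, tcoord c (base z) b).
Proof. by move=> ac d; exact: ttrans_vert. Qed.

End Charts.
#[global] Hint Resolve atlas_chart_at dom_chart_at : core.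

(** * Functions, sections and vector fields in charts *)

Section Reps.
Variables (R : realType) (n : nat) (M : smoothManifold R n).
Local Notation V := 'rV[R]_n.
Local Notation VV := (V * V)%type.
Local Notation TM := (tangent_bundle M).
Implicit Types (c : chart R n M) (p : M) (z : TM) (u w : VV) (X Y : section M).

Definition in_chart c z := atlas c /\ dom c (base z).

Lemma in_chart_at z : in_chart (chart_at (base z)) z.
Proof. by split. Qed.
Local Hint Resolve in_chart_at : core.

Lemma near_TMS z (P Q : TM -> Prop) : (forall z', P z' -> Q z') -> near_TM z P -> near_TM z Q.
Proof. by move=> PQ; apply: filterS => u; exact: PQ. Qed.

Lemma near_TMI z (P Q : TM -> Prop) : near_TM z P -> near_TM z Q ->
  near_TM z (fun z' => P z' /\ Q z').
Proof. exact: filterI. Qed.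

Lemma near_TM_self z (P : TM -> Prop) : near_TM z P -> P z.
Proof. by move=> /nbhs_singleton; rewrite TcoordK. Qed.

Lemma near_in_chart c z : in_chart c z -> near_TM z (in_chart c).
Proof.
move=> [ac d]; apply: filterS (near_Toverlap (dom_chart_at (base z)) d) => u [_ d'].
by split.
Qed.

Lemma near_slit z : slit z -> near_TM z (@slit R n M).
Proof.
rewrite /slit /= => z0; have a := in_chart_at z; set c := chart_at (base z) in a *.
have cs : {for Tcoord c z, continuous (snd : VV -> V)} by exact: cvg_snd.
have N : \forall u \near Tcoord c z, u.2 != 0.
  apply: (cs [set y | y != 0]); apply: open_nbhs_nbhs; split; first exact: open_neq0.
  by rewrite /= tcoord_id.
have O := near_Toverlap (dom_chart_at (base z)) (dom_chart_at (base z)).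
apply: filterS2 O N => u [q1 q2] u0.
rewrite /Tuncoord /=; apply: contra_neq u0 => E.
by rewrite -(tuncoordK u.2 (atlas_chart_at _) q2) E; exact: (linear_zero (tcoord_linear _ q2)).
Qed.

Lemma fun_rep_trans (T : Type) (f : TM -> T) c c' z : in_chart c z -> in_chart c' z ->
  \forall u \near Tcoord c z, f (Tuncoord c u) = f (Tuncoord c' (ttrans c c' u)).
Proof.
move=> [ac d] [ac' d'].
by apply: filterS (near_Toverlap d d') => u o; rewrite Tuncoord_ttrans.
Qed.

Lemma smooth_fun_trans (f : TM -> R) c c' z : in_chart c z -> in_chart c' z ->
  smooth_near (fun u => f (Tuncoord c' u) : R^o) (Tcoord c' z) ->
  smooth_near (fun u => f (Tuncoord c u) : R^o) (Tcoord c z).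
Proof.
move=> a a' sf; have [[ac d] [ac' d']] := (a, a').
apply: (@smooth_near_ext _ _ _ (fun u => f (Tuncoord c' (ttrans c c' u)) : R^o)).
  by apply: filterS (fun_rep_trans f a a') => u ->.
apply: (@smooth_near_comp _ _ _ _ _ _ (ttrans c c') (fun u => f (Tuncoord c' u) : R^o)).
  exact: ttrans_smooth.
by rewrite (ttrans_Tcoord ac ac' d d').
Qed.

Lemma smooth_funP (f : TM -> R) c z : in_chart c z -> smooth_fun z f <->
  smooth_near (fun u => f (Tuncoord c u) : R^o) (Tcoord c z).
Proof. by move=> a; split; exact: smooth_fun_trans. Qed.

Lemma act_chart (f : TM -> R) c z w : in_chart c z -> smooth_fun z f ->
  act z w f = 'D_(TTcoord c z w) (fun u => f (Tuncoord c u) : R^o) (Tcoord c z).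
Proof.
move=> a sf; have a' := in_chart_at z; have [[ac d] [ac' d']] := (a, a').
have {}sf := (smooth_funP f a).1 sf.
rewrite /act (near_eq_derive _ (fun_rep_trans f a' a)).
have dt := ttrans_diff ac' ac d' d.
have E := ttrans_Tcoord ac' ac d' d.
have df : differentiable (fun u => f (Tuncoord c u) : R^o)
    (ttrans (chart_at (base z)) c (Tcoord (chart_at (base z)) z)).
  by rewrite E; exact: smooth_near_diff sf.
by rewrite (derive_comp _ dt df) E.
Qed.

Lemma section_rep_trans X c c' z : in_chart c z -> in_chart c' z ->
  \forall u \near Tcoord c z, section_rep c X u =
    'D_(section_rep c' X (ttrans c c' u)) (trans c' c) (trans c c' u.1).
Proof.
move=> [ac d] [ac' d']; apply: filterS (near_Toverlap d d') => u o.
have E := Tuncoord_ttrans ac ac' o; rewrite /section_rep E.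
have [q1 q2] := o; have [q3 q4] := uncoord_dom q1.
apply: esym; exact: (tcoord_trans (X (Tuncoord c u)) ac' ac q2 q3).
Qed.

Lemma smooth_section_trans X c c' z : in_chart c z -> in_chart c' z ->
  smooth_near (section_rep c' X) (Tcoord c' z) ->
  smooth_near (section_rep c X) (Tcoord c z).
Proof.
move=> a a' sX; have [[ac d] [ac' d']] := (a, a').
have st := ttrans_smooth ac ac' d d'.
apply: (@smooth_near_ext _ _ _ (fun u => 'D_(section_rep c' X (ttrans c c' u)) (trans c' c) (trans c c' u.1))).
  by apply: filterS (section_rep_trans X a a') => u ->.
apply: (@smooth_near_dir _ _ _ _ _ _ (trans c' c) (fun u => trans c c' u.1)
  (fun u => section_rep c' X (ttrans c c' u))).
- by rewrite /= trans_coord//; exact: trans_smooth.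
- apply: (@smooth_near_comp _ _ _ _ _ _ (fst : VV -> V) (trans c c')); first exact: smooth_near_lin.
  exact: trans_smooth.
- apply: (@smooth_near_comp _ _ _ _ _ _ (ttrans c c') (section_rep c' X)); first exact: st.
  by rewrite (ttrans_Tcoord ac ac' d d'); exact: sX.
Qed.

Lemma smooth_sectionP X c z : in_chart c z -> smooth_section z X <->
  smooth_near (section_rep c X) (Tcoord c z).
Proof. by move=> a; split; exact: smooth_section_trans. Qed.

Lemma vfield_rep_trans (X : vfield M) c c' z : in_chart c z -> in_chart c' z ->
  \forall u \near Tcoord c z, vfield_rep c X u =
    'D_(vfield_rep c' X (ttrans c c' u)) (ttrans c' c) (ttrans c c' u).
Proof.
move=> [ac d] [ac' d']; apply: filterS (near_Toverlap d d') => u o.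
have E := Tuncoord_ttrans ac ac' o; rewrite /vfield_rep E (ttrans_Tuncoord ac ac' o).
have [q1 q2] := o; have [q3 q4] := uncoord_dom q1.
apply: esym; exact: (@TTcoord_trans _ _ _ _ _ (Tuncoord c u) _ ac' ac q2 q3).
Qed.

Lemma smooth_vfield_trans (X : vfield M) c c' z : in_chart c z -> in_chart c' z ->
  smooth_near (vfield_rep c' X) (Tcoord c' z) ->
  smooth_near (vfield_rep c X) (Tcoord c z).
Proof.
move=> a a' sX; have [[ac d] [ac' d']] := (a, a').
have st := ttrans_smooth ac ac' d d'.
apply: (@smooth_near_ext _ _ _ (fun u => 'D_(vfield_rep c' X (ttrans c c' u)) (ttrans c' c) (ttrans c c' u))).
  by apply: filterS (vfield_rep_trans X a a') => u ->.
apply: (@smooth_near_dir _ _ _ _ _ _ (ttrans c' c) (ttrans c c')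
  (fun u => vfield_rep c' X (ttrans c c' u))).
- by rewrite (ttrans_Tcoord ac ac' d d'); exact: ttrans_smooth.
- exact: st.
- apply: (@smooth_near_comp _ _ _ _ _ _ (ttrans c c') (vfield_rep c' X)); first exact: st.
  by rewrite (ttrans_Tcoord ac ac' d d'); exact: sX.
Qed.

Lemma smooth_vfieldP (X : vfield M) c z : in_chart c z -> smooth_vfield z X <->
  smooth_near (vfield_rep c X) (Tcoord c z).
Proof. by move=> a; split; exact: smooth_vfield_trans. Qed.

(** Smoothness at a point is tested in the preferred chart of that point, which may change without
    any continuity from one point to the next. For smoothness to be an open condition it must be
    carried from one chart to another. *)
Lemma near_TM_smooth (P : chart R n M -> VV -> Prop) z :
  (\forall u \near Tcoord (chart_at (base z)) z, P (chart_at (base z)) u) ->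
  (forall z' c, in_chart c z' -> P c (Tcoord c z') -> P (chart_at (base z')) (Tcoord (chart_at (base z')) z')) ->
  near_TM z (fun z' => P (chart_at (base z')) (Tcoord (chart_at (base z')) z')).
Proof.
move=> HP tr.
have O := near_Toverlap (dom_chart_at (base z)) (dom_chart_at (base z)).
apply: filterS2 O HP => u [q1 q2] Hu.
by apply: (tr _ (chart_at (base z))); [split|rewrite TuncoordK].
Qed.

Lemma near_smooth_section z X : smooth_section z X -> near_TM z (fun z' => smooth_section z' X).
Proof.
move=> sX; apply: (near_TM_smooth (P := fun c u => smooth_near (section_rep c X) u)).
  exact: smooth_near_near.
by move=> z' c a H; exact: ((smooth_sectionP X a).2 H).
Qed.

Lemma smooth_section_ext z X Y : near_TM z (fun z' => X z' = Y z') ->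
  smooth_section z X -> smooth_section z Y.
Proof.
move=> E sX; apply: (smooth_near_ext _ sX).
have {}E : \forall u \near Tcoord (chart_at (base z)) z,
  X (Tuncoord (chart_at (base z)) u) = Y (Tuncoord (chart_at (base z)) u) by exact: E.
by apply: filterS E => u Eu; rewrite /section_rep Eu.
Qed.

Lemma smooth_vfield_ext z (X Y : vfield M) : near_TM z (fun z' => X z' = Y z') ->
  smooth_vfield z X -> smooth_vfield z Y.
Proof.
move=> E sX; apply: (smooth_near_ext _ sX).
have {}E : \forall u \near Tcoord (chart_at (base z)) z,
  X (Tuncoord (chart_at (base z)) u) = Y (Tuncoord (chart_at (base z)) u) by exact: E.
by apply: filterS E => u Eu; rewrite /vfield_rep Eu.
Qed.

Lemma act_ext z w (f g : TM -> R) : near_TM z (fun z' => f z' = g z') -> act z w f = act z w g.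
Proof. exact: near_eq_derive. Qed.

Definition csec c (xi : V) : section M := fun z => tuncoord c (base z) xi.

Lemma near_rep c z (P : VV -> Prop) : in_chart c z ->
  (forall u, in_chart c (Tuncoord c u) -> Tcoord c (Tuncoord c u) = u -> P u) ->
  \forall u \near Tcoord c z, P u.
Proof.
move=> [ac d] HP; apply: filterS (near_Toverlap d d) => u [q1 q2].
by apply: HP; [split|rewrite TuncoordK].
Qed.

Lemma csec_rep c z xi : in_chart c z -> \forall u \near Tcoord c z, section_rep c (csec c xi) u = xi.
Proof. by move=> a; apply: near_rep => // u [ac d] _; rewrite /section_rep /csec tuncoordK. Qed.

Lemma smooth_csec c z xi : in_chart c z -> smooth_section z (csec c xi).
Proof.
move=> a; apply/(smooth_sectionP _ a).
apply: (@smooth_near_ext _ _ _ (fun=> xi)); last exact: smooth_near_cst.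
by apply: filterS (csec_rep xi a) => u ->.
Qed.

Lemma yvec_rep c z : in_chart c z -> \forall u \near Tcoord c z, section_rep c (@vec R n M) u = u.2.
Proof.
move=> a; apply: near_rep => // u [ac d] E.
by rewrite -[in RHS]E.
Qed.

Lemma smooth_yvec z : smooth_section z (@vec R n M).
Proof.
apply: (@smooth_near_ext _ _ _ snd); last exact: smooth_near_lin.
by apply: filterS (yvec_rep (in_chart_at z)) => u ->.
Qed.

(* A vector field that projects exactly, not only near a point, onto X, so that
   [rhof (hlift c X) = X] holds as an equality of functions. *)
Definition hlift c X : vfield M :=
  fun z => (X z, (TTuncoord c z (tcoord c (base z) (X z), 0)).2).

Lemma hliftE c z X : in_chart c z -> hlift c X z = TTuncoord c z (tcoord c (base z) (X z), 0).
Proof.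
move=> [ac d]; rewrite /hlift; have := TTuncoord_fst (tcoord c (base z) (X z), 0) ac d.
by rewrite /= tcoordK//; case: (TTuncoord _ _ _) => a b /= ->.
Qed.

Lemma hlift_rep c z X : in_chart c z ->
  \forall u \near Tcoord c z, vfield_rep c (hlift c X) u = (section_rep c X u, 0).
Proof.
by move=> a; apply: near_rep => // u [ac d] E; rewrite /vfield_rep hliftE// TTuncoordK.
Qed.

Lemma smooth_hlift c z X : in_chart c z -> smooth_section z X -> smooth_vfield z (hlift c X).
Proof.
move=> a /(smooth_sectionP X a) sX; apply/(smooth_vfieldP _ a).
apply: (@smooth_near_ext _ _ _ (fun u => (section_rep c X u, 0))).
  by apply: filterS (hlift_rep X a) => u ->.
by apply: (smooth_near_pair sX); exact: smooth_near_cst.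
Qed.

Definition vert X : vfield M := fun z => (0, X z).

Lemma vert_rep c z X : in_chart c z ->
  \forall u \near Tcoord c z, vfield_rep c (vert X) u = (0, section_rep c X u).
Proof.
by move=> a; apply: near_rep => // u [ac d] E; rewrite /vfield_rep TTcoord_vert.
Qed.

Lemma smooth_vert z X : smooth_section z X -> smooth_vfield z (vert X).
Proof.
move=> sX; apply: (@smooth_near_ext _ _ _ (fun u => (0, section_rep (chart_at (base z)) X u))).
  by apply: filterS (vert_rep X (in_chart_at z)) => u ->.
by apply: (smooth_near_pair _ sX); exact: smooth_near_cst.
Qed.

Lemma smooth_vfield_add z (X Y : vfield M) : smooth_vfield z X -> smooth_vfield z Y ->
  smooth_vfield z (fun z' => X z' + Y z').
Proof.
move=> sX sY; have a := in_chart_at z.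
apply: (@smooth_near_ext _ _ _ (fun u => vfield_rep (chart_at (base z)) X u + vfield_rep (chart_at (base z)) Y u)).
  apply: near_rep => // u [ac d] E; rewrite /vfield_rep.
  by rewrite (linear_add _ _ (TTcoord_linear ac d)).
exact: (smooth_near_add sX sY).
Qed.

Lemma smooth_section_opp z X : smooth_section z X -> smooth_section z (fun z' => - X z').
Proof.
move=> sX; have a := in_chart_at z.
apply: (@smooth_near_ext _ _ _ (fun u => - section_rep (chart_at (base z)) X u)).
  apply: near_rep => // u [ac d] E; rewrite /section_rep.
  by rewrite (linear_opp _ (tcoord_linear ac d)).
exact: (smooth_near_opp sX).
Qed.

Lemma smooth_section_scale z (f : TM -> R) X : smooth_fun z f -> smooth_section z X ->
  smooth_section z (fun z' => f z' *: X z').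
Proof.
move=> sf sX; have a := in_chart_at z.
apply: (@smooth_near_ext _ _ _ (fun u => f (Tuncoord (chart_at (base z)) u) *: section_rep (chart_at (base z)) X u)).
  apply: near_rep => // u [ac d] E; rewrite /section_rep.
  by rewrite (linear_scale _ _ (tcoord_linear ac d)).
exact: (smooth_near_scale sf sX).
Qed.

Lemma smooth_fun_coord c z X i : in_chart c z -> smooth_section z X ->
  smooth_fun z (fun z' => tcoord c (base z') (X z') 0 i).
Proof.
move=> a /(smooth_sectionP X a) sX; apply/(smooth_funP _ a).
apply: (@smooth_near_linear_comp _ _ _ _ _ (section_rep c X) (fun v : V => v 0 i : R^o)) => //.
by move=> k u v; rewrite !mxE.
Qed.

End Reps.
#[global] Hint Resolve in_chart_at : core.

(** * Finsler functions in charts *)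

Section FinslerChart.
Variables (R : realType) (n : nat) (M : smoothManifold R n) (F : finsler M).
Local Notation V := 'rV[R]_n.
Local Notation VV := (V * V)%type.
Local Notation TM := (tangent_bundle M).
Implicit Types (c : chart R n M) (p : M) (z : TM) (u : VV) (X Y : section M).

Definition Fsq c (u : VV) : R^o := F (Tuncoord c u) ^+ 2.

Lemma smooth_F c z : in_chart c z -> slit z -> smooth_near (fun u => F (Tuncoord c u) : R^o) (Tcoord c z).
Proof. by move=> a sz; exact: ((smooth_funP _ a).1 (fin_smooth F sz)). Qed.

Lemma smooth_Fsq c z : in_chart c z -> slit z -> smooth_near (Fsq c) (Tcoord c z).
Proof.
move=> a sz; have sF := smooth_F a sz.
apply: (@smooth_near_ext _ _ _ (fun u => (F (Tuncoord c u) : R^o) *: (F (Tuncoord c u) : R^o))).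
  by apply: filterE => u; rewrite /Fsq expr2.
exact: (smooth_near_scale sF sF).
Qed.

Lemma Fsq_tcoord c z y : in_chart c z -> F (TPoint (base z) y) ^+ 2 = Fsq c (coord c (base z), tcoord c (base z) y).
Proof. by move=> [ac d]; rewrite /Fsq /Tuncoord /= chartK// tcoordK. Qed.

Lemma derive_tcoord (W : normedModType R) c z (h : VV -> W) y v : in_chart c z ->
  'D_v (fun y => h (coord c (base z), tcoord c (base z) y)) y =
  'D_(0, tcoord c (base z) v) h (coord c (base z), tcoord c (base z) y).
Proof.
move=> [ac d].
apply: (@derive_comp_affine _ _ _ _ (fun v => (0, tcoord c (base z) v)) (fun y => (coord c (base z), tcoord c (base z) y))) => k a b.
by rewrite (tcoord_linear ac d) -[RHS]/(k *: 0 + _, _) scaler0 add0r.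
Qed.

Lemma fundamental_chart c z v w : in_chart c z -> fundamental F z v w =
  2^-1 * 'D_(0, tcoord c (base z) v) ('D_(0, tcoord c (base z) w) (Fsq c)) (Tcoord c z).
Proof.
move=> a; rewrite /fundamental; apply: (congr1 ( *%R 2^-1)).
have -> : (fun y => F (TPoint (base z) y) ^+ 2 : R^o) =
    fun y => Fsq c (coord c (base z), tcoord c (base z) y).
  by apply/funext => y; exact: Fsq_tcoord.
have -> : (fun y => 'D_w (fun y => Fsq c (coord c (base z), tcoord c (base z) y)) y) =
    fun y => 'D_(0, tcoord c (base z) w) (Fsq c) (coord c (base z), tcoord c (base z) y).
  by apply/funext => y; exact: (derive_tcoord (Fsq c)).
exact: (derive_tcoord ('D_(0, tcoord c (base z) w) (Fsq c))).
Qed.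

Lemma cartan_chart c z v w t : in_chart c z -> cartan F z v w t =
  4^-1 * F z * 'D_(0, tcoord c (base z) v) ('D_(0, tcoord c (base z) w)
    ('D_(0, tcoord c (base z) t) (Fsq c))) (Tcoord c z).
Proof.
move=> a; rewrite /cartan; apply: (congr1 ( *%R (4^-1 * F z))).
have -> : (fun y => F (TPoint (base z) y) ^+ 2 : R^o) =
    fun y => Fsq c (coord c (base z), tcoord c (base z) y).
  by apply/funext => y; exact: Fsq_tcoord.
have -> : (fun y => 'D_t (fun y => Fsq c (coord c (base z), tcoord c (base z) y)) y) =
    fun y => 'D_(0, tcoord c (base z) t) (Fsq c) (coord c (base z), tcoord c (base z) y).
  by apply/funext => y; exact: (derive_tcoord (Fsq c)).
have -> : (fun y => 'D_w (fun y => 'D_(0, tcoord c (base z) t) (Fsq c) (coord c (base z), tcoord c (base z) y)) y) =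
    fun y => 'D_(0, tcoord c (base z) w) ('D_(0, tcoord c (base z) t) (Fsq c)) (coord c (base z), tcoord c (base z) y).
  by apply/funext => y; exact: (derive_tcoord ('D_(0, tcoord c (base z) t) (Fsq c))).
exact: (derive_tcoord ('D_(0, tcoord c (base z) w) ('D_(0, tcoord c (base z) t) (Fsq c)))).
Qed.

(** * Homogeneity along a fibre *)

Section Fiber.
Variables (c : chart R n M) (x : V).
Hypotheses (ac : atlas c) (cx : (coord c @` dom c) x).

Lemma fiber_in_chart y : in_chart c (Tuncoord c (x, y)).
Proof. by split=> //; have [] := uncoord_dom cx. Qed.

Lemma fiber_slit y : y != 0 -> slit (Tuncoord c (x, y)).
Proof.
move=> y0; have [d _] := uncoord_dom cx; rewrite /slit /= /Tuncoord /=.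
apply: contra_neq y0 => E.
by rewrite -(tuncoordK y ac d) E; exact: linear_zero (tcoord_linear ac d).
Qed.

Lemma fiber_Tcoord y : Tcoord c (Tuncoord c (x, y)) = (x, y).
Proof. exact: TuncoordK. Qed.

Lemma fiber_smooth_F y : y != 0 -> smooth_near (fun u => F (Tuncoord c u) : R^o) (x, y).
Proof. by move=> y0; rewrite -fiber_Tcoord; apply: smooth_F; [exact: fiber_in_chart|exact: fiber_slit]. Qed.

Lemma fiber_smooth_Fsq y : y != 0 -> smooth_near (Fsq c) (x, y).
Proof. by move=> y0; rewrite -fiber_Tcoord; apply: smooth_Fsq; [exact: fiber_in_chart|exact: fiber_slit]. Qed.

Lemma fiber_diff (W : normedModType R) (h : VV -> W) y :
  differentiable h (x, y) -> differentiable (fun y => h (x, y)) y.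
Proof.
by move=> dh; apply: (@differentiable_comp _ _ _ _ (fun y => (x, y))) => //.
Qed.

Lemma fiber_homogeneous (k : R) y : 0 < k -> F (Tuncoord c (x, k *: y)) = k * F (Tuncoord c (x, y)).
Proof.
move=> k0; have [d _] := uncoord_dom cx.
by rewrite /Tuncoord /= (linear_scale _ _ (tuncoord_linear ac d)) fin_homo.
Qed.

Lemma fiber_D1_homogeneous w y (k : R) : 0 < k -> y != 0 ->
  'D_(0, w) (Fsq c) (x, k *: y) = k * 'D_(0, w) (Fsq c) (x, y).
Proof.
move=> k0 y0; rewrite -!derive_fiber -[k in RHS]expr1.
apply: derive_homogeneous => // [y' k' k'0 y'0|y' y'0].
  by rewrite /Fsq fiber_homogeneous// exprMn.
by apply: (@fiber_diff _ (Fsq c)); apply: smooth_near_diff; exact: fiber_smooth_Fsq.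
Qed.

Lemma fiber_D2_homogeneous v w y (k : R) : 0 < k -> y != 0 ->
  'D_(0, v) ('D_(0, w) (Fsq c)) (x, k *: y) = 'D_(0, v) ('D_(0, w) (Fsq c)) (x, y).
Proof.
move=> k0 y0; rewrite -!derive_fiber -[RHS]mul1r -[1 in RHS](expr0 k).
apply: derive_homogeneous => // [y' k' k'0 y'0|y' y'0].
  by rewrite fiber_D1_homogeneous// expr1.
apply: (@fiber_diff _ ('D_(0, w) (Fsq c))); apply: smooth_near_diff.
by apply: smooth_near_derive; exact: fiber_smooth_Fsq.
Qed.

Lemma fiber_euler1 w y : y != 0 ->
  'D_(0, y) ('D_(0, w) (Fsq c)) (x, y) = 'D_(0, w) (Fsq c) (x, y).
Proof.
move=> y0; rewrite -derive_fiber.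
by apply: (@euler1 _ _ (fun y => 'D_(0, w) (Fsq c) (x, y))) => k k0; rewrite fiber_D1_homogeneous.
Qed.

Lemma fiber_euler0 v w y : y != 0 ->
  'D_(0, y) ('D_(0, v) ('D_(0, w) (Fsq c))) (x, y) = 0.
Proof.
move=> y0; rewrite -derive_fiber.
by apply: (@euler0 _ _ (fun y => 'D_(0, v) ('D_(0, w) (Fsq c)) (x, y))) => k k0; rewrite fiber_D2_homogeneous.
Qed.

Lemma fiber_euler2 y : y != 0 -> 'D_(0, y) (Fsq c) (x, y) = 2 * Fsq c (x, y).
Proof.
move=> y0; have dF := smooth_near_diff (fiber_smooth_F y0).
have -> : Fsq c = fun u => (F (Tuncoord c u) : R^o) *: (F (Tuncoord c u) : R^o).
  by apply/funext => u; rewrite /Fsq expr2.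
rewrite (differentiable_scale dF dF).2 -derive_fiber.
rewrite (@euler1 _ _ (fun y => F (Tuncoord c (x, y)) : R^o)); last first.
  by move=> k k0; rewrite fiber_homogeneous.
by rewrite /GRing.scale /=; ring.
Qed.

(** The identity g(y, y) = F^2: Euler's identity for the 1-homogeneous first derivative, then for
    the 2-homogeneous F^2. *)
Lemma fiber_energy y : y != 0 -> 2^-1 * 'D_(0, y) ('D_(0, y) (Fsq c)) (x, y) = Fsq c (x, y).
Proof. by move=> y0; rewrite fiber_euler1// fiber_euler2// mulKf. Qed.

End Fiber.

(** A Finsler function is only assumed nonnegative; its positivity comes from F^2 = g(y, y) and the
    positive definiteness of g. *)
Lemma F_neq0 z : slit z -> F z != 0.
Proof.
move=> sz; have a := in_chart_at z; have [ac d] := a.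
have := fin_posdef F sz sz; rewrite (fundamental_chart _ _ a) tcoord_id.
have y0 : vec z != 0 by exact: sz.
have E : Tcoord (chart_at (base z)) z = (coord (chart_at (base z)) (base z), vec z).
  by rewrite /Tcoord tcoord_id.
rewrite E (fiber_energy ac (coord_im d) y0).
by rewrite -E /Fsq TcoordK//; apply: contraTneq => ->; rewrite expr0n ltxx.
Qed.

End FinslerChart.

(** * Torsion-free connections *)

Section Connection.
Variables (R : realType) (n : nat) (M : smoothManifold R n).
Local Notation V := 'rV[R]_n.
Local Notation VV := (V * V)%type.
Local Notation TM := (tangent_bundle M).
Variable D : connection M.
Implicit Types (c : chart R n M) (p : M) (z : TM) (u w : VV) (X Y Z : section M).

Lemma act_cst z w (k : R) : act z w (fun=> k) = 0.
Proof. exact: derive_cst. Qed.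

Lemma smooth_fun_cst z (k : R) : smooth_fun z (fun=> k).
Proof. exact: smooth_near_cst. Qed.

Lemma smooth_section0 z : smooth_section z (fun=> 0).
Proof.
have a := in_chart_at z; apply: (@smooth_near_ext _ _ _ (fun=> 0)); last exact: smooth_near_cst.
apply: near_rep => // u [ac d] _; rewrite /section_rep.
by rewrite (linear_zero (tcoord_linear ac d)).
Qed.

Lemma smooth_section_add z X Y : smooth_section z X -> smooth_section z Y ->
  smooth_section z (fun z' => X z' + Y z').
Proof.
move=> sX sY; have a := in_chart_at z.
apply: (@smooth_near_ext _ _ _ (fun u => section_rep (chart_at (base z)) X u + section_rep (chart_at (base z)) Y u)).
  apply: near_rep => // u [ac d] E; rewrite /section_rep.
  by rewrite (linear_add _ _ (tcoord_linear ac d)).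
exact: (smooth_near_add sX sY).
Qed.

Lemma cov_scale z (k : R) X w : slit z -> smooth_section z X ->
  D z w (fun z' => k *: X z') = k *: D z w X.
Proof.
move=> sz sX; rewrite (@cov_leibniz _ _ _ D z sz (fun=> k) X (smooth_fun_cst z k) sX).
by rewrite act_cst scale0r add0r.
Qed.

Lemma cov_zero z X w : slit z -> near_TM z (fun z' => X z' = 0) -> D z w X = 0.
Proof.
move=> sz X0; have s0 := smooth_section0 z.
rewrite (@cov_local _ _ _ D z sz X (fun z' => 0 *: (0 : V))).
- by rewrite (@cov_scale z 0 (fun=> 0))// scale0r.
- by apply: smooth_section_ext s0; apply: near_TMS X0 => z' ->.
- by apply: near_TMS X0 => z' ->; rewrite scale0r.
Qed.

Lemma cov_bigsum z (I : Type) (r : seq I) (X : I -> section M) w : slit z ->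
  (forall i, smooth_section z (X i)) ->
  smooth_section z (fun z' => \sum_(i <- r) X i z') /\
  D z w (fun z' => \sum_(i <- r) X i z') = \sum_(i <- r) D z w (X i).
Proof.
move=> sz sX; elim: r => [|i r [sr IH]].
  under eq_fun do rewrite big_nil; rewrite big_nil; split; first exact: smooth_section0.
  by apply: cov_zero => //; apply: filterE.
under eq_fun do rewrite big_cons; rewrite big_cons; split.
  exact: (smooth_section_add (sX i) sr).
by rewrite (cov_add D sz (sX i) sr) IH.
Qed.

(** The connection form in the frame of [c]: the section [csec c xi] has constant components there,
    so only the term of order zero is left. *)
Definition Gamma_chart c z w (xi : V) : V := tcoord c (base z) (D z w (csec c xi)).

(** Near [z] a section is the combination of the frame sections with its components as coefficients,
    and locality allows the Leibniz rule to be applied to that sum. *)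
Lemma cov_frame c z w X : slit z -> in_chart c z -> smooth_section z X ->
  tcoord c (base z) (D z w X) =
  'D_(TTcoord c z w) (section_rep c X) (Tcoord c z) +
  \sum_i (tcoord c (base z) (X z) 0 i) *: Gamma_chart c z w (delta_mx 0 i).
Proof.
move=> sz a sX; have [ac d] := a.
pose Xi i z' : R := tcoord c (base z') (X z') 0 i.
pose E i := csec c (delta_mx 0 i).
have sXi i : smooth_fun z (Xi i) by exact: (smooth_fun_coord _ a sX).
have sE i : smooth_section z (E i) by exact: smooth_csec.
have sS i := smooth_section_scale (sXi i) (sE i).
have [_ B] := @cov_bigsum z 'I_n (index_enum _) (fun i z' => Xi i z' *: E i z') w sz sS.
rewrite (@cov_local _ _ _ D z sz X (fun z' => \sum_i Xi i z' *: E i z') sX); last first.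
  apply: near_TMS (near_in_chart a) => z' [_ d']; rewrite -[LHS](tcoordK _ ac d').
  rewrite [in LHS](row_sum_delta (tcoord c (base z') (X z'))).
  rewrite (linear_bigsum _ _ (tuncoord_linear ac d')).
  by apply: eq_bigr => i _; rewrite (linear_scale _ _ (tuncoord_linear ac d')).
rewrite B (eq_bigr _ (fun i _ => @cov_leibniz _ _ _ D z sz (Xi i) (E i) (sXi i) (sE i) w)).
rewrite big_split /= (linear_add _ _ (tcoord_linear ac d)); congr (_ + _); last first.
  rewrite (linear_bigsum _ _ (tcoord_linear ac d)); apply: eq_bigr => i _.
  exact: (linear_scale _ _ (tcoord_linear ac d)).
rewrite (linear_bigsum _ _ (tcoord_linear ac d)) [RHS]row_sum_delta; apply: eq_bigr => i _.
rewrite (linear_scale _ _ (tcoord_linear ac d)) /E /csec tuncoordK//; congr (_ *: _).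
have dX : differentiable (section_rep c X) (Tcoord c z).
  by apply: smooth_near_diff; exact: ((smooth_sectionP X a).1 sX).
have lin : linear (fun v : V => v 0 i : R^o) by move=> k u v; rewrite !mxE.
rewrite (act_chart w a (sXi i)).
have cL : continuous (fun v : V => v 0 i : R^o) by exact: linear_findim_continuous.
exact: (derive_linear_comp _ lin cL dX).
Qed.

Lemma Gamma_chartE c z w xi : slit z -> in_chart c z ->
  Gamma_chart c z w xi = \sum_i (xi 0 i) *: Gamma_chart c z w (delta_mx 0 i).
Proof.
move=> sz a; have [ac d] := a.
rewrite {1}/Gamma_chart (cov_frame _ sz a (smooth_csec _ a)).
rewrite (near_eq_derive _ (csec_rep xi a)) derive_cst add0r.
by rewrite /csec tuncoordK.
Qed.

Lemma cov_chart c z w X : slit z -> in_chart c z -> smooth_section z X ->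
  tcoord c (base z) (D z w X) =
  'D_(TTcoord c z w) (section_rep c X) (Tcoord c z) + Gamma_chart c z w (tcoord c (base z) (X z)).
Proof. by move=> sz a sX; rewrite cov_frame// -Gamma_chartE. Qed.

Lemma Gamma_chart_linear_r c z w : slit z -> in_chart c z -> linear (Gamma_chart c z w).
Proof.
move=> sz a k x y; rewrite (Gamma_chartE _ (k *: x + y) sz a) (Gamma_chartE _ x sz a) (Gamma_chartE _ y sz a).
rewrite scaler_sumr -big_split; apply: eq_bigr => i _.
by rewrite !mxE scalerDl scalerA.
Qed.

Lemma Gamma_chart_linear_l c z xi : slit z -> in_chart c z -> linear (fun w => Gamma_chart c z w xi).
Proof.
move=> sz a k x y; rewrite /Gamma_chart (cov_linear D sz (smooth_csec xi a)).
by have [ac d] := a; rewrite (tcoord_linear ac d).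
Qed.

Lemma cov_linear_l z X : slit z -> smooth_section z X -> linear (fun w => D z w X).
Proof. by move=> sz sX k x y; rewrite (cov_linear D sz sX). Qed.

Variable F : finsler M.
Hypothesis tor : torsion_eq F D (@tensor0 R n M).

(** [raise] picks a solution of a linear equation. Testing the chosen vector against itself,
    positive definiteness leaves only 0. *)
Lemma raise_tensor0 X Y z : slit z -> raise F (@tensor0 R n M) X Y z = 0.
Proof.
move=> sz; rewrite /raise; set S := (X in get X).
have S0 : S 0.
  move=> Z sZ; rewrite (fundamental_chart _ _ _ (in_chart_at z)) !tcoord_id.
  by rewrite (_ : (0, 0) = 0 :> VV)// derive0 mulr0.
have St := getPex (ex_intro _ _ S0).
apply/eqP; apply: contrapT => /negP n0.
have := fin_posdef F sz n0.
have := St _ (smooth_csec (get S) (in_chart_at z)).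
by rewrite /csec tuncoord_id => ->; rewrite /tensor0 ltxx.
Qed.

Lemma torsion_free z (X Y : vfield M) : slit z -> smooth_vfield z X -> smooth_vfield z Y ->
  covf D X (rhof Y) z - covf D Y (rhof X) z = rho (bracket X Y z).
Proof.
move=> sz sX sY; have := tor sz sX sY.
rewrite !raise_tensor0// !scaler0 subrr => /eqP; rewrite subr_eq0 => /eqP.
by [].
Qed.

Lemma bracket_cst z (X Y : vfield M) x y :
  (\forall u \near Tcoord (chart_at (base z)) z, vfield_rep (chart_at (base z)) X u = x) ->
  (\forall u \near Tcoord (chart_at (base z)) z, vfield_rep (chart_at (base z)) Y u = y) ->
  bracket X Y z = 0.
Proof.
move=> hX hY; have EX v := etrans (@near_eq_derive _ _ _ _ (fun=> x) _ v hX) (derive_cst _ _ _).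
have EY v := etrans (@near_eq_derive _ _ _ _ (fun=> y) _ v hY) (derive_cst _ _ _).
exact: (etrans (congr2 (fun a b => a - b) (EY (X z)) (EX (Y z))) (subrr 0)).
Qed.

Let hl c xi := hlift c (csec c xi).

Lemma hl_rep c z xi : in_chart c z ->
  \forall u \near Tcoord c z, vfield_rep c (hl c xi) u = (xi, 0).
Proof.
by move=> a; apply: filterS2 (hlift_rep (csec c xi) a) (csec_rep xi a) => u -> ->.
Qed.

Lemma hl_at z xi : hl (chart_at (base z)) xi z = (xi, 0).
Proof.
have a := in_chart_at z; rewrite /hl hliftE// /csec tuncoordK//.
exact: TTuncoord_id.
Qed.

(** The torsion equation for a constant vertical field and a lifted constant section: the two fields
    commute and the vertical one projects to 0, so a single term remains. Hence with T = 0 the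
    connection form has no dy part. *)
Lemma cov_vert_own z b xi : slit z -> D z (0, b) (csec (chart_at (base z)) xi) = 0.
Proof.
move=> sz; have a := in_chart_at z; set c := chart_at (base z) in a *.
have sb := smooth_csec b a; have sxi := smooth_csec xi a.
have H := torsion_free sz (smooth_vert sb) (smooth_hlift a sxi).
have hV : \forall u \near Tcoord c z, vfield_rep c (vert (csec c b)) u = (0, b).
  by apply: filterS2 (vert_rep (csec c b) a) (csec_rep b a) => u -> ->.
move: H; rewrite (bracket_cst hV (hl_rep xi a)) /covf.
rewrite (_ : vert (csec c b) z = (0, b)); last by rewrite /vert /csec tuncoord_id.
rewrite [X in _ - X](_ : _ = 0) ?subr0//.
by apply: cov_zero => //; apply: filterE.
Qed.

Lemma section_rep_csec_vert c c' xi x y b :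
  'D_(0, b) (section_rep c' (csec c xi)) (x, y) = 0.
Proof.
rewrite -derive_fiber.
have -> : (fun y => section_rep c' (csec c xi) (x, y)) = fun=> section_rep c' (csec c xi) (x, 0).
  by apply/funext => y'; rewrite /section_rep /csec /=.
exact: derive_cst.
Qed.

(** The components of a section constant in one chart depend on x only in any other, so the
    vanishing in the preferred chart carries over. *)
Lemma Gamma_chart_vert c z b xi : slit z -> in_chart c z -> Gamma_chart c z (0, b) xi = 0.
Proof.
move=> sz a; have a0 := in_chart_at z; have [ac d] := a.
suff E : D z (0, b) (csec c xi) = 0 by rewrite /Gamma_chart E (linear_zero (tcoord_linear ac d)).
have := cov_chart (0, b) sz a0 (smooth_csec xi a).
rewrite tcoord_id /Gamma_chart tcoord_id cov_vert_own// addr0 TTcoord_id => ->.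
rewrite [Tcoord _ _]surjective_pairing.
exact: section_rep_csec_vert.
Qed.

Lemma cov_vert c z b X : slit z -> in_chart c z -> smooth_section z X ->
  tcoord c (base z) (D z (0, b) X) =
  'D_(0, tcoord c (base z) b) (section_rep c X) (Tcoord c z).
Proof.
move=> sz a sX; rewrite (cov_chart _ sz a sX) Gamma_chart_vert// addr0.
by have [ac d] := a; rewrite TTcoord_vert.
Qed.

(* The Christoffel coefficients in the preferred chart at [base z]; by
   [cov_vert_own] the vertical part of the direction does not contribute. *)
Definition Gamma z (a xi : V) : V := D z (a, 0) (csec (chart_at (base z)) xi).

(** Constant coordinate fields commute, so the torsion equation with T = 0 leaves only the
    difference of the two covariant derivatives. *)
Lemma Gamma_sym z x y : slit z -> Gamma z x y = Gamma z y x.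
Proof.
move=> sz; have a := in_chart_at z; set c := chart_at (base z) in a *.
have sx := smooth_csec x a; have sy := smooth_csec y a.
have := torsion_free sz (smooth_hlift a sx) (smooth_hlift a sy).
have hx : hlift c (csec c x) z = (x, 0) := hl_at z x.
have hy : hlift c (csec c y) z = (y, 0) := hl_at z y.
rewrite (bracket_cst (hl_rep x a) (hl_rep y a)) /covf hx hy.
by move/eqP; rewrite subr_eq0 => /eqP.
Qed.

Lemma Gamma_linear_r z x : slit z -> linear (Gamma z x).
Proof.
move=> sz k a b.
have E xi : Gamma_chart (chart_at (base z)) z (x, 0) xi = Gamma z x xi := tcoord_id _ _.
by rewrite -!E; exact: (Gamma_chart_linear_r (x, 0) sz (in_chart_at z) k a b).
Qed.

Lemma Gamma_linear_l z y : slit z -> linear (Gamma z ^~ y).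
Proof. by move=> sz k a b; rewrite ![Gamma _ _ y]Gamma_sym//; exact: Gamma_linear_r. Qed.

Lemma cov_own z w X : slit z -> smooth_section z X ->
  D z w X = 'D_w (section_rep (chart_at (base z)) X) (Tcoord (chart_at (base z)) z)
    + Gamma z w.1 (X z).
Proof.
move=> sz sX; have := cov_chart w sz (in_chart_at z) sX; rewrite !tcoord_id TTcoord_id => ->.
congr (_ + _); rewrite /Gamma.
have E : w = 1 *: (w.1, 0) + (0, w.2).
  by rewrite scale1r [LHS]surjective_pairing -[RHS]/(_ + 0, 0 + _) addr0 add0r.
rewrite [in LHS]E (Gamma_chart_linear_l _ sz (in_chart_at z)) scale1r Gamma_chart_vert// addr0.
by rewrite /Gamma_chart tcoord_id.
Qed.

Lemma Fell z : slit z -> F z *: ell F z = vec z.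
Proof. by move=> sz; rewrite /ell scalerA mulfV ?scale1r// F_neq0. Qed.

Lemma near_Fell z : slit z -> near_TM z (fun z' => F z' *: ell F z' = vec z').
Proof. by move=> sz; apply: near_TMS (near_slit sz) => z'; exact: Fell. Qed.

Lemma smooth_Fell z : slit z -> smooth_section z (fun z' => F z' *: ell F z').
Proof.
move=> sz; apply: smooth_section_ext (smooth_yvec z).
by apply: near_TMS (near_Fell sz) => z' ->.
Qed.

Lemma mu_vec z w : slit z -> mu F D z w = D z w (@vec R n M).
Proof. by move=> sz; apply: cov_local => //; [exact: smooth_Fell|exact: near_Fell]. Qed.

(** F ell is the vector y, with components the fibre coordinates, whose derivative along [w] is
    [w.2]. So [w] is horizontal exactly when [w.2] is minus Gamma of [w.1] and y. *)
Lemma muE z w : slit z -> mu F D z w = w.2 + Gamma z w.1 (vec z).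
Proof.
move=> sz; rewrite mu_vec// (cov_own w sz (smooth_yvec z)).
by rewrite (near_eq_derive _ (yvec_rep (in_chart_at z))) (@derive_lin _ _ _ (snd : VV -> V)).
Qed.

Lemma mu_vert z b : slit z -> mu F D z (0, b) = b.
Proof. by move=> sz; rewrite muE//= (linear_zero (Gamma_linear_l _ sz)) addr0. Qed.

Lemma mu_linear z : slit z -> linear (mu F D z).
Proof. by move=> sz; apply: cov_linear_l => //; exact: smooth_Fell. Qed.

Lemma horizontal_unique z a b b' : slit z -> mu F D z (a, b) = 0 -> mu F D z (a, b') = 0 -> b = b'.
Proof. by move=> sz; rewrite !muE//= => <- /eqP; rewrite eq_sym (can_eq (addrK _)) => /eqP. Qed.

(** [hpart] is a choice among decompositions. As [mu] is the identity on vertical vectors, a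
    horizontal vector is determined by its projection, and the choice becomes an explicit
    formula. *)
Lemma hpartE (W : vfield M) z : slit z -> hpart F D W z = W z - (0, mu F D z (W z)).
Proof.
move=> sz; rewrite /hpart; set S := (X in get X).
have S0 : S (W z - (0, mu F D z (W z))).
  split; last by rewrite /vertical /= /rho opprB addrCA subrr addr0.
  rewrite /horizontal /= (linear_add _ _ (mu_linear sz)) (linear_opp _ (mu_linear sz)).
  by rewrite mu_vert// subrr.
have [h1 h2] := getPex (ex_intro _ _ S0); have [k1 k2] := S0.
move: S0 h1 h2 k1 k2; set h := get S; set k := W z - _ => _ h1 h2 k1 k2.
have e : h.1 = k.1.
  have e1 : (W z).1 = h.1 by apply/eqP; rewrite -subr_eq0; apply/eqP; exact: h2.
  have e2 : (W z).1 = k.1 by apply/eqP; rewrite -subr_eq0; apply/eqP; exact: k2.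
  by rewrite -e1 e2.
rewrite (surjective_pairing h) (surjective_pairing k) e; congr pair.
apply: (horizontal_unique (a := k.1) sz); last by rewrite -surjective_pairing.
by rewrite -e -surjective_pairing.
Qed.

Lemma lbarE z : slit z -> lbar F D z = (ell F z, - Gamma z (ell F z) (vec z)).
Proof.
move=> sz; rewrite /lbar; set S := (X in get X).
have S0 : S (ell F z, - Gamma z (ell F z) (vec z)).
  by split=> //; rewrite /horizontal /= muE//= addNr.
have [h1 h2] := getPex (ex_intro _ _ S0); have [k1 k2] := S0.
move: h1 h2 k1 k2; rewrite /horizontal /rho /=.
case: (get S) => a b /= h1 h2 k1 _; subst a; congr pair.
exact: (horizontal_unique sz h1 k1).
Qed.

Lemma smooth_muf z (W : vfield M) : slit z -> smooth_vfield z W -> smooth_section z (muf F D W).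
Proof.
move=> sz sW; apply: smooth_section_ext (cov_smooth D sz sW (smooth_yvec z)).
by apply: near_TMS (near_slit sz) => z' sz'; rewrite /muf mu_vec.
Qed.

Lemma near_hpart z (W : vfield M) : slit z ->
  near_TM z (fun z' => W z' + vert (fun z' => - muf F D W z') z' = hpart F D W z').
Proof.
move=> sz; apply: near_TMS (near_slit sz) => z' sz'; rewrite hpartE//.
by congr (_ + _); rewrite -[RHS]/(- 0, _) oppr0.
Qed.

Lemma smooth_hpart z (W : vfield M) : slit z -> smooth_vfield z W -> smooth_vfield z (hpart F D W).
Proof.
move=> sz sW; apply: smooth_vfield_ext (near_hpart W sz) _.
exact: (smooth_vfield_add sW (smooth_vert (smooth_section_opp (smooth_muf sz sW)))).
Qed.

Lemma near_vpart z (W : vfield M) : slit z ->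
  near_TM z (fun z' => vert (muf F D W) z' = vpart F D W z').
Proof.
by move=> sz; apply: near_TMS (near_slit sz) => z' sz'; rewrite /vpart hpartE// opprB addrCA subrr addr0.
Qed.

Lemma smooth_ell z : slit z -> smooth_section z (ell F).
Proof.
move=> sz; apply: (@smooth_section_scale _ _ _ _ (fun z' => (F z')^-1)); last exact: smooth_yvec.
apply: smooth_near_inv; last exact: (fin_smooth F sz).
by rewrite TcoordK//; exact: F_neq0.
Qed.

(** The pointwise choice in [lbar] says nothing about regularity; smoothness is taken from the
    horizontal part of a smooth lift of ell, which agrees with [lbar] on the slit bundle. *)
Lemma smooth_lbar z : slit z -> smooth_vfield z (lbar F D).
Proof.
move=> sz; have a := in_chart_at z; have sl := smooth_hlift a (smooth_ell sz).
apply: smooth_vfield_ext (smooth_hpart sz sl).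
apply: near_TMS (near_slit sz) => z' sz'; rewrite hpartE// lbarE// muE//.
rewrite -[LHS]/(_ - 0, _) subr0 /=; congr pair.
by rewrite opprD addrA subrr add0r.
Qed.

End Connection.

(** * The hv-curvature *)

Section Curvature.
Variables (R : realType) (n : nat) (M : smoothManifold R n).
Local Notation V := 'rV[R]_n.
Local Notation VV := (V * V)%type.
Local Notation TM := (tangent_bundle M).
Variables (D : connection M) (F : finsler M).
Hypothesis tor : torsion_eq F D (@tensor0 R n M).
Implicit Types (c : chart R n M) (p : M) (z : TM) (u w : VV) (X Y Z : section M).

Lemma Tcoord_own z : Tcoord (chart_at (base z)) z = (coord (chart_at (base z)) (base z), vec z).
Proof. by rewrite /Tcoord tcoord_id. Qed.

Lemma Tuncoord_own p y : Tuncoord (chart_at p) (coord (chart_at p) p, y) = TPoint p y.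
Proof. by rewrite /Tuncoord /= chartK// tuncoord_id. Qed.

Lemma near_fiber z (P : VV -> Prop) : (\forall u \near Tcoord (chart_at (base z)) z, P u) ->
  \forall y \near vec z, P (coord (chart_at (base z)) (base z), y).
Proof.
rewrite Tcoord_own; set x := coord _ _ => HP.
have ct : {for vec z, continuous (fun y : V => (x, y))}.
  by apply: differentiable_continuous; exact: differentiable_pair.
exact: (ct _ HP).
Qed.

Lemma near_neq0 (y : V) : y != 0 -> \forall y' \near y, y' != 0.
Proof.
by move=> y0; exact: (near_open (@open_neq0 _ _) y0).
Qed.

Local Opaque Gamma hpart vpart mu Tcoord Tuncoord tcoord tuncoord TTcoord.

Section Formula.
Variables (z : TM) (sz : slit z) (X Y : vfield M) (Z : section M).
Hypotheses (sX : smooth_vfield z X) (sY : smooth_vfield z Y) (sZ : smooth_section z Z).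
Let c := chart_at (base z).
Let x0 := coord c (base z).
Let u0 := Tcoord c z.
Let a : in_chart c z := in_chart_at z.
Let H := hpart F D X.
Let W := vpart F D Y.
Let h := vfield_rep c H.
Let b := section_rep c (muf F D Y).
Let zeta := section_rep c Z.

Let sH : smooth_vfield z H := smooth_hpart tor sz sX.
Let smu : smooth_section z (muf F D Y) := smooth_muf D F sz sY.
Let sW : smooth_vfield z W := smooth_vfield_ext (near_vpart tor Y sz) (smooth_vert smu).

Let uK : Tuncoord c u0 = z.
Proof. exact: (TcoordK a.1 a.2). Qed.

Let h_at : h u0 = H z.
Proof. by rewrite /h /vfield_rep uK; exact: TTcoord_id. Qed.

Let b_at : b u0 = mu F D z (Y z).
Proof. by rewrite /b /section_rep uK; exact: tcoord_id. Qed.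

Let W_at : W z = (0, b u0).
Proof. by rewrite b_at /W -(near_TM_self (near_vpart tor Y sz)). Qed.

Let W_rep : \forall u \near u0, vfield_rep c W u = (0, b u).
Proof.
have E : \forall u \near u0, W (Tuncoord c u) = vert (muf F D Y) (Tuncoord c u).
  have E : near_TM z (fun z' => W z' = vert (muf F D Y) z').
    by apply: near_TMS (near_vpart tor Y sz) => z' ->.
  exact: E.
by apply: filterS2 E (vert_rep (muf F D Y) a) => u Eu <-; rewrite /vfield_rep Eu.
Qed.

Let S1_rep : \forall u \near u0, section_rep c (covf D W Z) u = 'D_(0, b u) zeta u.
Proof.
have N := near_TMI (near_smooth_section sZ) (near_TMI (near_slit sz) (near_TMI (near_in_chart a) (near_vpart tor Y sz))).
have O := near_Toverlap (dom_chart_at (base z)) (dom_chart_at (base z)).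
have {}N : \forall u \near u0, smooth_section (Tuncoord c u) Z /\ slit (Tuncoord c u) /\
  in_chart c (Tuncoord c u) /\ vert (muf F D Y) (Tuncoord c u) = W (Tuncoord c u) by exact: N.
apply: filterS2 O N => u [q1 q2] [sZ' [sz' [a' EW]]].
have K := cov_vert tor (muf F D Y (Tuncoord c u)) sz' a' sZ'.
have E : Tcoord c (Tuncoord c u) = u := TuncoordK (atlas_chart_at (base z)) q1.
rewrite E in K.
have -> : section_rep c (covf D W Z) u =
  tcoord c (base (Tuncoord c u)) (D (Tuncoord c u) (W (Tuncoord c u)) Z) by [].
by rewrite -EW; exact: K.
Qed.

Let S2_fiber : \forall y \near vec z, section_rep c (covf D H Z) (x0, y) =
  'D_(h (x0, y)) zeta (x0, y) + Gamma D (TPoint (base z) y) (h (x0, y)).1 (zeta (x0, y)).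
Proof.
have N := near_fiber (near_TMI (near_smooth_section sZ) (near_slit sz)).
apply: filterS N => y; rewrite Tuncoord_own => -[sZ' sz'].
rewrite /h /zeta /vfield_rep /section_rep Tuncoord_own /= tcoord_id.
have -> : TTcoord c (TPoint (base z) y) (H (TPoint (base z) y)) = H (TPoint (base z) y).
  exact: (@TTcoord_id _ _ _ (TPoint (base z) y)).
have E := Tcoord_own (TPoint (base z) y).
have K := cov_own tor (H (TPoint (base z) y)) sz' sZ'.
rewrite E in K; rewrite tcoord_id; exact: K.
Qed.

Let sh : smooth_near h u0 := sH.
Let szeta : smooth_near zeta u0 := sZ.
Let sb : smooth_near b u0 := smu.

Let sDh : smooth_near (fun u => 'D_(h u) zeta u) u0.
Proof. exact: (@smooth_near_dir _ _ _ _ _ _ zeta id h u0 szeta (smooth_near_lin _ (fun _ _ _ => erefl)) sh). Qed.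

Let sS2 : smooth_near (section_rep c (covf D H Z)) u0 := cov_smooth D sz sH sZ.

Let sb0 : smooth_near (fun u => (0 : V, b u)) u0 := smooth_near_pair (smooth_near_cst _ _) sb.

(** The regularity of Gamma in y is only accessible through [cov_smooth]: this function is the
    difference, along the fibre, of the components of the covariant derivative of Z and of a smooth
    directional derivative. *)
Lemma curvature_fiber_diff : differentiable
  (fun y => Gamma D (TPoint (base z) y) (h (x0, y)).1 (zeta (x0, y))) (vec z).
Proof.
have d1 : differentiable (section_rep c (covf D H Z)) (x0, vec z).
  by rewrite -Tcoord_own; exact: smooth_near_diff sS2.
have d2 : differentiable (fun u => 'D_(h u) zeta u) (x0, vec z).
  by rewrite -Tcoord_own; exact: smooth_near_diff sDh.
apply: (differentiable_ext _ (differentiableB (fiber_diff d1) (fiber_diff d2))).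
by apply: filterS S2_fiber => y E; rewrite -[LHS]/(section_rep c (covf D H Z) (x0, y) - 'D_(h (x0, y)) zeta (x0, y)) E addrAC subrr add0r.
Qed.

(** Along vertical vectors D just differentiates components, so Gamma enters through horizontal
    directions only. The second derivatives of the components of Z cancel by Schwarz and the
    first-order terms cancel against the bracket. What remains is the defect in the product rule for
    Gamma with y ignored, that is, minus its fibre derivative. *)
Lemma curvature_formula : curvature D H W Z z =
  Gamma D z (H z).1 ('D_(0, mu F D z (Y z)) zeta u0)
  + Gamma D z ('D_(0, mu F D z (Y z)) h u0).1 (Z z)
  - 'D_(mu F D z (Y z)) (fun y => Gamma D (TPoint (base z) y) (h (x0, y)).1 (zeta (x0, y))) (vec z).
Proof.
have dS2 := smooth_near_diff sS2; have dDh := smooth_near_diff sDh.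
have T1 : covf D H (covf D W Z) z =
    'D_('D_(H z) (fun u => (0, b u)) u0) zeta u0 + 'D_(0, b u0) ('D_(H z) zeta) u0
    + Gamma D z (H z).1 ('D_(0, b u0) zeta u0).
  have K : covf D H (covf D W Z) z = 'D_(H z) (section_rep c (covf D W Z)) u0
      + Gamma D z (H z).1 (covf D W Z z) := cov_own tor (H z) sz (cov_smooth D sz sW sZ).
  have E1 : 'D_(H z) (section_rep c (covf D W Z)) u0 =
      'D_('D_(H z) (fun u => (0, b u)) u0) zeta u0 + 'D_(0, b u0) ('D_(H z) zeta) u0.
    apply: (etrans (near_eq_derive (H z) S1_rep)).
    exact: (derive_dir_schwarz _ szeta (smooth_near_diff sb0)).
  have E2 : covf D W Z z = 'D_(0, b u0) zeta u0.
    have <- := nbhs_singleton S1_rep; rewrite /section_rep uK.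
    exact: (esym (tcoord_id _ _)).
  exact: (etrans K (congr2 (fun r s => r + Gamma D z (H z).1 s) E1 E2)).
have T2 : covf D W (covf D H Z) z =
    'D_('D_(0, b u0) h u0) zeta u0 + 'D_(H z) ('D_(0, b u0) zeta) u0 +
    'D_(b u0) (fun y => Gamma D (TPoint (base z) y) (h (x0, y)).1 (zeta (x0, y))) (vec z).
  have K : covf D W (covf D H Z) z = 'D_(0, b u0) (section_rep c (covf D H Z)) u0
      + Gamma D z 0 (covf D H Z z).
    by rewrite {1}/covf W_at; exact: (cov_own tor (0, b u0) sz sS2).
  have G0 : Gamma D z 0 (covf D H Z z) = 0 := linear_zero (Gamma_linear_l tor (covf D H Z z) sz).
  have e : u0 = (x0, vec z) := Tcoord_own z.
  have E1 : 'D_(0, b u0) (section_rep c (covf D H Z)) u0 =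
      'D_(b u0) (fun y => section_rep c (covf D H Z) (x0, y)) (vec z).
    by rewrite derive_fiber -e.
  have d2 : differentiable (fun u => 'D_(h u) zeta u) (x0, vec z).
    by rewrite -e; exact: dDh.
  have E2 := near_eq_derive (b u0) S2_fiber.
  have E3 := derive_add (b u0) (fiber_diff d2) curvature_fiber_diff.
  have E4 : 'D_(b u0) (fun y => 'D_(h (x0, y)) zeta (x0, y)) (vec z) =
      'D_('D_(0, b u0) h u0) zeta u0 + 'D_(H z) ('D_(0, b u0) zeta) u0.
    apply: (etrans (derive_fiber (fun u => 'D_(h u) zeta u) x0 (vec z) (b u0))).
    rewrite -e -h_at; exact: (derive_dir_schwarz _ szeta (smooth_near_diff sh)).
  have E5 := etrans E1 (etrans E2 (etrans E3 (congr1 (fun r => r + _) E4))).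
  exact: (etrans K (etrans (congr2 +%R E5 G0) (addr0 _))).
have Br : bracket H W z = 'D_(H z) (fun u => (0, b u)) u0 - 'D_(0, b u0) h u0.
  have E1 := near_eq_derive (H z) W_rep.
  exact: (congr2 (fun r s => r - s) E1 (congr1 (fun w => 'D_w h u0) W_at)).
(* [W] has zero x-component near [z], so the x-component of the bracket comes from [h] alone. *)
have B1 : ('D_(H z) (fun u => (0 : V, b u)) u0).1 = 0.
  have E1 := derive_pair (H z) (differentiable_cst (0 : V) u0) (smooth_near_diff sb).
  exact: (etrans (congr1 fst E1) (derive_cst _ _ _)).
have T3 : covf D (bracket H W) Z z =
    'D_('D_(H z) (fun u => (0, b u)) u0) zeta u0 - 'D_('D_(0, b u0) h u0) zeta u0
    - Gamma D z ('D_(0, b u0) h u0).1 (Z z).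
  have lz := derive_linear (smooth_near_diff szeta).
  have K : covf D (bracket H W) Z z = 'D_(bracket H W z) zeta u0
      + Gamma D z (bracket H W z).1 (Z z) := cov_own tor (bracket H W z) sz sZ.
  have E1 : 'D_(bracket H W z) zeta u0 =
      'D_('D_(H z) (fun u => (0, b u)) u0) zeta u0 - 'D_('D_(0, b u0) h u0) zeta u0.
    rewrite Br; apply: (etrans (linear_add _ _ lz)); apply: (congr1 (fun r => _ + r)).
    exact: (linear_opp _ lz).
  have E2 : (bracket H W z).1 = - ('D_(0, b u0) h u0).1.
    rewrite Br; exact: (etrans (congr1 (fun r => r - _) B1) (add0r _)).
  have E3 : Gamma D z (bracket H W z).1 (Z z) = - Gamma D z ('D_(0, b u0) h u0).1 (Z z).
    rewrite E2; exact: (linear_opp _ (Gamma_linear_l tor (Z z) sz)).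
  exact: (etrans K (congr2 +%R E1 E3)).
have S := @schwarz _ _ _ (findim_rV R n) _ _ (0, b u0) (H z) szeta.
have alg (A1 A2 B B' g1 g2 g3 : V) : B = B' ->
    (A1 + B + g1) - (A2 + B' + g3) - (A1 - A2 - g2) = g1 + g2 - g3.
  by move=> ->; apply/rowP => i; rewrite !mxE; ring.
rewrite -b_at.
apply: (etrans (congr2 (fun r s => r - s) (congr2 (fun r s => r - s) T1 T2) T3)).
exact: (alg _ _ _ _ _ _ _ S).
Qed.

End Formula.

Lemma hpart_fst (W : vfield M) z : slit z -> (hpart F D W z).1 = (W z).1.
Proof. by move=> sz; rewrite (hpartE tor)//= subr0. Qed.

(** For constant x, b and xi the first two terms of [curvature_formula] vanish: passing to the
    horizontal part changes only the vertical component of the lift, and the x-component, which is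
    all Gamma sees, stays constant. *)
Lemma derive_Gamma_curvature z (x b xi : V) : slit z -> hv_curvature_vanishes F D ->
  differentiable (fun y => Gamma D (TPoint (base z) y) x xi) (vec z) /\
  'D_b (fun y => Gamma D (TPoint (base z) y) x xi) (vec z) = 0.
Proof.
move=> sz hv; have a := in_chart_at z; set c := chart_at (base z) in a *.
have [ac d] := a.
have sxi := smooth_csec xi a.
have sX := smooth_hlift a (smooth_csec x a).
have sY := smooth_vert (smooth_csec b a).
have C := hv z sz _ _ _ sX sY sxi.
rewrite (curvature_formula sz sX sY sxi) in C.
have mub : mu F D z (vert (csec c b) z) = b.
  by rewrite /vert (mu_vert tor)// /csec tuncoord_id.
have Nh : \forall u \near Tcoord c z, (vfield_rep c (hpart F D (hlift c (csec c x))) u).1 = x.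
  have N : \forall u \near Tcoord c z, slit (Tuncoord c u) /\ in_chart c (Tuncoord c u).
    exact: (near_TMI (near_slit sz) (near_in_chart a)).
  apply: filterS2 N (hl_rep x a) => u [su [ac' du]] Eu.
  rewrite /vfield_rep TTcoord_fst// hpart_fst// -TTcoord_fst//.
  by have := congr1 fst Eu.
have dh := smooth_near_diff (smooth_hpart tor sz sX).
have D1 : ('D_(0, mu F D z (vert (csec c b) z)) (vfield_rep c (hpart F D (hlift c (csec c x)))) (Tcoord c z)).1 = 0.
  have cf : continuous (fst : VV -> V) by exact: linear_findim_continuous.
  have lf : linear (fst : VV -> V) by [].
  apply: (etrans (esym (derive_linear_comp _ lf cf dh))).
  exact: (etrans (@near_eq_derive _ _ _ _ (fun=> x) _ _ Nh) (derive_cst _ _ _)).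
have D2 : 'D_(0, mu F D z (vert (csec c b) z)) (section_rep c (csec c xi)) (Tcoord c z) = 0.
  exact: (etrans (@near_eq_derive _ _ _ _ (fun=> xi) _ _ (csec_rep xi a)) (derive_cst _ _ _)).
have G1 : Gamma D z (hpart F D (hlift c (csec c x)) z).1 0 = 0 := linear_zero (Gamma_linear_r D _ sz).
have G2 : Gamma D z 0 (csec c xi z) = 0 := linear_zero (Gamma_linear_l tor _ sz).
have NG : \forall y \near vec z,
    Gamma D (TPoint (base z) y) (vfield_rep c (hpart F D (hlift c (csec c x))) (coord c (base z), y)).1
      (section_rep c (csec c xi) (coord c (base z), y)) = Gamma D (TPoint (base z) y) x xi.
  have N1 := near_fiber Nh; have N2 := near_fiber (csec_rep xi a).
  by apply: filterS2 N1 N2 => y -> ->.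
have dG := curvature_fiber_diff sz sX sxi.
split; first exact: (differentiable_ext NG dG).
rewrite -(near_eq_derive b NG) -mub; apply: oppr_inj; rewrite oppr0 -[RHS]C.
have K1 := congr1 (Gamma D z (hpart F D (hlift c (csec c x)) z).1) D2.
have K2 := congr1 (fun r => Gamma D z r (csec c xi z)) D1.
have K := congr2 +%R (etrans K1 G1) (etrans K2 G2).
apply: esym; apply: (etrans (congr1 (fun r => r - _) (etrans K (addr0 0)))).
exact: sub0r.
Qed.

Lemma Gamma_const_curvature p (x xi y y' : V) : n <> 1%N -> hv_curvature_vanishes F D ->
  y != 0 -> y' != 0 -> Gamma D (TPoint p y) x xi = Gamma D (TPoint p y') x xi.
Proof.
move=> n1 hv y0 y0'.
apply: (derive0_const_punctured (f := fun y => Gamma D (TPoint p y) x xi)) => // t t0; split.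
  exact: (@derive_Gamma_curvature (TPoint p t) x 0 xi t0 hv).1.
by move=> b; exact: (@derive_Gamma_curvature (TPoint p t) x b xi t0 hv).2.
Qed.

(** When Gamma does not depend on y, the bilinear product rule expands the last term of
    [curvature_formula] into the sum of the first two. *)
Lemma curvature_Gamma_const z (X Y : vfield M) Z : slit z ->
  smooth_vfield z X -> smooth_vfield z Y -> smooth_section z Z ->
  (forall y x xi, y != 0 -> Gamma D (TPoint (base z) y) x xi = Gamma D z x xi) ->
  curvature D (hpart F D X) (vpart F D Y) Z z = 0.
Proof.
move=> sz sX sY sZ cG; rewrite (curvature_formula sz sX sY sZ).
have a := in_chart_at z; set c := chart_at (base z) in a *; have [ac d] := a.
set b := mu F D z (Y z).
have e : Tcoord c z = (coord c (base z), vec z) := Tcoord_own z.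
set h := vfield_rep c (hpart F D X); set zeta := section_rep c Z.
have NG : \forall y \near vec z,
    Gamma D (TPoint (base z) y) (h (coord c (base z), y)).1 (zeta (coord c (base z), y))
    = Gamma D z (h (coord c (base z), y)).1 (zeta (coord c (base z), y)).
  by apply: filterS (near_neq0 sz) => y; exact: cG.
have dh0 := smooth_near_diff (smooth_hpart tor sz sX).
have dz0 := smooth_near_diff sZ.
have dh : differentiable h (coord c (base z), vec z) by rewrite -e; exact: dh0.
have dz : differentiable zeta (coord c (base z), vec z) by rewrite -e; exact: dz0.
have lf : linear (fst : VV -> V) by [].
have cf : continuous (fst : VV -> V) by exact: linear_findim_continuous.
have dh1 : differentiable (fun y => (h (coord c (base z), y)).1) (vec z).
  by apply: (differentiable_comp (fiber_diff dh)); exact: findim_linear_diff.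
have BL := @derive_bilinear _ _ _ _ _ (findim_rV R n) (findim_rV R n) _ _ _ _ (fun x => Gamma_linear_r D x sz) (fun y => Gamma_linear_l tor y sz)
  dh1 (fiber_diff dz).
have E1 := etrans (near_eq_derive b NG) (BL.2 b).
have E2 : 'D_b (fun y => (h (coord c (base z), y)).1) (vec z) = ('D_(0, b) h (Tcoord c z)).1.
  rewrite e; apply: (etrans (derive_linear_comp _ lf cf (fiber_diff dh))).
  by rewrite derive_fiber.
have E3 : 'D_b (fun y => zeta (coord c (base z), y)) (vec z) = 'D_(0, b) zeta (Tcoord c z).
  by rewrite e derive_fiber.
have F1 : h (coord c (base z), vec z) = hpart F D X z.
  by rewrite -e /h /vfield_rep (TcoordK ac d); exact: (TTcoord_id z (hpart F D X z)).
have F2 : zeta (coord c (base z), vec z) = Z z.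
  by rewrite -e /zeta /section_rep (TcoordK ac d); exact: (tcoord_id (base z) (Z z)).
have E4 := congr2 (fun r s => Gamma D z r s) E2 F2.
have E5 := congr2 (fun r s => Gamma D z r.1 s) F1 E3.
apply: (etrans (congr1 (fun r => _ - r) (etrans E1 (congr2 +%R E4 E5)))).
set r := Gamma D z _ _; set s := Gamma D z _ _.
by rewrite [s + r]addrC subrr.
Qed.

End Curvature.

(** * The metric equation *)

Section Metric.
Variables (R : realType) (n : nat) (M : smoothManifold R n) (F : finsler M).
Local Notation V := 'rV[R]_n.
Local Notation VV := (V * V)%type.
Local Notation TM := (tangent_bundle M).
Implicit Types (c : chart R n M) (p : M) (z : TM) (u : VV) (X Y Z : section M).

Let q z := Fsq F (chart_at (base z)).
Let pt z := Tcoord (chart_at (base z)) z.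

(** The derivative of g(x, y) in any direction w of TM, for constant x and y. Vertical directions
    give the Cartan tensor divided by F/2, horizontal ones the first term of the covariant
    derivative of g. *)
Definition half_D3 z (w : VV) (x y : V) : R := 2^-1 * 'D_w ('D_(0, x) ('D_(0, y) (q z))) (pt z).

Definition gform z (x y : V) : R := 2^-1 * 'D_(0, x) ('D_(0, y) (q z)) (pt z).

Lemma fundamentalE z x y : fundamental F z x y = gform z x y.
Proof. by rewrite (fundamental_chart _ _ _ (in_chart_at z)) !tcoord_id. Qed.

Lemma cartanE z v x y : cartan F z v x y = 2^-1 * F z * half_D3 z (0, v) x y.
Proof. by rewrite (cartan_chart _ _ _ _ (in_chart_at z)) !tcoord_id /half_D3; field. Qed.

Section AtPoint.
Variables (z : TM) (sz : slit z).

Let sq : smooth_near (q z) (pt z) := smooth_Fsq F (in_chart_at z) sz.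

Lemma half_D3_linear x y : linear (fun w => half_D3 z w x y : R^o).
Proof.
move=> k v w; rewrite /half_D3.
have l := derive_linear (smooth_near_diff (smooth_near_derive (0, x) (smooth_near_derive (0, y) sq))).
have -> := l k v w.
by rewrite mulrDr -[k *: _]/(k * _) -[k *: _]/(k * _) mulrCA.
Qed.

Lemma half_D3_sym w x y : half_D3 z w x y = half_D3 z w y x.
Proof.
rewrite /half_D3; apply: (congr1 ( *%R 2^-1)); apply: near_eq_derive.
by apply: filterS (smooth_near_near sq) => u su; exact: schwarz.
Qed.

Lemma half_D3_rot x y t : half_D3 z (0, x) y t = half_D3 z (0, y) x t.
Proof.
rewrite /half_D3; apply: (congr1 ( *%R 2^-1)).
exact: (schwarz (0, x) (0, y) (smooth_near_derive (0, t) sq)).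
Qed.

Lemma gform_sym x y : gform z x y = gform z y x.
Proof. by rewrite /gform; apply: (congr1 ( *%R 2^-1)); exact: (schwarz (0, x) (0, y) sq). Qed.

Lemma gform_linear y : linear (fun x => gform z x y : R^o).
Proof.
move=> k v w; rewrite /gform.
have l := derive_linear (smooth_near_diff (smooth_near_derive (0, y) sq)).
have -> : (0, k *: v + w) = k *: (0, v) + (0, w) :> VV.
  by rewrite -[RHS]/(k *: 0 + 0, k *: v + w) scaler0 addr0.
have -> := l k (0, v) (0, w).
by rewrite mulrDr -[k *: _]/(k * _) -[k *: _]/(k * _) mulrCA.
Qed.

Lemma gform_addl x x' y : gform z (x + x') y = gform z x y + gform z x' y.
Proof. exact: (linear_add x x' (gform_linear y)). Qed.

Lemma gform_addr x y y' : gform z x (y + y') = gform z x y + gform z x y'.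
Proof. by rewrite !(gform_sym x) gform_addl. Qed.

Lemma gform_oppl x y : gform z (- x) y = - gform z x y.
Proof. exact: (linear_opp x (gform_linear y)). Qed.

Lemma gform_eq0 x : (forall y, gform z x y = 0) -> x = 0.
Proof.
move=> H; apply/eqP; apply: contrapT => /negP x0.
by have := fin_posdef F sz x0; rewrite fundamentalE H ltxx.
Qed.

Let pE : pt z = (coord (chart_at (base z)) (base z), vec z) := Tcoord_own z.
Let ac : atlas (chart_at (base z)) := atlas_chart_at (base z).
Let cx := coord_im (dom_chart_at (base z)).

Lemma half_D3_vec x y : half_D3 z (0, vec z) x y = 0.
Proof. by rewrite /half_D3 /q pE (fiber_euler0 F ac cx x y sz) mulr0. Qed.

(** The direction keeps the fibre coordinate fixed, so the identity g(y, y) = F^2 holds with the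
    same y at all nearby x and can be differentiated. *)
Lemma half_D3_horizontal_vec a : half_D3 z (a, 0) (vec z) (vec z) = 'D_(a, 0) (q z) (pt z).
Proof.
have s2 := smooth_near_derive (0, vec z) (smooth_near_derive (0, vec z) sq).
have -> : half_D3 z (a, 0) (vec z) (vec z) =
    'D_(a, 0) (fun u => 2^-1 *: 'D_(0, vec z) ('D_(0, vec z) (q z)) u) (pt z).
  apply: esym; apply: (@deriveZ _ _ _ ('D_(0, vec z) ('D_(0, vec z) (q z)))).
  by apply: diff_derivable; exact: smooth_near_diff.
have fst_fiber (W : normedModType R) (h : VV -> W) x y :
    'D_(a, 0) h (x, y) = 'D_a (fun x => h (x, y)) x.
  apply: esym; apply: (@derive_comp_affine _ _ _ _ (fun w => (w, 0)) (fun x => (x, y))) => k v b.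
  by rewrite -[RHS]/(k *: v + b, k *: 0 + y) scaler0 add0r.
rewrite pE (fst_fiber _ (fun u => 2^-1 *: 'D_(0, vec z) ('D_(0, vec z) (q z)) u)) fst_fiber.
apply: near_eq_derive.
have N := near_overlap (dom_chart_at (base z)) (dom_chart_at (base z)).
apply: filterS N => x [xi _].
exact: (fiber_energy F ac xi sz).
Qed.

Lemma gform_vec x : gform z x (vec z) = 2^-1 * 'D_(0, x) (q z) (pt z).
Proof. by rewrite gform_sym /gform /q pE (fiber_euler1 F ac cx x sz). Qed.

End AtPoint.

Section WithConnection.
Variable D : connection M.
Hypothesis tor : torsion_eq F D (@tensor0 R n M).

(* (D_h g)(x, y) for the horizontal lift h of a. *)
Definition nabla_g z (a x y : V) : R :=
  half_D3 z (a, - Gamma D z a (vec z)) x y - gform z (Gamma D z a x) y - gform z x (Gamma D z a y).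

Lemma act_fundamental z w X Y : slit z -> smooth_section z X -> smooth_section z Y ->
  act z w (fun z' => fundamental F z' (X z') (Y z')) =
  half_D3 z w (X z) (Y z)
  + gform z ('D_w (section_rep (chart_at (base z)) X) (pt z)) (Y z)
  + gform z (X z) ('D_w (section_rep (chart_at (base z)) Y) (pt z)).
Proof.
move=> sz sX sY; have a := in_chart_at z; set c := chart_at (base z) in a *.
have [ac d] := a.
have N : \forall u \near pt z, fundamental F (Tuncoord c u) (X (Tuncoord c u)) (Y (Tuncoord c u))
    = 2^-1 *: 'D_(0, section_rep c X u) ('D_(0, section_rep c Y u) (q z)) u :> R^o.
  apply: (near_rep a) => u a' E.
  have K := fundamental_chart F (X (Tuncoord c u)) (Y (Tuncoord c u)) a'.
  by rewrite E in K; exact: K.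
have sx0 : smooth_near (fun u => (0 : V, section_rep c X u)) (pt z).
  exact: (smooth_near_pair (smooth_near_cst _ _) sX).
have sy0 : smooth_near (fun u => (0 : V, section_rep c Y u)) (pt z).
  exact: (smooth_near_pair (smooth_near_cst _ _) sY).
have sq : smooth_near (q z) (pt z) := smooth_Fsq F a sz.
have sid : smooth_near (id : VV -> VV) (pt z) by exact: smooth_near_lin.
have Dp (X' : section M) : smooth_section z X' ->
    'D_w (fun u => (0 : V, section_rep c X' u)) (pt z) = (0, 'D_w (section_rep c X') (pt z)).
  move=> sX'; apply: (etrans (derive_pair w (differentiable_cst (0 : V) (pt z)) (smooth_near_diff sX'))).
  by apply: (congr1 (fun r => (r, _))); exact: derive_cst.
have at_ (X' : section M) : section_rep c X' (pt z) = X' z.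
  by rewrite /section_rep (TcoordK ac d); exact: tcoord_id.
have D2 := derive_dir2 (fV := findim_prod (findim_rV R n) (findim_rV R n)) (fW := findim_R R)
  w sq sx0 sy0.
rewrite (Dp _ sX) (Dp _ sY) !at_ in D2.
(* [derive_dir2] gives the value of the derivative; extracting the factor 1/2 also requires
   differentiability. *)
have dd : differentiable (fun u => 'D_(0, section_rep c X u) ('D_(0, section_rep c Y u) (q z)) u) (pt z).
  have D3 := (@derive_dir3 _ _ _ _ _ (q z) (fun=> (0, 0)) (fun u => (0 : V, section_rep c X u))
    (fun u => (0 : V, section_rep c Y u)) (pt z) w sq (smooth_near_cst _ _) sx0 sy0).1.
  have [[k [e [l [cl El]]]]] := findim_prod (findim_rV R n) (findim_rV R n).
  have N2 : \forall u \near pt z, \sum_i (l i (0 : V, section_rep c Y u) : R^o) *: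
      'D_(0, section_rep c X u) ('D_(e i) (q z)) u =
      'D_(0, section_rep c X u) ('D_(0, section_rep c Y u) (q z)) u.
    apply: filterS (smooth_near_near sq) => u su.
    exact: (esym (sum_expand (0, section_rep c Y u) El (derive2_linear (0, section_rep c X u) su))).
  apply: (differentiable_ext N2); apply: (differentiable_bigsum _ _).1 => i.
  apply: (differentiable_scale _ _).1.
    apply: (differentiable_comp (smooth_near_diff sy0)); exact: linear_differentiable.
  apply: smooth_near_diff.
  exact: (@smooth_near_dir _ _ _ _ _ _ ('D_(e i) (q z)) id _ (pt z) (smooth_near_derive (e i) sq) sid sx0).
apply: (etrans (near_eq_derive w N)).
apply: (etrans (@deriveZ _ _ _ _ 2^-1 _ _ (diff_derivable dd))).
apply: (etrans (congr1 ( *:%R 2^-1) D2)).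
have alg (A B C : R) : 2^-1 * (A + B + C) = 2^-1 * C + 2^-1 * A + 2^-1 * B by ring.
exact: alg.
Qed.

(** [W z] is the sum of the horizontal lift of its projection and of the vertical vector [mu] of
    [W z]. The vertical summand produces exactly the term of the metric equation that has A
    evaluated on [mu]. *)
Lemma cov_metricE z (W : vfield M) X Y : slit z -> smooth_section z X -> smooth_section z Y ->
  cov_metric F D W X Y z = nabla_g z (W z).1 (X z) (Y z)
    + 2 * (F z)^-1 * cartan F z (mu F D z (W z)) (X z) (Y z).
Proof.
move=> sz sX sY; rewrite /cov_metric (act_fundamental (W z) sz sX sY) !fundamentalE.
have EX : covf D W X z = 'D_(W z) (section_rep (chart_at (base z)) X) (pt z) + Gamma D z (W z).1 (X z).
  exact: (cov_own tor (W z) sz sX).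
have EY : covf D W Y z = 'D_(W z) (section_rep (chart_at (base z)) Y) (pt z) + Gamma D z (W z).1 (Y z).
  exact: (cov_own tor (W z) sz sY).
rewrite EX EY (gform_addl sz) (gform_addr sz) cartanE /nabla_g (muE tor _ sz).
set a := (W z).1.
set G := Gamma D z a (vec z).
have dec : W z = (a, - G) + (0, (W z).2 + G) :> VV.
  rewrite -[RHS]/(a + 0, _ + _) addr0 addrCA addNr addr0.
  by rewrite /a; case: (W z).
have HT := etrans (congr1 (fun w => half_D3 z w (X z) (Y z)) dec)
  (linear_add (a, - G) (0, (W z).2 + G) (half_D3_linear sz (X z) (Y z))).
have F0 := F_neq0 F sz.
have cancel (t : R) : 2 * (F z)^-1 * (2^-1 * F z * t) = t by field.
have alg (t t1 t2 p p' r s : R) : t = t1 + t2 ->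
    t + p + p' - (p + r) - (p' + s) = t1 - r - s + t2 by move=> ->; ring.
exact: (etrans (alg _ _ _ _ _ _ _ HT) (congr1 (fun r => _ + r) (esym (cancel _)))).
Qed.

(** With S = A + L and T = 0 both Cartan terms of the metric equation cancel, and only L is left. *)
Lemma metric_tensor (L : tensor3 M) z X1 X2 X3 :
  metric_eq F D (fun X Y Z z => cartan_form F X Y Z z + L X Y Z z) (@tensor0 R n M) ->
  slit z -> smooth_section z X1 -> smooth_section z X2 -> smooth_section z X3 ->
  nabla_g z (X1 z) (X2 z) (X3 z) = - 2 * L X1 X2 X3 z.
Proof.
move=> me sz s1 s2 s3; have a := in_chart_at z.
have := me z sz _ _ _ (smooth_hlift a s1) s2 s3.
rewrite (cov_metricE _ sz s2 s3) /tensor0 /cartan_form /muf mulr0 subr0.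
have -> : rhof (hlift (chart_at (base z)) X1) = X1 by [].
by set A := nabla_g _ _ _ _; set B := cartan _ _ _ _ _; set C := cartan _ _ _ _ _; lra.
Qed.

Lemma metric_eqE (S : tensor3 M) :
  (forall z (W : vfield M) X Y, slit z -> smooth_vfield z W -> smooth_section z X -> smooth_section z Y ->
    nabla_g z (W z).1 (X z) (Y z) = 0 /\ S (rhof W) X Y z = cartan_form F (rhof W) X Y z) ->
  metric_eq F D S (@tensor0 R n M).
Proof.
move=> H z sz W X Y sW sX sY; have [E1 E2] := H z W X Y sz sW sX sY.
have alg (e c m s t : R) : e = 0 -> s = c -> e + m = 2 * c + m - 2 * s - t * 0.
  by move=> -> ->; ring.
exact: (etrans (cov_metricE W sz sX sY) (alg _ _ _ _ _ E1 E2)).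
Qed.

(** By homogeneity the vertical derivative of g vanishes on y, and each of the two terms g(G(a, y),
    y) is half the derivative of F^2 along G(a, y). *)
Lemma horizontal_Fsq z a : slit z -> nabla_g z a (vec z) (vec z) = 0 ->
  'D_(a, - Gamma D z a (vec z)) (q z) (pt z) = 0.
Proof.
move=> sz; rewrite /nabla_g.
have lq := derive_linear (smooth_near_diff (smooth_Fsq F (in_chart_at z) sz)).
have dec : (a, - Gamma D z a (vec z)) = (a, 0) + (0, - Gamma D z a (vec z)) :> VV.
  by rewrite -[RHS]/(a + 0, 0 + _) addr0 add0r.
have e1 : half_D3 z (a, - Gamma D z a (vec z)) (vec z) (vec z) = 'D_(a, 0) (q z) (pt z).
  rewrite dec (linear_add _ _ (half_D3_linear sz _ _)) (half_D3_horizontal_vec sz).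
  by rewrite (half_D3_rot sz) (half_D3_vec sz) addr0.
have e2 := gform_vec sz (Gamma D z a (vec z)).
have e3 : 'D_(a, - Gamma D z a (vec z)) (q z) (pt z) =
    'D_(a, 0) (q z) (pt z) - 'D_(0, Gamma D z a (vec z)) (q z) (pt z).
  have e4 : (0, - Gamma D z a (vec z)) = - (0, Gamma D z a (vec z)) :> VV.
    by rewrite -[RHS]/(- 0, _) oppr0.
  rewrite dec e4; apply: (etrans (linear_add _ _ lq)); apply: (congr1 (fun r => _ + r)).
  exact: (linear_opp _ lq).
rewrite e1 (gform_sym sz (vec z)) e2 e3.
have alg (A B : R) : A - 2^-1 * B - 2^-1 * B = 0 -> A - B = 0.
  by move=> H; rewrite -H; field.
exact: alg.
Qed.

End WithConnection.

End Metric.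

(** * Symmetries of the iterated derivatives of A *)

Section Forms.
Variables (R : realType) (n : nat) (M : smoothManifold R n) (F : finsler M).
Local Notation V := 'rV[R]_n.
Local Notation VV := (V * V)%type.
Local Notation TM := (tangent_bundle M).
Implicit Types (c : chart R n M) (p : M) (z : TM) (u : VV) (X Y Z : section M).

(** Two transpositions generate all permutations. The sections are arbitrary, so that the covariant
    derivatives occurring in [dot] can be inserted directly. *)
Definition symmetric_form (B : tensor3 M) := forall z, slit z -> forall X Y Z,
  B X Y Z z = B Y X Z z /\ B X Y Z z = B X Z Y z.

(** The factor k keeps the property stable under [dot]: the derivative of k y along [lbar] is 0,
    which is the case k = 0. Equality on the whole slit bundle lets the value of the form be
    differentiated around a point. *)
Definition kills_vec (B : tensor3 M) := forall (k : R) X,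
  (forall z, slit z -> X z = k *: vec z) -> forall z, slit z -> forall Y Z, B X Y Z z = 0.

Lemma cartan_symmetric : symmetric_form (cartan_form F).
Proof.
move=> z sz X Y Z; rewrite /cartan_form !cartanE; split; apply: (congr1 ( *%R _)).
  exact: half_D3_rot.
exact: half_D3_sym.
Qed.

Lemma cartan_kills_vec : kills_vec (cartan_form F).
Proof.
move=> k X HX z sz Y Z; rewrite /cartan_form cartanE (HX z sz).
have e : (0, k *: vec z) = k *: (0, vec z) :> VV by rewrite -[RHS]/(k *: 0, _) scaler0.
have K := linear_scale k (0, vec z) (half_D3_linear F sz (Y z) (Z z)).
rewrite e; apply: (etrans (congr1 ( *%R _) K)).
by rewrite (half_D3_vec F sz) scaler0 mulr0.
Qed.

Section Dot.
Variable D : connection M.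

Lemma dot_symmetric B : symmetric_form B -> symmetric_form (dot F D B).
Proof.
move=> sB z sz X Y Z.
have near (B1 B2 : TM -> R) : (forall z', slit z' -> B1 z' = B2 z') ->
    act z (lbar F D z) B1 = act z (lbar F D z) B2.
  by move=> H; apply: act_ext; exact: near_TMS H (near_slit sz).
rewrite /dot; split.
  have a1 := near _ _ (fun z' sz' => (sB z' sz' X Y Z).1).
  rewrite a1 (sB z sz (covf D (lbar F D) X) Y Z).1 (sB z sz X (covf D (lbar F D) Y) Z).1.
  rewrite (sB z sz X Y (covf D (lbar F D) Z)).1.
  have alg (r s t q : R) : r - s - t - q = r - t - s - q by ring.
  exact: alg.
have a1 := near _ _ (fun z' sz' => (sB z' sz' X Y Z).2).
rewrite a1 (sB z sz (covf D (lbar F D) X) Y Z).2 (sB z sz X (covf D (lbar F D) Y) Z).2.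
rewrite (sB z sz X Y (covf D (lbar F D) Z)).2.
have alg (r s t q : R) : r - s - t - q = r - s - q - t by ring.
exact: alg.
Qed.

Hypothesis tor : torsion_eq F D (@tensor0 R n M).

Lemma cov_lbar_vec z k X : slit z -> (forall z, slit z -> X z = k *: vec z) ->
  covf D (lbar F D) X z = 0.
Proof.
move=> sz HX; have N : near_TM z (fun z' => k *: vec z' = X z').
  by apply: near_TMS (near_slit sz) => z' /HX.
have sv := smooth_yvec z.
have skv : smooth_section z (fun z' => k *: vec z').
  exact: (smooth_section_scale (smooth_fun_cst z k) sv).
have K := cov_local D sz skv N (lbar F D z).
rewrite /covf -K (@cov_scale _ _ _ D z k _ _ sz sv) -(mu_vec D F _ sz).
by rewrite (lbarE tor sz) (muE tor _ sz) /= addNr scaler0.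
Qed.

Lemma dot_kills_vec B : kills_vec B -> symmetric_form B -> kills_vec (dot F D B).
Proof.
move=> kB sB k X HX z sz Y Z; rewrite /dot.
have k1 : act z (lbar F D z) (B X Y Z) = 0.
  rewrite -[RHS](act_cst z (lbar F D z) 0); apply: act_ext.
  by apply: near_TMS (near_slit sz) => z' sz'; exact: (kB k X HX z' sz' Y Z).
have k2 : B (covf D (lbar F D) X) Y Z z = 0.
  by apply: (kB 0) => // z' sz'; rewrite scale0r; exact: cov_lbar_vec HX.
have k3 := kB k X HX z sz (covf D (lbar F D) Y) Z.
have k4 := kB k X HX z sz Y (covf D (lbar F D) Z).
by rewrite k1 k2 k3 k4 !subr0.
Qed.

Lemma cartan_dot_symmetric j : symmetric_form (cartan_dot F D j).
Proof. by elim: j => [|j IH]; [exact: cartan_symmetric|exact: dot_symmetric]. Qed.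

Lemma cartan_dot_kills_vec j : kills_vec (cartan_dot F D j).
Proof.
elim: j => [|j IH]; first exact: cartan_kills_vec.
exact: dot_kills_vec IH (cartan_dot_symmetric j).
Qed.

Variables (m : nat) (kappa : 'I_m -> R).

(** The tensor L = S - A. *)
Definition higher_part : tensor3 M :=
  fun X Y Z z => \sum_(j < m) kappa j * cartan_dot F D j.+1 X Y Z z.

Lemma higher_symmetric : symmetric_form higher_part.
Proof.
move=> z sz X Y Z; split; apply: eq_bigr => j _; apply: (congr1 ( *%R _)).
  exact: (cartan_dot_symmetric j.+1 sz X Y Z).1.
exact: (cartan_dot_symmetric j.+1 sz X Y Z).2.
Qed.

Lemma higher_kills_vec : kills_vec higher_part.
Proof.
move=> k X HX z sz Y Z; apply: big1 => j _.
by rewrite (cartan_dot_kills_vec j.+1 HX sz) mulr0.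
Qed.

Hypothesis me : metric_eq F D (berwald_type_tensor F D kappa) (@tensor0 R n M).

Lemma nabla_g_higher z X1 X2 X3 : slit z ->
  smooth_section z X1 -> smooth_section z X2 -> smooth_section z X3 ->
  nabla_g F D z (X1 z) (X2 z) (X3 z) = - 2 * higher_part X1 X2 X3 z.
Proof. exact: (metric_tensor tor me). Qed.

Let cs z (v : V) := csec (chart_at (base z)) v.
Let scs z v : smooth_section z (cs z v) := smooth_csec v (in_chart_at z).
Let cs_at z v : cs z v z = v := tuncoord_id _ _.

(** Passes from the operator L on sections to a function of vectors. Through it [nabla_g] inherits
    the symmetries of L without any appeal to the tensoriality of the A^(j). *)
Lemma nabla_g_csec z x y t : slit z ->
  nabla_g F D z x y t = - 2 * higher_part (cs z x) (cs z y) (cs z t) z.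
Proof.
move=> sz; rewrite -(nabla_g_higher sz (scs z x) (scs z y) (scs z t)).
by rewrite !cs_at.
Qed.

Lemma nabla_g_sym12 z x y t : slit z -> nabla_g F D z x y t = nabla_g F D z y x t.
Proof.
move=> sz; have H := (higher_symmetric sz (cs z x) (cs z y) (cs z t)).1.
exact: (etrans (nabla_g_csec x y t sz) (etrans (congr1 ( *%R (- 2)) H) (esym (nabla_g_csec y x t sz)))).
Qed.

Lemma nabla_g_sym23 z x y t : slit z -> nabla_g F D z x y t = nabla_g F D z x t y.
Proof.
move=> sz; have H := (higher_symmetric sz (cs z x) (cs z y) (cs z t)).2.
exact: (etrans (nabla_g_csec x y t sz) (etrans (congr1 ( *%R (- 2)) H) (esym (nabla_g_csec x t y sz)))).
Qed.

(** The section inserted is y itself, not the constant section with the same value at [z], because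
    [kills_vec] concerns multiples of y on the whole slit bundle. *)
Lemma nabla_g_vec z y t : slit z -> nabla_g F D z (vec z) y t = 0.
Proof.
move=> sz; have := nabla_g_higher sz (smooth_yvec z) (scs z y) (scs z t).
rewrite !cs_at => ->; rewrite (@higher_kills_vec 1) ?mulr0//.
by move=> z' _; rewrite scale1r.
Qed.

End Dot.

(** * Fibre derivatives of the horizontal invariance of F^2 *)

Section FiberDerivatives.
Variables (p : M) (a : V) (N : V -> V).
Hypothesis linN : linear N.
Let c := chart_at p.
Let x0 := coord c p.
Let Q := Fsq F c.
Let sQ y : y != 0 -> smooth_near Q (x0, y).
Proof. by move=> y0; exact: (fiber_smooth_Fsq F (atlas_chart_at p) (coord_im (dom_chart_at p)) y0). Qed.

(* Differentiates along the fibre an identity delta h = k, where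
   delta = d/dx^a - N(y)^i d/dy^i. *)
Lemma fiber_step (h k : VV -> R^o) t : (forall y, y != 0 -> smooth_near h (x0, y)) ->
  (forall y, y != 0 -> 'D_(a, - N y) h (x0, y) = k (x0, y)) ->
  forall y, y != 0 -> 'D_(a, - N y) ('D_(0, t) h) (x0, y) =
    'D_(0, t) k (x0, y) + 'D_(0, N t) h (x0, y).
Proof.
move=> sh hk y y0.
have lin2 : linear (fun u : VV => - N u.2).
  by move=> r u v; rewrite /= linN opprD scalerN.
have dN : differentiable (fun u : VV => - N u.2) (x0, y) by exact: findim_linear_diff.
have dv : differentiable (fun u : VV => (a, - N u.2)) (x0, y).
  exact: differentiable_pair (differentiable_cst a (x0, y)) dN.
have Dv : 'D_(0, t) (fun u : VV => (a, - N u.2)) (x0, y) = (0, - N t).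
  apply: (etrans (derive_pair (0, t) (differentiable_cst a (x0, y)) dN)).
  apply: (congr2 (fun r s : V => (r, s))); first exact: derive_cst.
  exact: (derive_lin (x0, y) (0, t) lin2).
have K := derive_dir_schwarz (fV := findim_prod (findim_rV R n) (findim_rV R n))
  (fW := findim_R R) (0, t) (sh y y0) dv.
have E : \forall y' \near y, 'D_(a, - N y') h (x0, y') = k (x0, y').
  by apply: filterS (near_neq0 y0) => y'; exact: hk.
have E1 := near_eq_derive t E.
have E2 : 'D_(0, t) k (x0, y) =
    'D_('D_(0, t) (fun u : VV => (a, - N u.2)) (x0, y)) h (x0, y) + 'D_(a, - N y) ('D_(0, t) h) (x0, y).
  rewrite -K -!derive_fiber; exact: (esym E1).
have e4 : (0, - N t) = - (0, N t) :> VV by rewrite -[RHS]/(- 0, _) oppr0.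
rewrite Dv e4 in E2.
have E3 := linear_opp (0, N t) (derive_linear (smooth_near_diff (sh y y0))).
have alg (A B C D : R^o) : A = B + C -> B = - D -> C = A + D.
  by move=> -> ->; rewrite addrAC addNr add0r.
exact: (alg _ _ _ _ E2 E3).
Qed.

Hypothesis I0 : forall y, y != 0 -> 'D_(a, - N y) Q (x0, y) = 0.

(** As N is linear, each further fibre derivative adds one term in which N acts on the new
    direction. The second order expresses compatibility with g, the third with the third fibre
    derivatives of F^2, hence with A. *)
Lemma fiber_I1 t y : y != 0 -> 'D_(a, - N y) ('D_(0, t) Q) (x0, y) = 'D_(0, N t) Q (x0, y).
Proof.
move=> y0; have K := fiber_step (k := fun=> 0) t sQ I0 y0.
apply: (etrans K); apply: (etrans (congr1 (fun r => r + _) (derive_cst _ _ _))).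
exact: add0r.
Qed.

Lemma fiber_I2 s t y : y != 0 -> 'D_(a, - N y) ('D_(0, s) ('D_(0, t) Q)) (x0, y) =
  'D_(0, s) ('D_(0, N t) Q) (x0, y) + 'D_(0, N s) ('D_(0, t) Q) (x0, y).
Proof.
move=> y0; exact: (fiber_step (k := 'D_(0, N t) Q) s
  (fun y y0 => smooth_near_derive (0, t) (sQ y0)) (fiber_I1 t) y0).
Qed.

Lemma fiber_I3 r s t y : y != 0 -> 'D_(a, - N y) ('D_(0, r) ('D_(0, s) ('D_(0, t) Q))) (x0, y) =
  'D_(0, r) ('D_(0, s) ('D_(0, N t) Q)) (x0, y) + 'D_(0, r) ('D_(0, N s) ('D_(0, t) Q)) (x0, y)
  + 'D_(0, N r) ('D_(0, s) ('D_(0, t) Q)) (x0, y).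
Proof.
move=> y0.
have K := fiber_step (k := fun u => 'D_(0, s) ('D_(0, N t) Q) u + 'D_(0, N s) ('D_(0, t) Q) u) r
  (fun y y0 => smooth_near_derive (0, s) (smooth_near_derive (0, t) (sQ y0))) (fiber_I2 s t) y0.
have s1 := smooth_near_derive (0, s) (smooth_near_derive (0, N t) (sQ y0)).
have s2 := smooth_near_derive (0, N s) (smooth_near_derive (0, t) (sQ y0)).
apply: (etrans K); apply: (congr1 (fun q => q + _)).
exact: (derive_add (0, r) (smooth_near_diff s1) (smooth_near_diff s2)).
Qed.

End FiberDerivatives.

End Forms.

(** * Comparison with the Chern connection *)

Section Berwald.
Variables (R : realType) (n : nat) (M : smoothManifold R n) (F : finsler M).
Local Notation V := 'rV[R]_n.
Local Notation VV := (V * V)%type.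
Local Notation TM := (tangent_bundle M).
Implicit Types (c : chart R n M) (p : M) (z : TM) (u : VV) (X Y Z : section M).
Local Notation pt z := (Tcoord (chart_at (base z)) z).
Local Notation q z := (Fsq F (chart_at (base z))).

Definition Gamma_constant (D : connection M) p := forall y y' a xi : V,
  y != 0 -> y' != 0 -> Gamma D (TPoint p y) a xi = Gamma D (TPoint p y') a xi.

Section OneConnection.
Variable D : connection M.
Hypothesis tor : torsion_eq F D (@tensor0 R n M).
Variables (z : TM) (sz : slit z).
Hypothesis constG : Gamma_constant D (base z).
Hypothesis Eyy : forall z a, slit z -> nabla_g F D z a (vec z) (vec z) = 0.

Let pE : pt z = (coord (chart_at (base z)) (base z), vec z) := Tcoord_own z.

Let zE : z = TPoint (base z) (vec z). Proof. by case: z. Qed.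

(** Constancy of Gamma allows the coefficients to be frozen at [z] while y runs through the fibre,
    which gives the linear N that the fibre derivatives require. *)
Let I0 a y : y != 0 -> 'D_(a, - Gamma D z a y) (q z) (coord (chart_at (base z)) (base z), y) = 0.
Proof.
move=> y0; have sy : slit (TPoint (base z) y : TM) by [].
have H := horizontal_Fsq sy (Eyy a sy).
have e : Tcoord (chart_at (base z)) (TPoint (base z) y) = (coord (chart_at (base z)) (base z), y).
  exact: (Tcoord_own (TPoint (base z) y)).
have g : Gamma D (TPoint (base z) y) a y = Gamma D z a y.
  by rewrite [in RHS]zE; exact: constG.
by rewrite /= e g in H.
Qed.

Lemma const_nabla_g a s t : nabla_g F D z a s t = 0.
Proof.
have K := fiber_I2 (Gamma_linear_r D a sz) (@I0 a) s t sz.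
rewrite -pE in K.
have E1 : half_D3 F z (a, - Gamma D z a (vec z)) s t = gform F z s (Gamma D z a t) + gform F z (Gamma D z a s) t.
  by rewrite /half_D3 /gform -mulrDr; exact: (congr1 ( *%R 2^-1) K).
rewrite /nabla_g E1.
have alg (r r' : R) : r + r' - r' - r = 0 by ring.
exact: alg.
Qed.

Lemma const_half_D3 a r s t :
  2^-1 * 'D_(a, - Gamma D z a (vec z)) ('D_(0, r) ('D_(0, s) ('D_(0, t) (q z)))) (pt z) =
  half_D3 F z (0, r) s (Gamma D z a t) + half_D3 F z (0, r) (Gamma D z a s) t + half_D3 F z (0, Gamma D z a r) s t.
Proof.
have K := fiber_I3 (Gamma_linear_r D a sz) (@I0 a) r s t sz.
rewrite -pE in K.
by rewrite /half_D3 -!mulrDr; exact: (congr1 ( *%R 2^-1) K).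
Qed.

(** A carries the factor F, so its derivative needs delta F = 0 and not only delta F^2 = 0; the two
    agree because F does not vanish. *)
Lemma const_horizontal_F a :
  'D_(a, - Gamma D z a (vec z)) (fun u => F (Tuncoord (chart_at (base z)) u) : R^o) (pt z) = 0.
Proof.
have H : 'D_(a, - Gamma D z a (vec z)) (q z) (pt z) = 0 by rewrite pE; exact: I0.
have sF := smooth_F F (in_chart_at z) sz; set Fc := fun u => _ in sF *.
have e : q z = fun u => Fc u *: Fc u by apply/funext => u; rewrite /Fsq expr2.
rewrite e in H; have dF := smooth_near_diff sF.
have K := etrans (esym ((differentiable_scale dF dF).2 _)) H.
have F0 : Fc (pt z) != 0 by rewrite /Fc TcoordK//; exact: F_neq0.
have alg (d f : R^o) : f != 0 -> d *: f + f *: d = 0 -> d = 0.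
  move=> f0; rewrite /GRing.scale /= [f * d]mulrC -mulr2n => /eqP.
  by rewrite mulrn_eq0 /= mulf_eq0 (negbTE f0) orbF => /eqP.
exact: (alg _ _ F0 K).
Qed.

(* The derivative along lbar only involves the coefficients of D' in the
   direction ell, so it can be computed with those of D. *)
Lemma dot_cartan_eq0 (D' : connection M) X Y Z : torsion_eq F D' (@tensor0 R n M) ->
  (forall xi, Gamma D' z (ell F z) xi = Gamma D z (ell F z) xi) ->
  smooth_section z X -> smooth_section z Y -> smooth_section z Z ->
  dot F D' (cartan_form F) X Y Z z = 0.
Proof.
move=> tor' GG sX sY sZ; have a := in_chart_at z; set c := chart_at (base z) in a *.
have [ac d] := a.
set l := ell F z; set N := Gamma D z l; set delta := (l, - N (vec z)).
have lb : lbar F D' z = delta by rewrite (lbarE tor' sz) GG.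
have covE (X' : section M) : smooth_section z X' ->
    covf D' (lbar F D') X' z = 'D_delta (section_rep c X') (pt z) + N (X' z).
  move=> sX'; have K := cov_own tor' (lbar F D' z) sz sX'.
  apply: (etrans K); rewrite lb; apply: (congr1 (fun r => _ + r)); exact: GG.
have at_ (X' : section M) : section_rep c X' (pt z) = X' z.
  by rewrite /section_rep (TcoordK ac d); exact: tcoord_id.
have spair (X' : section M) : smooth_section z X' ->
    smooth_near (fun u => (0 : V, section_rep c X' u)) (pt z).
  by move=> sX'; exact: (smooth_near_pair (smooth_near_cst _ _) sX').
have Dp (X' : section M) : smooth_section z X' ->
    'D_delta (fun u => (0 : V, section_rep c X' u)) (pt z) = (0, 'D_delta (section_rep c X') (pt z)).
  move=> sX'; apply: (etrans (derive_pair delta (differentiable_cst (0 : V) (pt z)) (smooth_near_diff sX'))).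
  by apply: (congr1 (fun r => (r, _))); exact: derive_cst.
have sq : smooth_near (q z) (pt z) := smooth_Fsq F a sz.
have sF := smooth_F F a sz; set Fc := fun u => F (Tuncoord c u) : R^o in sF *.
set T := fun u => 'D_(0, section_rep c X u) ('D_(0, section_rep c Y u) ('D_(0, section_rep c Z u) (q z))) u.
have [dT D3] := derive_dir3 (fV := findim_prod (findim_rV R n) (findim_rV R n))
  (fW := findim_R R) delta sq (spair _ sX) (spair _ sY) (spair _ sZ).
rewrite (Dp _ sX) (Dp _ sY) (Dp _ sZ) !at_ in D3.
have Nr : \forall u \near pt z, cartan_form F X Y Z (Tuncoord c u) = 4^-1 *: (Fc u *: T u) :> R^o.
  apply: (near_rep a) => u a' E.
  have K := cartan_chart F (X (Tuncoord c u)) (Y (Tuncoord c u)) (Z (Tuncoord c u)) a'.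
  rewrite E in K; apply: (etrans K); rewrite -mulrA; exact: erefl.
have dF := smooth_near_diff sF.
have [dFT DFT] := differentiable_scale dF dT.
have HF : 'D_delta Fc (pt z) = 0 := const_horizontal_F l.
have actE : act z (lbar F D' z) (cartan_form F X Y Z) =
    4^-1 *: (Fc (pt z) *: 'D_delta T (pt z)).
  rewrite lb; apply: (etrans (near_eq_derive delta Nr)).
  apply: (etrans (@deriveZ _ _ _ _ 4^-1 _ delta (diff_derivable dFT))).
  apply: (congr1 ( *:%R 4^-1)); apply: (etrans (DFT delta)).
  have alg (s t r : R^o) : s = 0 -> s *: t + r = r by move=> ->; rewrite scale0r add0r.
  exact: (alg _ _ _ HF).
have FE : Fc (pt z) = F z by rewrite /Fc TcoordK.
have DT : 4^-1 *: (Fc (pt z) *: 'D_delta T (pt z)) = 2^-1 * F z *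
   (half_D3 F z (0, 'D_delta (section_rep c X) (pt z)) (Y z) (Z z)
    + half_D3 F z (0, X z) ('D_delta (section_rep c Y) (pt z)) (Z z)
    + half_D3 F z (0, X z) (Y z) ('D_delta (section_rep c Z) (pt z))
    + 2^-1 * 'D_delta ('D_(0, X z) ('D_(0, Y z) ('D_(0, Z z) (q z)))) (pt z)).
  have alg (f A1 A2 A3 A4 t : R) : t = A1 + A2 + A3 + A4 ->
    4^-1 * (f * t) = 2^-1 * f * (2^-1 * A1 + 2^-1 * A2 + 2^-1 * A3 + 2^-1 * A4).
    by move=> ->; field.
  rewrite FE; exact: (alg (F z) _ _ _ _ _ D3).
have addT x x' y t : half_D3 F z (0, x + x') y t = half_D3 F z (0, x) y t + half_D3 F z (0, x') y t.
  have K := linear_add (0, x) (0, x') (half_D3_linear F sz y t).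
  have e : (0, x + x') = (0, x) + (0, x') :> VV by rewrite -[RHS]/(0 + 0, _) addr0.
  by rewrite e; exact: K.
have addT2 x y y' t : half_D3 F z (0, x) (y + y') t = half_D3 F z (0, x) y t + half_D3 F z (0, x) y' t.
  exact: (etrans (half_D3_rot F sz x (y + y') t) (etrans (addT y y' x t)
    (congr2 +%R (half_D3_rot F sz y x t) (half_D3_rot F sz y' x t)))).
have addT3 x y t t' : half_D3 F z (0, x) y (t + t') = half_D3 F z (0, x) y t + half_D3 F z (0, x) y t'.
  exact: (etrans (half_D3_sym F sz (0, x) y (t + t')) (etrans (addT2 x t t' y)
    (congr2 +%R (half_D3_sym F sz (0, x) t y) (half_D3_sym F sz (0, x) t' y)))).
have CE (x y t : V) : cartan F z x y t = 2^-1 * F z * half_D3 F z (0, x) y t := cartanE F z x y t.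
have c1 := congr1 (fun r => cartan F z r (Y z) (Z z)) (covE _ sX).
have c2 := congr1 (fun r => cartan F z (X z) r (Z z)) (covE _ sY).
have c3 := congr1 (fun r => cartan F z (X z) (Y z) r) (covE _ sZ).
have c1' := etrans c1 (etrans (CE _ _ _) (congr1 ( *%R _) (addT _ _ (Y z) (Z z)))).
have c2' := etrans c2 (etrans (CE _ _ _) (congr1 ( *%R _) (addT2 (X z) _ _ (Z z)))).
have c3' := etrans c3 (etrans (CE _ _ _) (congr1 ( *%R _) (addT3 (X z) (Y z) _ _))).
have DT' := etrans actE (etrans DT
  (congr1 (fun r => 2^-1 * F z * (_ + _ + _ + r)) (const_half_D3 l (X z) (Y z) (Z z)))).
(* Here k is F/2, the A's come from differentiating the components of X, Y, Z and the B's from the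
   action of Gamma on them; [const_half_D3] supplies the B's in reverse order. *)
have alg (k A1 A2 A3 B1 B2 B3 t t1 t2 t3 : R) : t = k * (A1 + A2 + A3 + (B3 + B2 + B1)) ->
  t1 = k * (A1 + B1) -> t2 = k * (A2 + B2) -> t3 = k * (A3 + B3) -> t - t1 - t2 - t3 = 0.
  by move=> -> -> -> ->; ring.
exact: (alg _ _ _ _ _ _ _ _ _ _ _ DT' c1' c2' c3').
Qed.

End OneConnection.

(** The vanishing is kept for all smooth sections and all points at once: the induction inserts
    covariant derivatives of the sections and differentiates the previous form around [z]. *)
Lemma cartan_dot_eq0 (D : connection M) : torsion_eq F D (@tensor0 R n M) ->
  (forall z X Y Z, slit z -> smooth_section z X -> smooth_section z Y -> smooth_section z Z ->
    dot F D (cartan_form F) X Y Z z = 0) ->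
  forall j z X Y Z, slit z -> smooth_section z X -> smooth_section z Y -> smooth_section z Z ->
    cartan_dot F D j.+1 X Y Z z = 0.
Proof.
move=> tor H1 j; elim: j => [|j IH] z X Y Z sz sX sY sZ; first exact: H1.
have sl := smooth_lbar tor sz.
have k1 : act z (lbar F D z) (cartan_dot F D j.+1 X Y Z) = 0.
  rewrite -[RHS](act_cst z (lbar F D z) 0); apply: act_ext.
  have N := near_TMI (near_slit sz) (near_TMI (near_smooth_section sX)
    (near_TMI (near_smooth_section sY) (near_smooth_section sZ))).
  by apply: near_TMS N => z' [sz' [sX' [sY' sZ']]]; exact: IH.
have k2 := IH z _ _ _ sz (cov_smooth D sz sl sX) sY sZ.
have k3 := IH z _ _ _ sz sX (cov_smooth D sz sl sY) sZ.
have k4 := IH z _ _ _ sz sX sY (cov_smooth D sz sl sZ).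
have alg (r s t t' : R) : r = 0 -> s = 0 -> t = 0 -> t' = 0 -> r - s - t - t' = 0.
  by move=> -> -> -> ->; rewrite !subr0.
exact: (alg _ _ _ _ k1 k2 k3 k4).
Qed.

(** * The difference between D and the Chern connection *)

Section Comparison.
Variables (m : nat) (kappa : 'I_m -> R) (D D0 : connection M).
Hypothesis tor : torsion_eq F D (@tensor0 R n M).
Hypothesis me : metric_eq F D (berwald_type_tensor F D kappa) (@tensor0 R n M).
Hypothesis tor0 : torsion_eq F D0 (@tensor0 R n M).
Hypothesis E0 : forall z a x y, slit z -> nabla_g F D0 z a x y = 0.

Section Point.
Variables (z : TM) (sz : slit z).
Let C a x := Gamma D z a x - Gamma D0 z a x.
Let v := vec z.
Let E := nabla_g F D z.

Let C_sym a x : C a x = C x a.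
Proof. by rewrite /C (Gamma_sym tor a x sz) (Gamma_sym tor0 a x sz). Qed.

(** The difference of the two metric equations. The two horizontal lifts of [a] differ by a vertical
    vector, minus C(a, v), which accounts for the Cartan term. *)
Let B_eq a x y : gform F z (C a x) y + gform F z x (C a y) = - E a x y - half_D3 F z (0, C a v) x y.
Proof.
have e0 := E0 a x y sz; rewrite /nabla_g in e0.
have dec : (a, - Gamma D z a v) = (a, - Gamma D0 z a v) + (0, - C a v) :> VV.
  by rewrite -[RHS]/(a + 0, _ + _) addr0 /C opprB addrA addNr add0r.
have K := linear_add (a, - Gamma D0 z a v) (0, - C a v) (half_D3_linear F sz x y).
have e4 : (0, - C a v) = - (0, C a v) :> VV by rewrite -[RHS]/(- 0, _) oppr0.
have K2 := linear_opp (0, C a v) (half_D3_linear F sz x y).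
have e1 : half_D3 F z (a, - Gamma D z a v) x y = half_D3 F z (a, - Gamma D0 z a v) x y - half_D3 F z (0, C a v) x y.
  rewrite dec; apply: (etrans K); apply: (congr1 (fun r => _ + r)).
  by rewrite e4; exact: K2.
have gsub r r' t : gform F z (r - r') t = gform F z r t - gform F z r' t.
  exact: (etrans (gform_addl F sz r (- r') t) (congr1 (fun w => _ + w) (gform_oppl F sz r' t))).
have g1 := gsub (Gamma D z a x) (Gamma D0 z a x) y.
have g2 := gsub (Gamma D z a y) (Gamma D0 z a y) x.
have g2' := etrans (gform_sym F sz x (C a y)) g2.
have f1 := gform_sym F sz x (Gamma D z a y); have f2 := gform_sym F sz x (Gamma D0 z a y).
have alg (t t0 t' g h gx hx gxs hxs c1 c2 : R) : t0 - h - hxs = 0 -> t = t0 - t' ->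
    gxs = gx -> hxs = hx -> c1 = g - h -> c2 = gx - hx -> c1 + c2 = - (t - g - gxs) - t'.
  move=> H -> -> e5 -> ->; rewrite e5 in H; rewrite -[LHS]subr0 -H; ring.
exact: (alg _ _ _ _ _ _ _ _ _ _ _ e0 e1 f1 f2 g1 g2').
Qed.

(** Koszul's permutation trick. On the right C occurs only with [v] as an argument, inside Cartan
    terms that vanish once another slot holds [v]. Hence two slots equal to [v] give C(v, v) = 0,
    and then one slot gives C(a, v) = 0. *)
Let C_eq a x y : 2 * gform F z (C a x) y = - E a x y
  - half_D3 F z (0, C a v) x y - half_D3 F z (0, C x v) a y + half_D3 F z (0, C y v) a x.
Proof.
have b1 := B_eq a x y; have b2 := B_eq x a y; have b3 := B_eq y a x.
rewrite (gform_sym F sz x (C a y)) in b1.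
rewrite (C_sym x a) (gform_sym F sz a (C x y)) in b2.
rewrite (C_sym y a) (gform_sym F sz a (C y x)) (C_sym y x) in b3.
have s1 : E x a y = E a x y := nabla_g_sym12 tor me x a y sz.
have s2 : E y a x = E a x y.
  exact: (etrans (nabla_g_sym12 tor me y a x sz) (nabla_g_sym23 tor me a y x sz)).
rewrite s1 in b2; rewrite s2 in b3.
have alg (g1 g2 g3 e t1 t2 t3 : R) : g1 + g2 = - e - t1 -> g1 + g3 = - e - t2 ->
  g2 + g3 = - e - t3 -> 2 * g1 = - e - t1 - t2 + t3.
  move=> h1 h2 h3; have -> : 2 * g1 = (g1 + g2) + (g1 + g3) - (g2 + g3) by ring.
  by rewrite h1 h2 h3; ring.
exact: (alg _ _ _ _ _ _ _ b1 b2 b3).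
Qed.

Let half_D3v2 w x : half_D3 F z (0, w) v x = 0.
Proof. exact: (etrans (half_D3_rot F sz w v x) (half_D3_vec F sz w x)). Qed.

Let half_D3v3 w x : half_D3 F z (0, w) x v = 0.
Proof. exact: (etrans (half_D3_sym F sz (0, w) x v) (half_D3v2 w x)). Qed.

Let E_vec2 a y : E a v y = 0.
Proof. exact: (etrans (nabla_g_sym12 tor me a v y sz) (nabla_g_vec tor me a y sz)). Qed.

Let gform_half x : (forall y, 2 * gform F z x y = 0) -> x = 0.
Proof.
move=> H; apply: (@gform_eq0 _ _ _ F z sz) => y; have /eqP := H y.
by rewrite mulf_eq0 pnatr_eq0 /= => /eqP.
Qed.

Let C_vv : C v v = 0.
Proof.
have alg (g e t1 t2 t3 : R) : 2 * g = - e - t1 - t2 + t3 -> e = 0 -> t1 = 0 -> t2 = 0 ->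
    t3 = 0 -> 2 * g = 0 by move=> -> -> -> -> ->; ring.
apply: gform_half => y.
exact: (alg _ _ _ _ _ (C_eq v v y) (E_vec2 v y) (half_D3v2 _ y) (half_D3v2 _ y) (half_D3v2 _ v)).
Qed.

Lemma C_vec a : C a v = 0.
Proof.
have alg (g e t1 t2 t3 : R) : 2 * g = - e - t1 - t2 + t3 -> e = 0 -> t1 = 0 -> t2 = 0 ->
    t3 = 0 -> 2 * g = 0 by move=> -> -> -> -> ->; ring.
apply: gform_half => y; have K : half_D3 F z (0, 0) a y = 0 := linear_zero (half_D3_linear F sz a y).
have K' := etrans (congr1 (fun w => half_D3 F z (0, w) a y) C_vv) K.
exact: (alg _ _ _ _ _ (C_eq a v y) (E_vec2 a y) (half_D3v2 _ y) K' (half_D3v3 _ a)).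
Qed.

(** This is obtained while L is still unknown. It breaks the apparent circle between D and the
    A^(j), which are formed with D itself. *)
Lemma Gamma_ell xi : Gamma D z (ell F z) xi = Gamma D0 z (ell F z) xi.
Proof.
have H : Gamma D z v xi = Gamma D0 z v xi.
  by apply/eqP; rewrite -subr_eq0; apply/eqP; rewrite -/(C v xi) C_sym C_vec.
rewrite /ell (linear_scale _ _ (Gamma_linear_l tor xi sz)) (linear_scale _ _ (Gamma_linear_l tor0 xi sz)).
exact: (congr1 ( *:%R (F z)^-1) H).
Qed.

Lemma Gamma_eq : (forall a x y, nabla_g F D z a x y = 0) ->
  forall a x, Gamma D z a x = Gamma D0 z a x.
Proof.
move=> HE a x; apply/eqP; rewrite -subr_eq0; apply/eqP; rewrite -/(C a x).
have alg (g e t1 t2 t3 : R) : 2 * g = - e - t1 - t2 + t3 -> e = 0 -> t1 = 0 -> t2 = 0 ->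
    t3 = 0 -> 2 * g = 0 by move=> -> -> -> -> ->; ring.
have K r b t : half_D3 F z (0, C r v) b t = 0.
  exact: (etrans (congr1 (fun w => half_D3 F z (0, w) b t) (C_vec r)) (linear_zero (half_D3_linear F sz b t))).
apply: gform_half => y.
exact: (alg _ _ _ _ _ (C_eq a x y) (HE a x y) (K a x y) (K x a y) (K y a x)).
Qed.

End Point.

Lemma nabla_g_eq0 : (forall p, Gamma_constant D0 p) ->
  forall z a x y, slit z -> nabla_g F D z a x y = 0.
Proof.
move=> cG z a x y sz; rewrite (nabla_g_csec tor me a x y sz).
rewrite /higher_part big1 ?mulr0// => j _.
have H : forall z X Y Z, slit z -> smooth_section z X -> smooth_section z Y ->
    smooth_section z Z -> dot F D (cartan_form F) X Y Z z = 0.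
  move=> z' X Y Z sz' sX sY sZ.
  apply: (dot_cartan_eq0 sz' (cG _) _ tor _ sX sY sZ); last exact: Gamma_ell.
  by move=> z'' a' sz''; exact: E0.
have a' := in_chart_at z.
rewrite (cartan_dot_eq0 tor H j sz (smooth_csec a a') (smooth_csec x a') (smooth_csec y a')).
by rewrite mulr0.
Qed.

End Comparison.

(** The case L = 0 of [metric_tensor]. *)
Lemma chern_nabla_g (D0 : connection M) : chern F D0 ->
  forall z a x y, slit z -> nabla_g F D0 z a x y = 0.
Proof.
move=> [_ tor0 me0] z a x y sz; have ad := in_chart_at z.
have me0' : metric_eq F D0 (fun X Y Z z => cartan_form F X Y Z z + 0) (@tensor0 R n M).
  move=> z' sz' W X Y sW sX sY; rewrite addr0; exact: me0.
have K := metric_tensor (L := fun _ _ _ _ => 0) tor0 me0' sz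
  (smooth_csec a ad) (smooth_csec x ad) (smooth_csec y ad).
by rewrite /csec !tuncoord_id mulr0 in K.
Qed.

Lemma Gamma_expand (D : connection M) z a xi : torsion_eq F D (@tensor0 R n M) -> slit z ->
  Gamma D z a xi = \sum_i a 0 i *: \sum_j xi 0 j *: Gamma D z (delta_mx 0 i) (delta_mx 0 j).
Proof.
move=> tor sz; rewrite {1}(row_sum_delta a) (linear_bigsum _ _ (Gamma_linear_l tor xi sz)).
apply: eq_bigr => i _; rewrite (linear_scale _ _ (Gamma_linear_l tor xi sz)); congr (_ *: _).
rewrite {1}(row_sum_delta xi) (linear_bigsum _ _ (Gamma_linear_r D _ sz)).
by apply: eq_bigr => j _; rewrite (linear_scale _ _ (Gamma_linear_r D _ sz)).
Qed.

Lemma christoffel_own (D : connection M) p y i j k :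
  christoffel D (chart_at p) i j k (coord (chart_at p) p, y) =
  Gamma D (TPoint p y) (delta_mx 0 i) (delta_mx 0 j) 0 k.
Proof.
rewrite /christoffel Tuncoord_own /= tcoord_id.
by rewrite (@TTuncoord_id _ _ _ (TPoint p y) (delta_mx 0 i, 0)).
Qed.

Lemma christoffel_Gamma_constant (D : connection M) p : torsion_eq F D (@tensor0 R n M) ->
  (forall i j k (x y y' : V), (coord (chart_at p) @` dom (chart_at p)) x ->
    y != 0 -> y' != 0 ->
    christoffel D (chart_at p) i j k (x, y) = christoffel D (chart_at p) i j k (x, y')) ->
  Gamma_constant D p.
Proof.
move=> tor H y y' a xi y0 y0'.
rewrite (@Gamma_expand D (TPoint p y))// (@Gamma_expand D (TPoint p y'))//.
apply: eq_bigr => i _; apply: (congr1 ( *:%R _)); apply: eq_bigr => j _; apply: (congr1 ( *:%R _)).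
apply/rowP => k; rewrite -!christoffel_own; apply: H => //.
exact: coord_im.
Qed.

(** In an arbitrary chart the symbols are given by the usual transformation law: an inhomogeneous
    term in which y does not occur, plus the transform of Gamma in the preferred chart of the base
    point. *)
Lemma christoffel_constant (D : connection M) c i j k (x y y' : V) :
  torsion_eq F D (@tensor0 R n M) -> atlas c -> (coord c @` dom c) x ->
  y != 0 -> y' != 0 -> Gamma_constant D (uncoord c x) ->
  christoffel D c i j k (x, y) = christoffel D c i j k (x, y').
Proof.
move=> tor ac cx y0 y0' cG; have [d E] := uncoord_dom cx.
set p := uncoord c x in d cG *; pose c0 := chart_at p.
have fst_fiber (W : normedModType R) (h : VV -> W) (w x1 y1 : V) :
    'D_(w, 0) h (x1, y1) = 'D_w (fun x => h (x, y1)) x1.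
  apply: esym; apply: (@derive_comp_affine _ _ _ _ (fun w => (w, 0)) (fun x => (x, y1))) => r v b.
  by rewrite -[RHS]/(r *: v + b, r *: 0 + y1) scaler0 add0r.
(* The fibre coordinate 0 in the first term is a placeholder: the components of a section constant
   in [c] do not depend on it. *)
have key t : t != 0 -> christoffel D c i j k (x, t) =
    tcoord c p ('D_(tuncoord c p (delta_mx 0 i))
        (fun x1 => section_rep c0 (csec c (delta_mx 0 j)) (x1, 0)) (coord c0 p)
      + Gamma D (TPoint p (tuncoord c p t)) (tuncoord c p (delta_mx 0 i)) (tuncoord c p (delta_mx 0 j))) 0 k.
  move=> t0; have st : slit (Tuncoord c (x, t)) := fiber_slit ac cx t0.
  have sa : in_chart c (Tuncoord c (x, t)) := fiber_in_chart ac cx t.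
  have ss := smooth_csec (delta_mx 0 j : V) sa.
  set w := TTuncoord c (Tuncoord c (x, t)) (delta_mx 0 i, 0).
  have w1 : w.1 = tuncoord c p (delta_mx 0 i) by exact: (TTuncoord_fst (z := Tuncoord c (x, t)) _ ac d).
  have K := cov_own tor w st ss.
  have e0 : Tcoord c0 (Tuncoord c (x, t)) = (coord c0 p, tuncoord c p t).
    exact: (Tcoord_own (Tuncoord c (x, t))).
  have Dw : 'D_w (section_rep c0 (csec c (delta_mx 0 j))) (Tcoord c0 (Tuncoord c (x, t))) =
      'D_(tuncoord c p (delta_mx 0 i)) (fun x1 => section_rep c0 (csec c (delta_mx 0 j)) (x1, 0)) (coord c0 p).
    have l := derive_linear (smooth_near_diff ss).
    have dec : w = (w.1, 0) + (0, w.2) :> VV.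
      by rewrite [LHS]surjective_pairing -[RHS]/(_ + 0, 0 + _) addr0 add0r.
    rewrite dec; apply: (etrans (linear_add _ _ l)).
    rewrite /= -/c0 e0 section_rep_csec_vert addr0 fst_fiber w1.
    by apply: near_eq_derive; apply: filterE => x1; rewrite /section_rep /csec /=.
  rewrite Dw w1 in K.
  exact: (congr1 (fun r => tcoord c p r 0 k) K).
rewrite (key y y0) (key y' y0'); congr (tcoord c p (_ + _) 0 k).
have nz t : t != 0 -> tuncoord c p t != 0.
  move=> t0; apply: contra_neq t0 => e.
  by rewrite -(tuncoordK t ac d) e; exact: (linear_zero (tcoord_linear ac d)).
by apply: cG; exact: nz.
Qed.

End Berwald.

Theorem theorem5p2 (R : realType) (n : nat) (hn : n <> 1%N)
  (M : smoothManifold R n) (F : finsler M)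
  (m : nat) (hm : (1 <= m)%N) (kappa : 'I_m -> R)
  (D : connection M) (hD : berwald_type F D kappa) :
  hv_curvature_vanishes F D <-> berwald_metric F.
Proof.
have [fc tor me] := hD; split=> [hv|[D0 [fc0 tor0 me0] ch]].
  have cG p : Gamma_constant D p.
    by move=> y y' a xi y0 y0'; exact: (Gamma_const_curvature tor p a xi hn hv y0 y0').
  have Ez z a x y : slit z -> nabla_g F D z a x y = 0.
    move=> sz; apply: (const_nabla_g sz (cG _)) => z' a' sz'.
    (* Symmetry brings y into the first slot, where the derivative of g vanishes whatever L is. *)
    rewrite (nabla_g_sym12 tor me _ _ _ sz'); exact: (nabla_g_vec tor me).
  exists D.
    split=> //; apply: (metric_eqE tor) => z W X Y sz sW sX sY; split; first exact: Ez.
    by [].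
  move=> c ac i j k x y y' cx y0 y0'.
  exact: (christoffel_constant i j k tor ac cx y0 y0' (cG _)).
have E0 := chern_nabla_g (And3 fc0 tor0 me0).
have cG0 p : Gamma_constant D0 p.
  apply: (christoffel_Gamma_constant tor0) => i j k x y y'; exact: ch.
have Ez := nabla_g_eq0 tor me tor0 E0 cG0.
move=> z sz X Y Z sX sY sZ.
apply: (curvature_Gamma_const tor sz sX sY sZ) => y x xi y0.
have G z' (sz' : slit z') := Gamma_eq tor me tor0 E0 sz' (fun a x y => Ez z' a x y sz').
have sy : slit (TPoint (base z) y : tangent_bundle M) by exact: y0.
rewrite (G _ sy) (G _ sz).
have -> : Gamma D0 z = Gamma D0 (TPoint (base z) (vec z)) by case: z {sz X Y Z sX sY sZ sy}.
exact: (cG0 (base z)).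
Qed.
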